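(* In the Laguerre I setting of the context, let $L_1^{\mathrm L},\dots,L_p^{\mathrm L}$ be the lower bidiagonal factors (unit main diagonal) of the step-line recurrence matrix $T^{\mathrm L}=L_1^{\mathrm L}\cdots L_p^{\mathrm L}U_q^{\mathrm L}\cdots U_1^{\mathrm L}$ described in the context. Write $N=pu_N+\ell_N=qv_N+j_N$ with $0\le\ell_N\le p-1$, $0\le j_N\le q-1$, $\chi_N=j_N+1$, $\boldsymbol d_N=\boldsymbol\sigma_p(N+1)$. If $r=0$, then for $k\in\{1,\dots,p\}$ and $N\in\mathbb N_0$ $$(L_k^{\mathrm L})_{N+1,N}=\beta_{k+\ell_N+1}-\beta_k+u_N.$$ If $r>0$, then for $k\in\{1,\dots,p\}$ and $N\in\mathbb N_0$ $$(L_k^{\mathrm L})_{N+1,N}=\begin{cases}-\dfrac{g_{N+1}^{\mathrm L,[k-1]}}{g_N^{\mathrm L,[k]}}\dfrac{\beta_{k+\ell_N+1}-\beta_k+u_N}{\beta_{k+\ell_N+1}+u_N+1+b_{\chi_N}+v_N},&\chi_N\in\{1,\dots,r-1\},\\[12pt]-\dfrac{(-1)^{N+2}}{g_N^{\mathrm L,[k]}}\dfrac{\beta_{k+\ell_N+1}-\beta_k+u_N}{\beta_{k+\ell_N+1}+u_N+1+b_r+v_N},&\chi_N=r,\\[12pt]\beta_{k+\ell_N+1}-\beta_k+u_N,&\chi_N\in\{r+1,\dots,q-1\},\\[4pt]-\dfrac{g_{N+1}^{\mathrm L,[k-1]}}{(-1)^{N+1}}\bigl(\beta_{k+\ell_N+1}-\beta_k+u_N\bigr),&\chi_N=q,\end{cases}$$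 where every $g_M^{\mathrm L,[a]}$ appearing here (necessarily with $\chi_M\le r$) is $$g_M^{\mathrm L,[a]}=-\frac{(\boldsymbol a-(b_{\chi_M}+v_M)\mathbf 1_q)_{v_M}\prod_{h=1}^{\chi_M-1}(b_h-b_{\chi_M})}{(\boldsymbol\beta^{[a]}+(b_{\chi_M}+v_M+1)\mathbf 1_p)_{\boldsymbol d_M}},$$ and cases with empty ranges of $\chi_N$ are omitted.
   Context: Conventions. $(c)_k=c(c+1)\cdots(c+k-1)$; for vectors, $\Gamma(\boldsymbol c)=\prod\Gamma(c_i)$, $(\boldsymbol c)_k=\prod(c_i)_k$, $(\boldsymbol c)_{\boldsymbol\nu}=\prod(c_i)_{\nu_i}$; $\mathbf 1_d=(1,\dots,1)$; $\boldsymbol e_h$ coordinate vector. $\boldsymbol\sigma_d(N)\in\mathbb N_0^d$: if $N=dm+j$, $0\le j<d$, the first $j$ entries are $m+1$, the rest $m$. Laguerre I setting. $p\ge1$, $q=r+s$, $r\ge0$, $s\ge1$, $\boldsymbol a\in(-1,\infty)^q$, $\boldsymbol b\in(-1,\infty)^r$, $a_h<b_h$ ($h\le r$), $\boldsymbol\beta\in\mathbb R^p$ with $\beta_i+a_\rho>-1$ for all $i,\rho$. $\mathcal B_{a,b}(x)=x^a(1-x)^{b-a-1}/\Gamma(b-a)$ on $(0,1)$, $0$ elsewhere; $\mathcal G_a(x)=x^ae^{-x}$ on $(0,\infty)$; $(f*g)(x)=\int_0^\infty f(t)g(x/t)dt/t$; $w_0(x;\boldsymbol a,\boldsymbol b)=\mathcal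 B_{a_1,b_1}*\cdots*\mathcal B_{a_r,b_r}*\mathcal G_{a_{r+1}}*\cdots*\mathcal G_{a_q}$; $w_h=w_0(\cdot;\boldsymbol a,\boldsymbol b+\boldsymbol e_h)$ ($h\le r$), $v_\ell=(-x\frac d{dx})^{\ell-1}w_0$ ($\ell\le s$), $(U_1,\dots,U_q)=(w_1,\dots,w_r,v_1,\dots,v_s)$. Nonresonance: $\beta_i-\beta_h\notin\mathbb Z$ ($i\ne h$), $b_h\ne b_j$ ($h\ne j$), $b_h+v\ne a_\rho$ for all integers $v\ge1$. Cyclic extension and shift: $\beta_{sp+i}=\beta_i+s$ for $s\in\mathbb N_0$, $1\le i\le p$; $\boldsymbol\beta^{[k]}=(\beta_{k+1},\dots,\beta_{k+p})$. Step-line forms of the system with power vector $(x^{\beta^{[k]}_1},\dots,x^{\beta^{[k]}_p})$ and the same weights: with $\boldsymbol n_N$ the first $r$ entries of $\boldsymbol\sigma_q(N)$, $$\widehat{\mathcal A}_N^{[k]}(x)=\frac1{2\pi\mathrm i}\int_\Sigma\frac{\Gamma(t\mathbf 1_r+\boldsymbol b+\boldsymbol n_N+\mathbf 1_r)}{\Gamma(t\mathbf 1_q+\boldsymbol a+\mathbf 1_q)}\frac{x^t}{\prod_{i=1}^p(\beta_i^{[k]}-t)_{\boldsymbol\sigma_p(N+1)_i}}dt=\sum_{i=1}^p\mathscr A_N^{[k],(i)}(x)x^{\beta_i^{[k]}},$$ $\Sigma$ enclosing exactly the zeros of $\prod_i(\beta_i^{[k]}-t)_{\boldsymbol\sigma_p(N+1)_i}$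 and no other pole; $g_N^{\mathrm L,[k]}=\int_0^\infty x^{v_N}\widehat{\mathcal A}_N^{[k]}(x)U_{\chi_N}(x)dx$; normalized form $\mathcal A_N^{[k]}=\widehat{\mathcal A}_N^{[k]}/g_N^{\mathrm L,[k]}$ with components $A_N^{[k],(i)}$. Recurrence matrix and factors. Let $\mathscr M$ be the semi-infinite matrix with entry $\int_0^\infty x^{u+v+\beta_i}U_j(x)dx$ in row $qu+j-1$ and column $pv+i-1$; $\mathscr M=\mathscr L^{-1}\mathscr U^{-1}$ its Gauss–Borel factorization ($\mathscr L$ lower unitriangular, $\mathscr U$ upper triangular); $T^{\mathrm L}=\mathscr L\Lambda^q\mathscr L^{-1}$ with $\Lambda_{N,N+1}=1$ and other entries $0$. In the Christoffel–Gauss–Borel bidiagonal factorization $T^{\mathrm L}=L_1^{\mathrm L}\cdots L_p^{\mathrm L}U_q^{\mathrm L}\cdots U_1^{\mathrm L}$, $L_k^{\mathrm L}$ is lower bidiagonal with unit diagonal and $$(L_k^{\mathrm L})_{N+1,N}=\frac{\operatorname{LC}\bigl(A_N^{[k],(\ell_N+1)}\bigr)}{\operatorname{LC}\bigl(A_{N+1}^{[k-1],(\ell_{N+1}+1)}\bigr)},$$ $\operatorname{LC}$ denoting the leading coefficient (coefficient of the maximal degree $\boldsymbol\sigma_p(N+1)_{\ell_N+1}-1$, resp. $\boldsymbol\sigma_p(N+2)_{\ell_{N+1}+1}-1$), and the $U_b^{\mathrm L}$ are upper bidiagonal with unit first superdiagonal. Standing assumption: all leading principal minors of the moment matrices along the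 Christoffel chains (power vectors $\boldsymbol\beta^{[k]}$, $0\le k\le p$; and row-shifted matrices $\Lambda^b\mathscr M$, $0\le b\le q$) are nonzero, i.e. normality and nonzero pivots, and all denominators in the displayed formulas are nonzero. *)

(* Defs.v *)
From HB Require Import structures.
From mathcomp Require Import all_boot all_order all_algebra archimedean.
From mathcomp Require Import all_classical all_reals all_analysis.
From mathcomp Require Import complex.

Set Implicit Arguments.
Unset Strict Implicit.
Unset Printing Implicit Defensive.

Import Order.TTheory GRing.Theory Num.Theory numFieldNormedType.Exports.

Local Open Scope classical_set_scope.
Local Open Scope ring_scope.
Local Open Scope complex_scope.

(* Vectors are tuples, read with nth: the entry c_h of the text (h >= 1) is
   [c`_h.-1].  Matrix rows and columns, N and the shift k start at 0; chi_N,
   the indices of the factors L_k and U_c, and the argument n of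
   [beta_ext beta n] start at 1, as in the text. *)

Definition poch (K : nzRingType) (c : K) (k : nat) : K :=
  \prod_(i < k) (c + i%:R).

(* Entry of index i (from 0) of the balanced vector sigma_d(N). *)
Definition step_sigma (d N i : nat) : nat := N %/ d + (i < N %% d).

Definition step_chi (q N : nat) : nat := (N %% q).+1.

Section ComplexAnalysis.
Variable R : realType.
Implicit Types (x : R) (z : R[i]).

(* x^z for a real base x > 0, principal determination. *)
Definition cpow x z : R[i] :=
  (expR (complex.Re z * ln x))%:C *
  (cos (complex.Im z * ln x) +i* sin (complex.Im z * ln x)).

(* R[i] carries no canonical topology here: limits are taken componentwise. *)
Definition clim (u : nat -> R[i]) : R[i] :=
  lim ((fun n => complex.Re (u n)) @ \oo)
  +i* lim ((fun n => complex.Im (u n)) @ \oo).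

(* Euler-Gauss limit  Gamma(z) = lim n! n^z / (z (z+1) ... (z+n)).  As 0^-1 = 0,
   it is 0 at the poles z = 0, -1, ..., hence (cGamma z)^-1 is the entire
   function 1/Gamma everywhere. *)
Definition cGamma z : R[i] :=
  clim (fun n => n`!%:R * cpow n%:R z / poch z n.+1).

Definition rGamma x : R := complex.Re (cGamma x%:C).

Definition C1 (f : R -> R) : Prop :=
  (forall t, derivable f t 1) /\ continuous (derive1 f).

(* Arcs are parametrized by [0, 1] and C^1 there; asking it on all of R is no
   restriction, since a C^1 map on [0, 1] has a C^1 extension. *)
Definition C1_arc (g : R -> R[i]) : Prop :=
  C1 (fun t => complex.Re (g t)) /\ C1 (fun t => complex.Im (g t)).

(* A closed piecewise C^1 contour is the sequence of its consecutive arcs. *)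
Definition contour := seq (R -> R[i]).

Definition closed_contour (S : contour) : Prop :=
  (forall j, (j < size S)%N -> C1_arc (nth (fun=> 0) S j)) /\
  path.cycle (fun g h : R -> R[i] => g 1 == h 0) S.

Definition on_contour (S : contour) z : Prop :=
  exists2 j, (j < size S)%N &
  exists2 t : R, 0 <= t <= 1 & nth (fun=> 0) S j t = z.

Definition arc_derive (g : R -> R[i]) (t : R) : R[i] :=
  derive1 (fun u => complex.Re (g u)) t +i* derive1 (fun u => complex.Im (g u)) t.

Definition contour_integral (S : contour) (f : R[i] -> R[i]) : R[i] :=
  \sum_(g <- S)
    ((\int[lebesgue_measure]_(t in `[0%R, 1%R])
        complex.Re (f (g t) * arc_derive g t)) +i*
     (\int[lebesgue_measure]_(t in `[0%R, 1%R])
        complex.Im (f (g t) * arc_derive g t))).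

Definition winding (S : contour) z : R[i] :=
  (2 * pi%:C * (0 +i* 1))^-1 * contour_integral S (fun t => (t - z)^-1).

Definition encloses (S : contour) z : Prop :=
  ~ on_contour S z /\ winding S z = 1.

Definition leaves_out (S : contour) z : Prop :=
  ~ on_contour S z /\ winding S z = 0.

End ComplexAnalysis.

Section Weights.
Variable R : realType.
Implicit Types (f g : R -> R) (x : R).

Definition beta_factor (a b x : R) : R :=
  if 0 < x < 1 then x `^ a * (1 - x) `^ (b - a - 1) / rGamma (b - a) else 0.

Definition gamma_factor (a x : R) : R :=
  if 0 < x then x `^ a * expR (- x) else 0.

Definition mellin_conv f g x : R :=
  \int[lebesgue_measure]_(t in `]0%R, +oo[) (f t * g (x / t) / t).

Definition mellin_convs (fs : seq (R -> R)) : R -> R :=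
  if fs is f :: fs' then foldl mellin_conv f fs' else (fun=> 0).

Definition w0 (q r : nat) (a : q.-tuple R) (b : r.-tuple R) : R -> R :=
  mellin_convs ([seq beta_factor a`_h b`_h | h <- iota 0 r] ++
                [seq gamma_factor a`_h | h <- iota r (q - r)]).

Definition add_unit (r : nat) (b : r.-tuple R) (h : nat) : r.-tuple R :=
  [tuple b`_i + (i == h :> nat)%:R | i < r].

Definition euler_op f : R -> R := fun x => - x * derive1 f x.

(* The weight U_j, for 1 <= j <= q. *)
Definition weight (q r : nat) (a : q.-tuple R) (b : r.-tuple R) (j : nat) :
    R -> R :=
  if (j <= r)%N then w0 a (add_unit b j.-1)
  else iter (j - r).-1 euler_op (w0 a b).

(* [beta_ext beta (t * p + i)] is beta_i + t for 1 <= i <= p. *)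
Definition beta_ext (p : nat) (beta : p.-tuple R) (n : nat) : R :=
  beta`_(n.-1 %% p) + (n.-1 %/ p)%:R.

Definition beta_shift (p : nat) (beta : p.-tuple R) (k : nat) : p.-tuple R :=
  [tuple beta_ext beta (k + i.+1) | i < p].

End Weights.

Record laguerreI_setting (R : realType) (p q r s : nat) (a : q.-tuple R)
    (b : r.-tuple R) (beta : p.-tuple R) : Prop := LaguerreISetting {
  lag_p_gt0 : (0 < p)%N;
  lag_q : q = (r + s)%N;
  lag_s_gt0 : (0 < s)%N;
  lag_a : forall i, (i < q)%N -> -1 < a`_i;
  lag_b : forall h, (h < r)%N -> -1 < b`_h;
  lag_ab : forall h, (h < r)%N -> a`_h < b`_h;
  lag_beta : forall i j, (i < p)%N -> (j < q)%N -> -1 < beta`_i + a`_j;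
  lag_beta_nonres : forall i h, (i < p)%N -> (h < p)%N -> i != h ->
    beta`_i - beta`_h \isn't a Num.int;
  lag_b_neq : forall h j, (h < r)%N -> (j < r)%N -> h != j -> b`_h != b`_j;
  lag_ba_nonres : forall h j v, (h < r)%N -> (j < q)%N -> (0 < v)%N ->
    b`_h + v%:R != a`_j
}.

Section SemiInfinite.
Variable R : realType.

Definition smx := nat -> nat -> R.
Implicit Types A B M : smx.

(* Finite-support sum: all the products below are between matrices for which
   only finitely many terms of each entry are nonzero. *)
Definition smx_mul A B : smx := fun i j => \sum_(k \in [set: nat]) (A i k * B k j).

Definition smx_one : smx := fun i j => (i == j)%:R.

Definition smx_exp A (n : nat) : smx := iter n (smx_mul A) smx_one.

Definition Lambda : smx := fun i j => (j == i.+1)%:R.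

Definition leading_minor M (n : nat) : R := \det (\matrix_(i < n, j < n) M i j).

Definition lower_unitri A : Prop :=
  (forall i, A i i = 1) /\ (forall i j, (i < j)%N -> A i j = 0).

Definition upper_tri A : Prop := forall i j, (j < i)%N -> A i j = 0.

Definition inverse_of A B : Prop :=
  smx_mul A B =2 smx_one /\ smx_mul B A =2 smx_one.

(* M = L^-1 U^-1, with Li and Ui the (triangular) inverses of L and U. *)
Record gauss_borel M (L Li U Ui : smx) : Prop := GaussBorel {
  gb_L : lower_unitri L;
  gb_Li : lower_unitri Li;
  gb_U : upper_tri U;
  gb_Ui : upper_tri Ui;
  gb_LLi : inverse_of L Li;
  gb_UUi : inverse_of U Ui;
  gb_M : M =2 smx_mul Li Ui
}.

Definition recurrence_matrix (q : nat) (L Li : smx) : smx :=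
  smx_mul (smx_mul L (smx_exp Lambda q)) Li.

Definition lower_bidiag_unit A : Prop :=
  (forall i, A i i = 1) /\ (forall i j, j != i -> i != j.+1 -> A i j = 0).

Definition upper_bidiag_unit A : Prop :=
  (forall i, A i i.+1 = 1) /\ (forall i j, j != i -> j != i.+1 -> A i j = 0).

(* The row qu + j - 1 is paired with x^u U_j, the column pv + i - 1 with
   x^(v + bet_i). *)
Definition moment_matrix (p q r : nat) (a : q.-tuple R) (b : r.-tuple R)
    (bet : p.-tuple R) : smx := fun m n =>
  \int[lebesgue_measure]_(x in `]0%R, +oo[)
    (x `^ ((m %/ q)%:R + (n %/ p)%:R + bet`_(n %% p)) *
     weight a b (m %% q).+1 x).

Definition normality (p q r : nat) (a : q.-tuple R) (b : r.-tuple R)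
    (beta : p.-tuple R) : Prop :=
  (forall k n, (k <= p)%N ->
     leading_minor (moment_matrix a b (beta_shift beta k)) n != 0) /\
  (forall c n, (c <= q)%N ->
     leading_minor (smx_mul (smx_exp Lambda c) (moment_matrix a b beta)) n != 0).

End SemiInfinite.

(* In this section [bet] stands for the power vector beta^[k]. *)
Section StepLine.
Variables (R : realType) (p q r : nat).
Variables (a : q.-tuple R) (b : r.-tuple R) (bet : p.-tuple R).
Implicit Types (S : contour R) (N : nat) (A : p.-tuple {poly R}).

Definition form_num N (t : R[i]) : R[i] :=
  \prod_(h < r) cGamma (t + (b`_h + (step_sigma q N h)%:R + 1)%:C).

Definition form_den N (t : R[i]) : R[i] :=
  \prod_(i < p) poch ((bet`_i)%:C - t) (step_sigma p N.+1 i).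

Definition form_kernel N (t : R[i]) : R[i] :=
  form_num N t / \prod_(j < q) cGamma (t + (a`_j + 1)%:C) / form_den N t.

Definition form_pole N (t : R[i]) : Prop :=
  exists2 h, (h < r)%N &
  exists m : nat, t + (b`_h + (step_sigma q N h)%:R + 1)%:C = - m%:R.

(* Sigma encloses exactly the zeros of the denominator and no other pole of
   the integrand. *)
Definition admissible_contour S N : Prop :=
  [/\ closed_contour S,
      forall t, form_den N t = 0 -> encloses S t
    & forall t, form_pole N t -> leaves_out S t].

Definition form_hat S N (x : R) : R[i] :=
  (2 * pi%:C * (0 +i* 1))^-1 *
  contour_integral S (fun t => form_kernel N t * cpow x t).

Definition form_components S N A : Prop :=
  forall x : R, 0 < x ->
    form_hat S N x = (\sum_(i < p) (A`_i).[x] * x `^ bet`_i)%:C.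

(* The form is real valued (see [form_components]), so Re loses nothing. *)
Definition g_norm S N : R :=
  \int[lebesgue_measure]_(x in `]0%R, +oo[)
    (x ^+ (N %/ q) * complex.Re (form_hat S N x) * weight a b (step_chi q N) x).

Definition normalized S N A : p.-tuple {poly R} :=
  [tuple (g_norm S N)^-1 *: A`_i | i < p].

End StepLine.

(* Leading coefficient of the component of index l_N + 1, where N = p u_N + l_N:
   its maximal degree is the entry of index l_N + 1 of sigma_p(N+1), minus 1. *)
Definition LC (R : realType) (p N : nat) (A : p.-tuple {poly R}) : R :=
  (A`_(N %% p))`_((step_sigma p N.+1 (N %% p)).-1).

(* The bidiagonal factors are not determined by T alone; they are singled out
   by the entries of the L_k.  [lc k N] stands for the leading coefficient of the
   component of index l_N + 1 of the normalized form of shift k. *)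
Record CGB_factorization (R : realType) (p q : nat) (T : smx R)
    (lc : nat -> nat -> R) (L U : nat -> smx R) : Prop := CGBFactorization {
  cgb_L : forall k, (1 <= k <= p)%N -> lower_bidiag_unit (L k);
  cgb_U : forall c, (1 <= c <= q)%N -> upper_bidiag_unit (U c);
  cgb_T : T =2 smx_mul
    (\big[@smx_mul R/@smx_one R]_(1 <= k < p.+1) L k)
    (\big[@smx_mul R/@smx_one R]_(0 <= c < q) U (q - c)%N);
  cgb_lc : forall k N, (1 <= k <= p)%N ->
    lc k.-1 N.+1 != 0 /\ L k N.+1 N = lc k N / lc k.-1 N.+1
}.

(* Main.v *)
(* Put z_n = beta_{k+n+1}, so that the denominator of the kernel of the form of
   index N and shift k is, up to sign, the product of the N + 1 simple factors
   t - z_n.  The residue theorem turns the form into a sum of c_n x^(z_n), and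
   its leading coefficient LC is c_N, since distinct powers of x are linearly
   independent.  In c_N^[k] / c_(N+1)^[k-1] everything cancels but one difference
   of exponents and, when chi_N <= r, one factor of a Gamma quotient: this is the
   stated entry up to the ratio of the norms g.

   Mellin transforms multiply under convolution and the Euler operator multiplies
   the moment of order t by t + 1, so the moments of the weights are Gamma
   quotients.  Hence g_N is, up to sign, the sum over n of
   P(z_n) / prod_(m <> n) (z_n - z_m) for a monic P of degree N, divided by
   z_n + b + v + 1 when chi_N <= r.  Lagrange interpolation at z_0, ..., z_N gives
   the leading coefficient 1 of P in the first case; in the second one it is
   applied with the additional node -(b + v + 1) and gives 0, whence g_N is minus
   the term of that node.

   Gamma is only known as the Euler-Gauss limit.  Its integral representation
   comes from the Bohr-Mollerup theorem.  For the residues, the Gauss products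
   are exponentials times rational functions, and exponentials are limits of
   polynomials; so only rational functions have to be integrated over the
   contour, where the winding number decides, and uniform bounds allow to pass to
   the limit without any Cauchy theory. *)

(* All that is needed about Gamma rests on one estimate: consecutive Gauss products differ by a
   factor 1 + O(1/n^2), uniformly on discs, with an error dominated by the telescoping difference
   K/n - K/(n+1). Convergence, upper bounds and lower bounds follow at once. At finite rank the
   integrand of a form has finitely many poles, each left out by the contour or a node, and the
   limit is taken on both sides of the residue formula. Integrals of nonnegative functions are
   compared in the extended reals, so that an integration by parts can be used before finiteness is
   known and then helps to prove it. Among the weights only iterates of the Euler operator may
   change sign; they are rewritten as combinations of convolutions with shifted Gamma factors, which
   keeps boundary terms out of their moments. The cases of the statement are a single identity with
   a ratio of two norms g and an optional denominator. They differ in which norms reduce to a sign,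
   and this depends on how the residues of N and N + 1 modulo q compare with r. *)
Require Import Defs.
From HB Require Import structures.
From mathcomp Require Import all_boot all_order all_algebra archimedean.
From mathcomp Require Import all_classical all_reals all_analysis.
From mathcomp Require Import complex measurable_realfun.
From mathcomp Require Import ring lra zify.
Import Order.TTheory GRing.Theory Num.Theory numFieldNormedType.Exports.
Import Normc.
Set Implicit Arguments.
Unset Strict Implicit.
Unset Printing Implicit Defensive.
Local Open Scope classical_set_scope.
Local Open Scope ring_scope.
Local Open Scope complex_scope.

(** * Complex limits and exponentials *)

Section ComplexLimits.
Variable R : realType.
Local Notation C := R[i].
Local Notation Re := (@complex.Re R).
Local Notation Im := (@complex.Im R).

(** An arbitrary filter serves both sequences ([\oo]) and continuity along an arc ([within]
    filters). *)
Definition ccvg {T : Type} (F : set_system T) (u : T -> C) (l : C) : Prop :=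
  (Re (u x) @[x --> F] --> Re l) /\ (Im (u x) @[x --> F] --> Im l).

Lemma cReM (z w : C) : Re (z * w) = Re z * Re w - Im z * Im w.
Proof. by case: z => a b; case: w. Qed.

Lemma cImM (z w : C) : Im (z * w) = Re z * Im w + Im z * Re w.
Proof. by case: z => a b; case: w. Qed.

Lemma cReV (z : C) : Re z^-1 = Re z / (Re z ^+ 2 + Im z ^+ 2).
Proof. by case: z. Qed.

Lemma cImV (z : C) : Im z^-1 = - Im z / (Re z ^+ 2 + Im z ^+ 2).
Proof. by case: z => a b; rewrite /= mulNr. Qed.

Lemma cReD (z w : C) : Re (z + w) = Re z + Re w.
Proof. by case: z; case: w. Qed.

Lemma cImD (z w : C) : Im (z + w) = Im z + Im w.
Proof. by case: z; case: w. Qed.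

Lemma cReN (z : C) : Re (- z) = - Re z.
Proof. by case: z. Qed.

Lemma cImN (z : C) : Im (- z) = - Im z.
Proof. by case: z. Qed.

Lemma complexP (z w : C) : Re z = Re w -> Im z = Im w -> z = w.
Proof. by case: z => a b; case: w => c d /= -> ->. Qed.

Lemma normc_sqr (z : C) : normc z ^+ 2 = Re z ^+ 2 + Im z ^+ 2.
Proof. by case: z => a b /=; rewrite sqr_sqrtr// addr_ge0 ?sqr_ge0. Qed.

Lemma normc_ge0 (z : C) : 0 <= normc z.
Proof. by case: z => a b /=; rewrite sqrtr_ge0. Qed.

Lemma normc_eq0 (z : C) : (normc z == 0) = (z == 0).
Proof.
by apply/eqP/eqP => [/eq0_normc//|->]; rewrite normc0.
Qed.

Lemma normc_gt0 (z : C) : (0 < normc z) = (z != 0).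
Proof. by rewrite lt_def normc_ge0 andbT normc_eq0. Qed.

Lemma ler_Re_normc (z : C) : `|Re z| <= normc z.
Proof. by case: z => a b /=; rewrite -sqrtr_sqr ler_wsqrtr// lerDl sqr_ge0. Qed.

Lemma ler_Im_normc (z : C) : `|Im z| <= normc z.
Proof. by case: z => a b /=; rewrite -sqrtr_sqr ler_wsqrtr// lerDr sqr_ge0. Qed.

Lemma normc_le_ReIm (z : C) : normc z <= `|Re z| + `|Im z|.
Proof.
rewrite -(@ler_pXn2r _ 2)// ?nnegrE ?normc_ge0 ?addr_ge0//.
rewrite normc_sqr sqrrD !real_normK ?num_real// -addrA lerD2l lerDr.
by rewrite mulrn_wge0// mulr_ge0.
Qed.

Lemma normc_real (x : R) : normc x%:C = `|x|.
Proof. by rewrite /= expr0n addr0 sqrtr_sqr. Qed.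

Lemma normcX (z : C) n : normc (z ^+ n) = normc z ^+ n.
Proof. by elim: n => [|n IH]; rewrite ?expr0 ?normc1// !exprS normcM IH. Qed.

Lemma lerB_normc (z w : C) : normc z - normc w <= normc (z + w).
Proof.
rewrite lerBlDr -[X in normc X <= _](addrK w z).
by rewrite (le_trans (le_normcD _ _))// normcN.
Qed.

Section Filters.
Context {T : Type} {F : set_system T} {FF : Filter F}.
Implicit Types (u v : T -> C) (l m : C).

Lemma ccvg_cst (l : C) : ccvg F (fun=> l) l.
Proof. by split; exact: cvg_cst. Qed.

Lemma ccvgD u v l m : ccvg F u l -> ccvg F v m ->
  ccvg F (fun x => u x + v x) (l + m).
Proof.
move=> [ur ui] [vr vi]; split; rewrite ?cReD ?cImD.
  by under eq_fun do rewrite cReD; exact: cvgD.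
by under eq_fun do rewrite cImD; exact: cvgD.
Qed.

Lemma ccvgM u v l m : ccvg F u l -> ccvg F v m ->
  ccvg F (fun x => u x * v x) (l * m).
Proof.
move=> [ur ui] [vr vi]; split; rewrite ?cReM ?cImM.
  by under eq_fun do rewrite cReM; apply: cvgB; exact: cvgM.
by under eq_fun do rewrite cImM; apply: cvgD; exact: cvgM.
Qed.

Lemma ccvgV u l : l != 0 -> ccvg F u l -> ccvg F (fun x => (u x)^-1) l^-1.
Proof.
move=> l0 [ur ui].
have d0 : Re l ^+ 2 + Im l ^+ 2 != 0.
  by rewrite -normc_sqr expf_eq0/= normc_eq0.
have dc : Re (u x) ^+ 2 + Im (u x) ^+ 2 @[x --> F] --> Re l ^+ 2 + Im l ^+ 2.
  by apply: cvgD; under eq_fun do rewrite expr2; rewrite expr2; exact: cvgM.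
have dV : (Re (u x) ^+ 2 + Im (u x) ^+ 2)^-1 @[x --> F] -->
    (Re l ^+ 2 + Im l ^+ 2)^-1 by exact: cvgV.
split; rewrite ?cReV ?cImV.
  by under eq_fun do rewrite cReV; exact: (cvgM ur dV).
by under eq_fun do rewrite cImV; exact: (cvgM (cvgN ui) dV).
Qed.

Lemma ccvg_prod (I : Type) (r : seq I) (P : pred I) (u : I -> T -> C)
    (l : I -> C) :
  (forall i, P i -> ccvg F (u i) (l i)) ->
  ccvg F (fun x => \prod_(i <- r | P i) u i x) (\prod_(i <- r | P i) l i).
Proof.
move=> ul; elim: r => [|i r IH].
  by rewrite big_nil; under eq_fun do rewrite big_nil; exact: ccvg_cst.
rewrite big_cons; under eq_fun do rewrite big_cons.
by case: ifP => // Pi; apply: ccvgM => //; exact: ul.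
Qed.

Lemma ccvg_sum (I : Type) (r : seq I) (P : pred I) (u : I -> T -> C)
    (l : I -> C) :
  (forall i, P i -> ccvg F (u i) (l i)) ->
  ccvg F (fun x => \sum_(i <- r | P i) u i x) (\sum_(i <- r | P i) l i).
Proof.
move=> ul; elim: r => [|i r IH].
  by rewrite big_nil; under eq_fun do rewrite big_nil; exact: ccvg_cst.
rewrite big_cons; under eq_fun do rewrite big_cons.
by case: ifP => // Pi; apply: ccvgD => //; exact: ul.
Qed.

Lemma ccvgX u l n : ccvg F u l -> ccvg F (fun x => u x ^+ n) (l ^+ n).
Proof.
move=> ul; elim: n => [|n IH].
  by rewrite expr0; under eq_fun do rewrite expr0; exact: ccvg_cst.
by rewrite exprS; under eq_fun do rewrite exprS; exact: ccvgM.
Qed.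

Lemma ccvg_real (f : T -> R) (l : R) : f x @[x --> F] --> l ->
  ccvg F (fun x => (f x)%:C) l%:C.
Proof. by move=> fl; split => //=; exact: cvg_cst. Qed.

Lemma near_eq_ccvg u v l : {near F, u =1 v} -> ccvg F u l -> ccvg F v l.
Proof.
move=> uv [ur ui]; split.
  by apply: cvg_trans ur; apply: near_eq_cvg; apply: filterS uv => x ->.
by apply: cvg_trans ui; apply: near_eq_cvg; apply: filterS uv => x ->.
Qed.

Lemma normc_cvg0 u l : normc (u x - l) @[x --> F] --> 0 -> ccvg F u l.
Proof.
move=> ul; split; apply: cvg_zero; apply: norm_cvg0.
  apply: (@squeeze_cvgr _ _ _ _ (cst 0) (fun x => normc (u x - l))) => //.
    apply: nearW => x; rewrite normr_ge0/=.
    by rewrite !fctE (le_trans _ (ler_Re_normc _))// cReD cReN.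
  exact: cvg_cst.
apply: (@squeeze_cvgr _ _ _ _ (cst 0) (fun x => normc (u x - l))) => //.
  apply: nearW => x; rewrite normr_ge0/=.
  by rewrite !fctE (le_trans _ (ler_Im_normc _))// cImD cImN.
exact: cvg_cst.
Qed.

Lemma ccvg_normc u l : ccvg F u l -> normc (u x) @[x --> F] --> normc l.
Proof.
move=> [ur ui].
have E z : normc z = Num.sqrt (Re z ^+ 2 + Im z ^+ 2) by case: z.
rewrite E; under eq_fun do rewrite E.
apply: continuous_cvg; first exact: sqrt_continuous.
by apply: cvgD; under eq_fun do rewrite expr2; rewrite expr2; exact: cvgM.
Qed.

End Filters.

Lemma ccvg_unique {T : Type} (F : set_system T) {FF : ProperFilter F} u l m :
  ccvg F u l -> ccvg F u m -> l = m.
Proof.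
move=> [ur ui] [ur' ui']; apply: complexP.
  exact: (cvg_unique _ ur ur').
exact: (cvg_unique _ ui ui').
Qed.

Lemma clim_ccvg (u : nat -> C) l : ccvg \oo u l -> clim u = l.
Proof. by move=> [ur ui]; apply: complexP; exact: cvg_lim. Qed.

End ComplexLimits.

Section ComplexExponential.
Variable R : realType.
Local Notation C := R[i].
Local Notation Re := (@complex.Re R).
Local Notation Im := (@complex.Im R).

Definition cexp (w : C) : C := (expR (Re w))%:C * (cos (Im w) +i* sin (Im w)).

Lemma Re_cexp w : Re (cexp w) = expR (Re w) * cos (Im w).
Proof. by rewrite /cexp cReM /= mul0r subr0. Qed.

Lemma Im_cexp w : Im (cexp w) = expR (Re w) * sin (Im w).
Proof. by rewrite /cexp cImM /= mul0r addr0. Qed.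

Lemma cpowE x (z : C) : cpow x z = cexp (z * (ln x)%:C).
Proof. by rewrite /cpow /cexp cReM cImM /= !mulr0 subr0 add0r. Qed.

Lemma cexp0 : cexp 0 = 1.
Proof. by rewrite /cexp /= expR0 cos0 sin0; apply: complexP; rewrite /=; lra. Qed.

Lemma cexpD w z : cexp (w + z) = cexp w * cexp z.
Proof.
by apply: complexP; rewrite !(cReM, cImM, Re_cexp, Im_cexp, cReD, cImD) expRD ?cosD ?sinD; ring.
Qed.

Lemma cexp_mulN w : cexp w * cexp (- w) = 1.
Proof. by rewrite -cexpD subrr cexp0. Qed.

Lemma cexp_neq0 w : cexp w != 0.
Proof.
apply/eqP => w0; have := cexp_mulN w; rewrite w0 mul0r => /eqP.
by rewrite eq_sym oner_eq0.
Qed.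

Lemma cexpV w : (cexp w)^-1 = cexp (- w).
Proof. by apply: (mulfI (cexp_neq0 w)); rewrite divff ?cexp_neq0// cexp_mulN. Qed.

Lemma cexpX w n : cexp w ^+ n = cexp (w *+ n).
Proof. by elim: n => [|n IH]; rewrite ?cexp0// exprS IH -cexpD mulrS. Qed.

Lemma cexp_real (x : R) : cexp x%:C = (expR x)%:C.
Proof. by apply: complexP; rewrite ?Re_cexp ?Im_cexp /= ?cos0 ?sin0 ?mulr1 ?mulr0. Qed.

Lemma cpow_real (x y : R) : 0 < x -> cpow x y%:C = (x `^ y)%:C.
Proof. by move=> x0; rewrite cpowE -rmorphM cexp_real /powR gt_eqF. Qed.

Lemma normc_cexp w : normc (cexp w) = expR (Re w).
Proof.
apply/eqP; rewrite -(@eqrXn2 _ 2)// ?normc_ge0 ?expR_ge0// normc_sqr.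
by rewrite Re_cexp Im_cexp !exprMn -mulrDr cos2Dsin2 mulr1.
Qed.

Lemma ccvg_cexp {T : Type} {F : set_system T} {FF : Filter F} (u : T -> C) (l : C) :
  ccvg F u l -> ccvg F (fun x => cexp (u x)) (cexp l).
Proof.
move=> [ur ui]; split; rewrite ?Re_cexp ?Im_cexp.
  under eq_fun do rewrite Re_cexp; apply: cvgM.
    by apply: continuous_cvg => //; exact: continuous_expR.
  by apply: continuous_cvg => //; exact: continuous_cos.
under eq_fun do rewrite Im_cexp; apply: cvgM.
  by apply: continuous_cvg => //; exact: continuous_expR.
by apply: continuous_cvg => //; exact: continuous_sin.
Qed.

(** Both signs of x follow from [1 + x <= expR x], used at x and at -x. *)
Lemma expR_sub1_le (x : R) : `|expR x - 1| <= `|x| * expR `|x|.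
Proof.
have := expR_ge1Dx x; have := expR_ge1Dx (- x); rewrite expRN => h1 h2.
have e0 := expR_gt0 x.
have [x0|x0] := leP 0 x.
  rewrite (ger0_norm x0) ger0_norm; last by rewrite subr_ge0 -expR0 ler_expR.
  have : (1 - x) * expR x <= (expR x)^-1 * expR x by rewrite ler_wpM2r// ltW.
  by rewrite mulVf ?gt_eqF// mulrBl mul1r; lra.
rewrite (ltr0_norm x0) ltr0_norm; last by rewrite subr_lt0 -[ltRHS]expR0 ltr_expR.
rewrite expRN opprB; have : 1 <= (expR x)^-1.
  by rewrite invf_ge1// -expR0 ler_expR ltW.
nra.
Qed.

Lemma expR_sub1x_le (x : R) : `|expR x - 1 - x| <= `|x| ^+ 2 * expR `|x|.
Proof.
have := expR_ge1Dx x; have := expR_ge1Dx (- x); rewrite expRN => h1 h2.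
have e0 := expR_gt0 x.
have h3 : expR x - 1 - x <= x * (expR x - 1).
  have : (1 - x) * expR x <= (expR x)^-1 * expR x by rewrite ler_wpM2r// ltW.
  by rewrite mulVf ?gt_eqF//; lra.
rewrite ger0_norm; last by lra.
rewrite (le_trans h3)// (le_trans (ler_norm _))// normrM expr2 -mulrA.
by rewrite ler_wpM2l// expR_sub1_le.
Qed.

Lemma sin_le_norm (y : R) : `|sin y| <= `|y|.
Proof.
wlog y0 : y / 0 <= y.
  move=> h; have [/h//|y0] := leP 0 y.
  by have := h (- y); rewrite sinN !normrN oppr_ge0; apply; exact: ltW.
have [|c _] := @MVT_segment R sin cos 0 y y0 (fun x _ => is_derive_sin x).
  by apply: continuous_subspaceT => x; exact: continuous_sin.
rewrite sin0 !subr0 => ->; rewrite normrM ler_piMl// ler_norml.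
by rewrite cos_geN1 cos_le1.
Qed.

Lemma cos_sub1_le (y : R) : `|cos y - 1| <= `|y| ^+ 2.
Proof.
wlog y0 : y / 0 <= y.
  move=> h; have [/h//|y0] := leP 0 y.
  by have := h (- y); rewrite cosN !normrN oppr_ge0; apply; exact: ltW.
have [|c] := @MVT_segment R cos (fun x => - sin x) 0 y y0 (fun x _ => is_derive_cos x).
  by apply: continuous_subspaceT => x; exact: continuous_cos.
rewrite in_itv/= => /andP[c0 cy].
rewrite cos0 !subr0 => ->; rewrite normrM normrN expr2 ler_wpM2r//.
by rewrite (le_trans (sin_le_norm _))// !ger0_norm.
Qed.

Lemma cos_sub1_le1 (y : R) : `|cos y - 1| <= `|y|.
Proof.
wlog y0 : y / 0 <= y.
  move=> h; have [/h//|y0] := leP 0 y.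
  by have := h (- y); rewrite cosN !normrN oppr_ge0; apply; exact: ltW.
have [|c _] := @MVT_segment R cos (fun x => - sin x) 0 y y0 (fun x _ => is_derive_cos x).
  by apply: continuous_subspaceT => x; exact: continuous_cos.
rewrite cos0 !subr0 => ->; rewrite normrM normrN ler_piMl// ler_norml.
by rewrite sin_geN1 sin_le1.
Qed.

Lemma sin_subx_le (y : R) : `|sin y - y| <= `|y| ^+ 2.
Proof.
wlog y0 : y / 0 <= y.
  move=> h; have [/h//|y0] := leP 0 y.
  have := h (- y); rewrite sinN -opprD !normrN oppr_ge0; apply; exact: ltW.
have D x : x \in `]0, y[ -> is_derive x 1 (fun z => sin z - z) (cos x - 1).
  by move=> _; apply: is_deriveB.
have [|c] := @MVT_segment R (fun z => sin z - z) (fun x => cos x - 1) 0 y y0 D.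
  apply: continuous_subspaceT => x; apply: cvgB; first exact: continuous_sin.
  exact: cvg_id.
rewrite in_itv/= => /andP[c0 cy].
rewrite sin0 !subr0 => ->; rewrite normrM expr2 ler_wpM2r//.
by rewrite (le_trans (cos_sub1_le1 _))// !ger0_norm.
Qed.

(** Each component of the remainder splits into two pieces of size at most |w|^2 e^|w|; the constant
    4 counts the pieces. This second-order bound drives both the Gauss products and the limit of (1
    + w/n)^n. *)
Lemma cexp_estimate w :
  normc (cexp w - 1 - w) <= 4 * normc w ^+ 2 * expR (normc w).
Proof.
have hx := ler_Re_normc w; have hy := ler_Im_normc w.
rewrite (le_trans (normc_le_ReIm _))//.
rewrite !(cReD, cImD, cReN, cImN) Re_cexp Im_cexp /= oppr0 addr0.
set n := normc w in hx hy *; set x := Re w in hx *; set y := Im w in hy *.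
have n0 : 0 <= n := normc_ge0 w.
have en : 1 <= expR n by rewrite -expR0 ler_expR.
have ex : expR x <= expR n by rewrite ler_expR (le_trans (ler_norm _)).
have exn : expR `|x| <= expR n by rewrite ler_expR.
have e0 := expR_gt0 x.
have sq : forall a : R, `|a| <= n -> `|a| ^+ 2 <= n ^+ 2.
  by move=> a an; rewrite ler_pXn2r ?nnegrE.
have h1 : `|expR x * (cos y - 1)| <= n ^+ 2 * expR n.
  rewrite normrM (gtr0_norm e0) mulrC ler_pM ?expR_ge0//.
  by rewrite (le_trans (cos_sub1_le _))// sq.
have h2 : `|expR x - 1 - x| <= n ^+ 2 * expR n.
  by rewrite (le_trans (expR_sub1x_le _))// ler_pM// ?expR_ge0 ?exprn_ge0 ?sq.
have h3 : `|(expR x - 1) * sin y| <= n ^+ 2 * expR n.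
  rewrite normrM (@le_trans _ _ (`|x| * expR `|x| * `|y|))//.
    by rewrite ler_pM// ?expR_sub1_le ?sin_le_norm.
  rewrite mulrAC ler_pM ?mulr_ge0 ?expR_ge0//.
  by rewrite expr2 ler_pM.
have h4 : `|sin y - y| <= n ^+ 2 * expR n.
  rewrite (le_trans (sin_subx_le _))// (le_trans (sq _ hy))// ler_peMr//.
  by rewrite exprn_ge0.
have -> : expR x * cos y - 1 - x = expR x * (cos y - 1) + (expR x - 1 - x) by ring.
have -> : expR x * sin y - y = (expR x - 1) * sin y + (sin y - y) by ring.
apply: le_trans (lerD (ler_normD _ _) (ler_normD _ _)) _.
by apply: le_trans (lerD (lerD h1 h2) (lerD h3 h4)) _; lra.
Qed.

End ComplexExponential.

(** * The Euler-Gauss product *)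

Section SlowProducts.
Variable R : realType.
Local Notation C := R[i].
Variables (h : nat -> R) (e p : nat -> C).
Hypothesis h_ge0 : forall n, 0 <= h n.
Hypothesis e_le : forall n, normc (e n) <= h n - h n.+1.
Hypothesis pS : forall n, p n.+1 = p n * (1 + e n).

Let h_le n : h n.+1 <= h n.
Proof. by rewrite -subr_ge0 (le_trans _ (e_le n))// normc_ge0. Qed.

(** Each factor has modulus at most 1 + (h n - h n.+1), hence at most exp (h n - h n.+1): the
    exponents telescope and only [h 0] remains. *)
Lemma slow_prod_upper n : normc (p n) <= normc (p 0%N) * expR (h 0%N).
Proof.
suff : normc (p n) <= normc (p 0%N) * expR (h 0%N - h n).
  move=> /le_trans; apply; rewrite ler_wpM2l ?normc_ge0// ler_expR.
  by rewrite gerBl.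
elim: n => [|n IH]; first by rewrite subrr expR0 mulr1.
rewrite pS normcM.
have -> : h 0%N - h n.+1 = (h 0%N - h n) + (h n - h n.+1) by ring.
rewrite expRD mulrA ler_pM ?normc_ge0//.
rewrite (le_trans (le_normcD _ _))// normc1.
by rewrite (le_trans _ (expR_ge1Dx _))// lerD2l.
Qed.

(** The inequality prod (1 - x_i) >= 1 - sum x_i with a telescoping sum. The smallness of [h 0]
    keeps half of the initial modulus, so the limit can vanish only if [p 0] does. *)
Lemma slow_prod_lower n : h 0%N <= 2^-1 -> normc (p 0%N) / 2 <= normc (p n).
Proof.
move=> h0.
suff : normc (p 0%N) * (1 - (h 0%N - h n)) <= normc (p n).
  apply: le_trans; rewrite ler_wpM2l ?normc_ge0//.
  by have := h_ge0 n; lra.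
have p0 := normc_ge0 (p 0%N).
have hn m : h m <= h 0%N.
  by elim: m => // m IH; exact: le_trans (h_le m) IH.
elim: n => [|n IH]; first by rewrite subrr subr0 mulr1.
rewrite pS normcM.
have h1 : 1 - (h n - h n.+1) <= normc (1 + e n).
  have := lerB_normc 1 (e n); have := e_le n; rewrite normc1; lra.
have : normc (p 0%N) * (1 - (h 0%N - h n)) * (1 - (h n - h n.+1)) <=
       normc (p n) * normc (1 + e n).
  have := hn n; have := h_ge0 n; have := h_ge0 n.+1 => ? ? ?.
  by apply: ler_pM => //; [apply: mulr_ge0 => //|]; lra.
apply: le_trans; rewrite -mulrA ler_wpM2l//.
have : 0 <= (h 0%N - h n) * (h n - h n.+1).
  by rewrite mulr_ge0// subr_ge0.
lra.
Qed.

(** For a component f of [p] the increments are at least - B (h n - h n.+1), so f - B h is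
    nondecreasing and bounded above. Adding back the convergent B h gives the limit, without Cauchy
    sequences. *)
Lemma slow_prod_cvg : exists l, ccvg \oo p l.
Proof.
set B := normc (p 0%N) * expR (h 0%N).
have B0 : 0 <= B by rewrite mulr_ge0 ?normc_ge0 ?expR_ge0.
have hc : cvgn h.
  apply: nonincreasing_is_cvgn; last by exists 0 => _ [n _ <-].
  by apply/nonincreasing_seqP.
have dp n : normc (p n.+1 - p n) <= B * (h n - h n.+1).
  rewrite pS mulrDr mulr1 addrC addKr normcM ler_pM ?normc_ge0//.
  exact: slow_prod_upper.
have key (f : nat -> R) : (forall n, `|f n.+1 - f n| <= B * (h n - h n.+1)) ->
    (forall n, `|f n| <= B) -> cvgn f.
  move=> df fB.
  have -> : f = (fun n => f n - B * h n) \+ (fun n => B * h n).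
    by apply/funext => n /=; rewrite subrK.
  apply: is_cvgD; last by apply: is_cvgMr.
  apply: nondecreasing_is_cvgn.
    apply/nondecreasing_seqP => n.
    by have := df n; rewrite ler_norml => /andP[+ _]; lra.
  exists B => _ [n _ <-].
  have : 0 <= B * h n by rewrite mulr_ge0.
  by have := fB n; rewrite ler_norml => /andP[_ +]; lra.
exists (limn (fun n => complex.Re (p n)) +i* limn (fun n => complex.Im (p n))).
split => /=.
  apply: (key (fun n => complex.Re (p n))) => n.
    by rewrite (le_trans _ (dp n))// -cReN -cReD ler_Re_normc.
  by rewrite (le_trans (ler_Re_normc _))// slow_prod_upper.
apply: (key (fun n => complex.Im (p n))) => n.
  by rewrite (le_trans _ (dp n))// -cImN -cImD ler_Im_normc.
by rewrite (le_trans (ler_Im_normc _))// slow_prod_upper.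
Qed.

End SlowProducts.

Section GaussProduct.
Variable R : realType.
Local Notation C := R[i].
Implicit Types z : C.

Lemma pochS (K : nzRingType) (c : K) n : poch c n.+1 = poch c n * (c + n%:R).
Proof. by rewrite /poch big_ord_recr. Qed.

Lemma poch0 (K : nzRingType) (c : K) : poch c 0 = 1.
Proof. by rewrite /poch big_ord0. Qed.

Lemma pochSl (K : comNzRingType) (c : K) n : poch c n.+1 = c * poch (c + 1) n.
Proof.
rewrite /poch big_ord_recl addr0; congr (_ * _); apply: eq_bigr => i _.
by rewrite -addrA -natr1 [X in _ + X]addrC.
Qed.

(* Inverse of the n-th term of the Euler-Gauss limit. *)
Definition gauss (n : nat) z : C := poch z n.+1 / (n`!%:R * cpow n%:R z).

Lemma cpow_neq0 (x : R) z : cpow x z != 0.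
Proof. by rewrite cpowE cexp_neq0. Qed.

Lemma gaussV n z : (gauss n z)^-1 = n`!%:R * cpow n%:R z / poch z n.+1.
Proof. by rewrite /gauss invf_div. Qed.

Let eps n z : C :=
  (1 + z / n.+1%:R) * cexp (- (z * (ln n.+1%:R - ln n%:R)%:C)) - 1.

Lemma natC n : (n%:R : R)%:C = n%:R :> C.
Proof. by rewrite rmorph_nat. Qed.

Lemma natVC n : ((n%:R)^-1 : R)%:C = (n%:R)^-1 :> C.
Proof. by rewrite -natC fmorphV. Qed.

Lemma gaussS n z : gauss n.+1 z = gauss n z * (1 + eps n z).
Proof.
rewrite /eps [1 + (_ - 1)]addrC subrK rmorphB /= mulrBr opprB addrC cexpD.
rewrite -cexpV /gauss pochS factS natrM !cpowE.
have := cexp_neq0 (z * (ln n.+1%:R)%:C); have := cexp_neq0 (z * (ln n%:R)%:C).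
have : n.+1%:R != 0 :> C by rewrite pnatr_eq0.
have : n`!%:R != 0 :> C by rewrite pnatr_eq0 -lt0n fact_gt0.
rewrite -natr1; move: (cexp _) (cexp _) => u v h1 h2 h3 h4.
by field; rewrite h1 h2 h3 h4.
Qed.

Lemma gauss_neq0 n z : poch z n.+1 != 0 -> gauss n z != 0.
Proof.
move=> h; rewrite /gauss mulf_eq0 negb_or h invr_eq0 mulf_eq0 negb_or.
by rewrite cpow_neq0 pnatr_eq0 -lt0n fact_gt0.
Qed.

(** Both bounds are ln (1 + x) <= x, at x = 1/n and at x = -1/(n+1). *)
Lemma ln_succ_bounds n : (0 < n)%N ->
  (n.+1%:R)^-1 <= ln n.+1%:R - ln n%:R :> R /\
  ln n.+1%:R - ln n%:R <= (n%:R)^-1 :> R.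
Proof.
move=> n0; have nR : 0 < n%:R :> R by rewrite ltr0n.
have nS : 0 < n.+1%:R :> R by rewrite ltr0n.
rewrite -ln_div ?posrE//; split; last first.
  have -> : n.+1%:R / n%:R = 1 + n%:R^-1 :> R.
    by rewrite -natr1 mulrDl divff ?gt_eqF// mul1r.
  by apply: le_ln1Dx; rewrite (lt_trans (ltrN10 _))// invr_gt0.
rewrite -lerN2 -lnV ?posrE ?divr_gt0// invf_div.
have -> : n%:R / n.+1%:R = 1 - n.+1%:R^-1 :> R.
  by rewrite -natr1; field; rewrite natr1 gt_eqF.
apply: le_ln1Dx; rewrite ltrN2 invf_lt1// ltr1n ltnS.
exact: n0.
Qed.

(** The first-order terms z/(n+1) and - z (ln (n+1) - ln n) cancel up to order 1/n^2, which is the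
    order of K/n - K/(n+1) = K/(n(n+1)). *)
Lemma eps_bound (M : R) : 0 <= M -> exists2 K, 0 <= K &
  forall n z, (0 < n)%N -> normc z <= M ->
    normc (eps n z) <= K / n%:R - K / n.+1%:R.
Proof.
move=> M0.
(* One summand for each term of the expansion below: z (a - d), z^2 d a and (1 + z a) r. The 8 is
   the 4 of [cexp_estimate] times the 2 of b <= 2 a. *)
exists (M + M ^+ 2 + (1 + M) * (8 * M ^+ 2 * expR M)).
  by rewrite !addr_ge0 ?mulr_ge0 ?exprn_ge0 ?addr_ge0 ?expR_ge0.
move=> n z n0 zM.
have nR : 0 < n%:R :> R by rewrite ltr0n.
have nS : 0 < n.+1%:R :> R by rewrite ltr0n.
rewrite /eps; move: (ln _ - ln _) (ln_succ_bounds n0) => d [d1 d2].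
set a : R := n.+1%:R^-1 in d1; set b : R := n%:R^-1 in d2.
have a0 : 0 < a by rewrite invr_gt0.
have ab : b - a = a * b.
  by rewrite /a /b -natr1; field; rewrite natr1 !gt_eqF.
have a1 : a <= 1 by rewrite invf_le1// ler1n.
have b1 : b <= 1 by rewrite invf_le1// ler1n.
have b2a : b <= 2 * a.
  by have : a * b <= a * 1 by [rewrite ler_wpM2l// ltW]; lra.
have z0 := normc_ge0 z.
set w := - (z * d%:C).
have nw : normc w = normc z * d.
  by rewrite normcN normcM normc_real ger0_norm//; lra.
set r := cexp w - 1 - w.
have nr : normc r <= 8 * M ^+ 2 * expR M * (a * b).
  rewrite (le_trans (cexp_estimate _))//.
  have -> : 8 * M ^+ 2 * expR M * (a * b) = (8 * M ^+ 2 * (a * b)) * expR M by ring.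
  apply: ler_pM; rewrite ?expR_ge0 ?mulr_ge0 ?normc_ge0//.
    have : normc w ^+ 2 <= M ^+ 2 * (2 * (a * b)).
      rewrite nw exprMn ler_pM ?exprn_ge0//; first by lra.
        by rewrite ler_pXn2r ?nnegrE.
      rewrite expr2 (@le_trans _ _ (b * b))//.
        by apply: ler_pM; lra.
      by rewrite mulrA ler_wpM2r//; lra.
    lra.
  rewrite ler_expR nw.
  by rewrite -[leRHS]mulr1; apply: ler_pM => //; lra.
have -> : (1 + z / n.+1%:R) * cexp (- (z * d%:C)) - 1 = z * (a - d)%:C - z * z * (d * a)%:C + (1 + z * a%:C) * r.
  have -> : (1 + z / n.+1%:R) * cexp (- (z * d%:C)) - 1 =
      (1 + z * a%:C) * (r + 1 + w) - 1.
    by rewrite /r /a -natC fmorphV -/w -addrA [1 + w]addrC addrA !subrK.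
  rewrite /w (_ : (a - d)%:C = a%:C - d%:C) ?rmorphB//.
  rewrite (_ : (d * a)%:C = d%:C * a%:C) ?rmorphM//.
  by move: (r : C) (a%:C) (d%:C) => r' a' d'; ring.
have h1 : normc (z * (a - d)%:C) <= M * (a * b).
  rewrite normcM normc_real ler_pM// -ab distrC ger0_norm; lra.
have h2 : normc (- (z * z * (d * a)%:C)) <= M ^+ 2 * (a * b).
  rewrite normcN !normcM normc_real ler_pM ?mulr_ge0//.
    by rewrite expr2 ler_pM.
  rewrite ger0_norm ?mulr_ge0//; [|lra..].
  by rewrite mulrC ler_wpM2l//; lra.
have h3 : normc ((1 + z * a%:C) * r) <= (1 + M) * (8 * M ^+ 2 * expR M) * (a * b).
  rewrite normcM -mulrA ler_pM ?normc_ge0//.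
  rewrite (le_trans (le_normcD _ _))// normc1 lerD2l normcM normc_real.
  by rewrite ger0_norm ?(ltW a0)// -[leRHS]mulr1 ler_pM// ltW.
apply: le_trans (le_normcD _ _) _.
apply: le_trans (lerD (le_normcD _ _) (lexx _)) _.
apply: le_trans (lerD (lerD h1 h2) h3) _.
by rewrite -!mulrBr ab -!mulrDl.
Qed.

(* The tail [gauss (n + n0) z], n >= 0, is a slow product for every n0 >= 1. *)
Let tail (K : R) n0 n : R := K / (n + n0)%:R.

Lemma gauss_tail_cvg (n0 : nat) z : (0 < n0)%N ->
  exists l, ccvg \oo (fun n => gauss (n + n0) z) l.
Proof.
move=> n00; have [K K0 eK] := eps_bound (normc_ge0 z).
apply: (@slow_prod_cvg R (tail K n0) (fun n => eps (n + n0) z)) => n.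
- by rewrite /tail divr_ge0.
- by rewrite /tail addSn eK// addn_gt0 n00 orbT.
- by rewrite addSn gaussS.
Qed.

(** Uniform on a disc, as dominated convergence on the contour will require. The chain starts at n =
    1, where [gauss 1 z] is z (z + 1). *)
Lemma gauss_upper_bound (M : R) : 0 <= M -> exists B, forall n z, (0 < n)%N ->
  normc z <= M -> normc (gauss n z) <= B.
Proof.
move=> M0; have [K K0 eK] := eps_bound M0.
exists (M * (M + 1) * expR K) => -[//|n] z _ zM.
have H : normc (gauss n.+1 z) <= normc (gauss 1 z) * expR (tail K 1 0).
  apply: (@slow_prod_upper R (tail K 1) (fun n => eps n.+1 z)
    (fun n => gauss n.+1 z)).
  - by move=> m; rewrite divr_ge0.
  - by move=> m; rewrite /tail !addn1 eK.
  - by move=> m; rewrite gaussS.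
rewrite (le_trans H)// /tail divr1 ler_wpM2r ?expR_ge0// /gauss !pochS poch0.
rewrite mul1r addr0 cpowE ln1 mulr0 cexp0 !mulr1 divr1 normcM.
rewrite ler_pM ?normc_ge0//.
by rewrite (le_trans (le_normcD _ _))// normc1 lerD2r.
Qed.

(** [n0] depends on the disc only: it makes K / n0 <= 1/2, as [slow_prod_lower] asks. The bound is
    relative to [gauss n0 z], which vanishes at finitely many points only. *)
Lemma gauss_lower_bound (M : R) : 0 <= M -> exists2 n0, (0 < n0)%N &
  forall n z, (n0 <= n)%N -> normc z <= M ->
    normc (gauss n0 z) / 2 <= normc (gauss n z).
Proof.
move=> M0; have [K K0 eK] := eps_bound M0.
have [n0 n00 hK] : exists2 n0, (0 < n0)%N & K / n0%:R <= 2^-1.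
  exists (Num.truncn (2 * K)).+1 => //.
  rewrite ler_pdivrMr ?ltr0n// mulrC ler_pdivlMr// mulrC ltW//.
  by rewrite truncnS_gt.
exists n0 => // n z nn zM.
rewrite -(subnK nn).
have := @slow_prod_lower R (tail K n0) (fun n => eps (n + n0) z)
  (fun n => gauss (n + n0) z) _ _ _ (n - n0)%N.
rewrite add0n; apply.
- by move=> m; rewrite divr_ge0.
- by move=> m; rewrite /tail addSn eK// addn_gt0 n00 orbT.
- by move=> m; rewrite addSn gaussS.
- by rewrite /tail add0n.
Qed.

Lemma ccvg_shiftn (u : nat -> C) l N :
  ccvg \oo (fun n => u (n + N)%N) l -> ccvg \oo u l.
Proof.
move=> [ur ui]; split.
  by move: ur; rewrite (cvg_shiftn N (fun n => complex.Re (u n))).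
by move: ui; rewrite (cvg_shiftn N (fun n => complex.Im (u n))).
Qed.

Lemma poch_eq0_ge (K : idomainType) (z : K) n m :
  (n <= m)%N -> poch z n = 0 -> poch z m = 0.
Proof.
move=> nm zn; elim: m nm => [|m IH]; first by rewrite leqn0 => /eqP <-.
by rewrite leq_eqVlt => /orP[/eqP <- //|nm]; rewrite pochS IH ?mul0r.
Qed.

(** Holds at the poles too: there the products vanish from some rank on, and [0^-1 = 0] gives
    [cGamma z = 0]. Elsewhere the lower bound keeps the limit away from 0, so that the inverses
    converge as well. *)
Lemma gauss_cvg z : ccvg \oo (gauss ^~ z) (cGamma z)^-1.
Proof.
have [l lz] := gauss_tail_cvg z (ltnSn 0).
have {}lz := @ccvg_shiftn (gauss ^~ z) l 1 lz.
have UE : (fun n => n`!%:R * cpow n%:R z / poch z n.+1) = fun n => (gauss n z)^-1.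
  by apply/funext => n; rewrite gaussV.
suff -> : cGamma z = l^-1 by rewrite invrK.
apply: clim_ccvg; rewrite UE.
have [[m pm]|np] := pselect (exists m, poch z m = 0).
  have gm n : (m <= n)%N -> gauss n z = 0.
    by move=> mn; rewrite /gauss (poch_eq0_ge _ pm) ?mul0r// ltnW.
  have -> : l = 0.
    apply: (ccvg_unique lz).
    apply: (near_eq_ccvg _ (ccvg_cst 0)).
    by exists m => // n /= mn; rewrite gm.
  apply: (near_eq_ccvg _ (ccvg_cst _)).
  by exists m => // n /= mn; rewrite gm.
apply: ccvgV => //.
have [n0 n00 low] := gauss_lower_bound (normc_ge0 z).
rewrite -normc_gt0.
have g0 : 0 < normc (gauss n0 z) / 2.
  rewrite divr_gt0// normc_gt0 gauss_neq0//.
  by apply/eqP => pz; apply: np; exists n0.+1.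
apply: lt_le_trans g0 _.
apply: (cvgr_to_ge (ccvg_normc lz)).
by exists n0 => // n /= nn; rewrite low.
Qed.

Lemma cGamma_neq0 z : (forall n, z + n%:R != 0) -> cGamma z != 0.
Proof.
move=> hz; have [n0 n00 low] := gauss_lower_bound (normc_ge0 z).
rewrite -invr_eq0 -normc_gt0.
have g0 : 0 < normc (gauss n0 z) / 2.
  rewrite divr_gt0// normc_gt0 gauss_neq0// /poch.
  by apply/prodf_neq0 => i _; exact: hz.
apply: lt_le_trans g0 _.
apply: (cvgr_to_ge (ccvg_normc (gauss_cvg z))).
by exists n0 => // n /= nn; rewrite low.
Qed.

(** The functional equation of Gamma at finite rank; the correcting factor tends to 1. *)
Lemma gauss_shift n z : (0 < n)%N ->
  z * gauss n (z + 1) = gauss n z * ((z + 1) / n%:R + 1).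
Proof.
move=> n0; rewrite /gauss !cpowE [(z + 1) * _]mulrDl mul1r cexpD cexp_real.
rewrite lnK ?posrE ?ltr0n// natC.
have h1 : poch z n.+1 * (z + n.+1%:R) = z * poch (z + 1) n.+1.
  by rewrite -pochS pochSl.
have n1 : n%:R != 0 :> C by rewrite pnatr_eq0 -lt0n.
have nf : n`!%:R != 0 :> C by rewrite pnatr_eq0 -lt0n fact_gt0.
have := cexp_neq0 (z * (ln n%:R)%:C); move: (cexp _) => w w0.
rewrite [LHS]mulrA -h1 -natr1; field.
by rewrite n1 nf w0.
Qed.

Lemma cvg_invn : (n%:R : R)^-1 @[n --> \oo] --> (0 : R).
Proof.
rewrite -(cvg_shiftS (fun n => (n%:R : R)^-1)).
exact: cvg_harmonic.
Qed.

Lemma cGammaS z : z != 0 -> cGamma (z + 1) = z * cGamma z.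
Proof.
move=> z0.
have h : z * (cGamma (z + 1))^-1 = (cGamma z)^-1.
  apply: (@ccvg_unique _ _ \oo _ (fun n => z * gauss n (z + 1))).
    by apply: ccvgM (ccvg_cst _) (gauss_cvg _).
  have -> : (cGamma z)^-1 = (cGamma z)^-1 * ((z + 1) * (0 : R)%:C + 1).
    by rewrite mulr0 add0r mulr1.
  apply: (@near_eq_ccvg _ _ _ _ (fun n => gauss n z * ((z + 1) * (n%:R^-1)%:C + 1))).
    exists 1%N => // n /= n0; rewrite gauss_shift//.
    by rewrite natVC.
  apply: ccvgM (gauss_cvg z) (ccvgD (ccvgM (ccvg_cst _) (ccvg_real _)) (ccvg_cst _)).
  exact: cvg_invn.
by rewrite -[cGamma z]invrK -h invfM invrK mulrA divff// mul1r.
Qed.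

Lemma poch_real (x : R) n : poch x%:C n = (poch x n)%:C.
Proof.
by rewrite rmorph_prod; apply: eq_bigr => i _; rewrite rmorphD /= natC.
Qed.

Lemma gauss_real n (x : R) : (0 < n)%N ->
  gauss n x%:C = (poch x n.+1 / (n`!%:R * n%:R `^ x))%:C.
Proof.
move=> n0; rewrite /gauss poch_real cpow_real ?ltr0n//.
by rewrite fmorph_div rmorphM /= natC.
Qed.

Lemma cGamma_real (x : R) : cGamma x%:C = (rGamma x)%:C.
Proof.
have h : complex.Im (cGamma x%:C)^-1 = 0.
  have [_ h] := gauss_cvg x%:C; apply: (cvg_unique _ h) => //=.
  apply: (@cvg_trans _ ((fun=> 0 : R) @ \oo)); last exact: cvg_cst.
  apply: near_eq_cvg.
  by exists 1%N => // n /= n0; rewrite gauss_real.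
have := cImV (cGamma x%:C)^-1; rewrite h oppr0 mul0r invrK /rGamma.
by case: (cGamma _) => u v /= ->.
Qed.

Lemma rgauss_cvg (x : R) :
  poch x n.+1 / (n`!%:R * n%:R `^ x) @[n --> \oo] --> (rGamma x)^-1.
Proof.
have [h _] := gauss_cvg x%:C.
move: h; rewrite cGamma_real -fmorphV /=; apply: cvg_trans.
apply: near_eq_cvg.
by exists 1%N => // n /= n0; rewrite gauss_real.
Qed.

Lemma rGamma_gt0 (x : R) : 0 < x -> 0 < rGamma x.
Proof.
move=> x0; rewrite lt_def; apply/andP; split.
  have : cGamma x%:C != 0.
    apply: cGamma_neq0 => n; rewrite -natC -rmorphD.
    rewrite (_ : 0 = 0%:C)// (inj_eq (@complexI _)) gt_eqF//.
    by rewrite ltr_wpDr.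
  by rewrite cGamma_real (_ : 0 = 0%:C)// (inj_eq (@complexI _)).
rewrite -invr_ge0; apply: (cvgr_to_ge (@rgauss_cvg x)).
apply: nearW => n; rewrite divr_ge0 ?mulr_ge0 ?powR_ge0//.
by apply: prodr_ge0 => i _; rewrite addr_ge0// ltW.
Qed.

Lemma rGammaS (x : R) : 0 < x -> rGamma (x + 1) = x * rGamma x.
Proof.
move=> x0; apply: (@complexI R); rewrite rmorphM /= -!cGamma_real rmorphD.
by apply: cGammaS; rewrite (_ : 0 = 0%:C)// (inj_eq (@complexI _)) gt_eqF.
Qed.

End GaussProduct.

(** * Contour integrals and residues *)

Section RootProducts.
Variable K : fieldType.
Implicit Types (z : K) (zs cs ds : seq K).

(** At a point z of a duplicate-free [zs], the derivative of the monic polynomial with roots [zs]: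
    the denominator of residues and of Lagrange interpolation. The filter makes it nonzero for every
    z. *)
Definition other_prod zs z : K := \prod_(w <- zs | w != z) (z - w).

Lemma horner_prodXsubC cs (p : pred K) z :
  (\prod_(c <- cs | p c) ('X - c%:P)).[z] = \prod_(c <- cs | p c) (z - c).
Proof. by rewrite horner_prod; apply: eq_bigr => c _; rewrite !hornerE. Qed.

Lemma prod_sub_neq0 ds z : z \notin ds -> \prod_(d <- ds) (z - d) != 0.
Proof.
move=> zds; rewrite prodf_seq_neq0; apply/allP => d dds /=.
by rewrite subr_eq0; apply: contraNneq zds => ->.
Qed.

Lemma other_prod_neq0 zs z : other_prod zs z != 0.
Proof.
rewrite /other_prod prodf_seq_neq0; apply/allP => d dds /=; apply/implyP => dz.
by rewrite subr_eq0 eq_sym.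
Qed.

(** Compare the coefficients of X^(size zs - 1) in the Lagrange formula, whose basis products are
    monic of that degree. The value is the leading coefficient of P when its size is maximal, and 0
    when there is a spare node. *)
Lemma lagrange_lead zs (P : {poly K}) : uniq zs -> (size P <= size zs)%N ->
  \sum_(z <- zs) P.[z] / other_prod zs z = P`_(size zs).-1.
Proof.
move=> zsu Ps.
pose B z := \prod_(w <- zs | w != z) ('X - w%:P).
have sB z : z \in zs -> size (B z) = size zs.
  move=> zzs; rewrite /B -big_filter size_prod_XsubC -rem_filter// size_rem//.
  by rewrite prednK//; case: (zs) zzs.
pose Q := P - \sum_(z <- zs) (P.[z] / other_prod zs z) *: B z.
have Q0 : Q = 0.
  apply: (@roots_geq_poly_eq0 _ _ zs) => //.
    apply/allP => z zzs; apply/rootP.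
    rewrite /Q hornerD hornerN horner_sum (bigD1_seq z)//= hornerZ horner_prodXsubC.
    rewrite -/(other_prod zs z) divfK ?other_prod_neq0// big1 ?addr0 ?subrr//.
    move=> w wz; rewrite hornerZ horner_prodXsubC (big_rem z)//= eq_sym wz.
    by rewrite subrr mul0r mulr0.
  rewrite (leq_trans (size_polyD _ _))// geq_max Ps size_polyN.
  rewrite (leq_trans (size_sum _ _ _))//; apply/bigmax_leqP_seq => z zzs _.
  by rewrite (leq_trans (size_scale_leq _ _))// sB.
have -> : P = \sum_(z <- zs) (P.[z] / other_prod zs z) *: B z.
  by apply/eqP; rewrite -subr_eq0 -/Q Q0.
rewrite coef_sum big_seq [RHS]big_seq; apply: eq_bigr => z zzs.
rewrite coefZ -(sB z zzs) -lead_coefE (_ : lead_coef (B z) = 1) ?mulr1//.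
  rewrite /Q in Q0; move/eqP: Q0; rewrite subr_eq0 => /eqP <-//.
by apply/eqP; rewrite -monicE; exact: monic_prod_XsubC.
Qed.

End RootProducts.

Section ContourIntegral.
Variable R : realType.
Local Notation C := R[i].
Local Notation Re := (@complex.Re R).
Local Notation Im := (@complex.Im R).
Local Notation mu := (@lebesgue_measure R).
Implicit Types t : R.

Definition cderiv (h : R -> C) (t : R) (d : C) : Prop :=
  is_derive t 1 (fun u => Re (h u)) (Re d) /\
  is_derive t 1 (fun u => Im (h u)) (Im d).

Lemma cderiv_cst (c : C) t : cderiv (fun=> c) t 0.
Proof. by split; exact: is_derive_cst. Qed.

Lemma cderivD h k t d e : cderiv h t d -> cderiv k t e ->
  cderiv (fun u => h u + k u) t (d + e).
Proof.
move=> [hr hi] [kr ki]; split; rewrite ?cReD ?cImD.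
  by under eq_fun do rewrite cReD; exact: is_deriveD.
by under eq_fun do rewrite cImD; exact: is_deriveD.
Qed.

Lemma cderivM h k t d e : cderiv h t d -> cderiv k t e ->
  cderiv (fun u => h u * k u) t (h t * e + d * k t).
Proof.
move=> [hr hi] [kr ki]; split.
  under eq_fun do rewrite cReM.
  apply: is_derive_eq.
  by rewrite cReD !cReM /GRing.scale/=; ring.
under eq_fun do rewrite cImM.
apply: is_derive_eq.
by rewrite cImD !cImM /GRing.scale/=; ring.
Qed.

Lemma cderivX h t d n : cderiv h t d ->
  cderiv (fun u => h u ^+ n) t (n%:R * h t ^+ n.-1 * d).
Proof.
move=> hd; elim: n => [|n IH]; first by rewrite !mul0r; exact: cderiv_cst.
under eq_fun do rewrite exprS.
have -> : n.+1%:R * h t ^+ n * d = h t * (n%:R * h t ^+ n.-1 * d) + d * h t ^+ n.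
  case: n {IH} => [|n]; first by rewrite !mul0r !expr0; ring.
  by rewrite /= exprS -natr1; ring.
exact: cderivM.
Qed.

Lemma cderivV (h : R -> C) t d : h t != 0 -> cderiv h t d ->
  cderiv (fun u => (h u)^-1) t (- (h t) ^- 2 * d).
Proof.
move=> h0 [hr hi].
have d0 : Re (h t) ^+ 2 + Im (h t) ^+ 2 != 0.
  by rewrite -normc_sqr expf_eq0/= normc_eq0.
pose N u := Re (h u) ^+ 2 + Im (h u) ^+ 2.
have dN : is_derive t 1 N (2 * Re (h t) * Re d + 2 * Im (h t) * Im d).
  rewrite /N; apply: is_derive_eq.
  by rewrite /GRing.scale/=; ring.
have dV : is_derive t 1 (fun u => (N u)^-1)
    (- (N t) ^- 2 * (2 * Re (h t) * Re d + 2 * Im (h t) * Im d)).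
  by apply: is_derive_eq; last by rewrite /GRing.scale/=.
have E : (h t) ^- 2 = ((Re (h t) / N t) +i* (- Im (h t) / N t)) ^+ 2.
  by rewrite -exprVn; congr (_ ^+ 2); apply: complexP; rewrite ?cReV ?cImV.
split.
  under eq_fun do rewrite cReV.
  apply: is_derive_eq.
  rewrite E /GRing.scale/= !(cReM, cImM, cReN, cImN, expr2)/= -!expr2 /N.
  field; exact: d0.
under eq_fun do rewrite cImV.
apply: is_derive_eq.
rewrite E /GRing.scale/= !(cReM, cImM, cReN, cImN, expr2)/= -!expr2 /N.
field; exact: d0.
Qed.

(** Relative to [0, 1], because outside it an arc may run through poles of the integrand. *)
Definition ccont01 (h : R -> C) : Prop :=
  forall t, 0 <= t <= 1 -> ccvg (within `[0, 1] (nbhs t)) h (h t).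

Lemma continuous01_within (k : R -> R) :
  (forall t, 0 <= t <= 1 -> k u @[u --> within `[0, 1] (nbhs t)] --> k t) ->
  {within `[0%R, 1%R], continuous k}.
Proof.
by move=> kc; apply/subspace_continuousP => t /=; rewrite in_itv/= => /kc.
Qed.

Lemma continuous01_integrable (k : R -> R) :
  (forall t, 0 <= t <= 1 -> k u @[u --> within `[0, 1] (nbhs t)] --> k t) ->
  mu.-integrable `[0%R, 1%R] (EFin \o k).
Proof.
move=> kc; apply: continuous_compact_integrable; first exact: segment_compact.
exact: continuous01_within.
Qed.

Definition cint01 (h : R -> C) : C :=
  (\int[mu]_(t in `[0%R, 1%R]) Re (h t)) +i*
  (\int[mu]_(t in `[0%R, 1%R]) Im (h t)).

Lemma ccont01_intRe h : ccont01 h ->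
  mu.-integrable `[0%R, 1%R] (EFin \o (fun t => Re (h t))).
Proof. by move=> hc; apply: continuous01_integrable => t /hc[]. Qed.

Lemma ccont01_intIm h : ccont01 h ->
  mu.-integrable `[0%R, 1%R] (EFin \o (fun t => Im (h t))).
Proof. by move=> hc; apply: continuous01_integrable => t /hc[]. Qed.

Lemma cint01D h k : ccont01 h -> ccont01 k ->
  cint01 (fun t => h t + k t) = cint01 h + cint01 k.
Proof.
move=> hc kc; apply: complexP; rewrite /cint01 /=.
  under eq_Rintegral do rewrite cReD.
  by rewrite RintegralD//; exact: ccont01_intRe.
under eq_Rintegral do rewrite cImD.
by rewrite RintegralD//; exact: ccont01_intIm.
Qed.

Lemma integrableZl01 (k : R -> R) c :
  mu.-integrable `[0%R, 1%R] (EFin \o k) ->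
  mu.-integrable `[0%R, 1%R] (EFin \o (fun t => c * k t)).
Proof. by move=> ki; apply: (@integrableZl _ _ _ _ _ _ c _ ki). Qed.

Lemma cint01Z (c : C) h : ccont01 h -> cint01 (fun t => c * h t) = c * cint01 h.
Proof.
move=> hc; have hr := ccont01_intRe hc; have hi := ccont01_intIm hc.
apply: complexP; rewrite ?cReM ?cImM /cint01 /=.
  under eq_Rintegral do rewrite cReM.
  rewrite RintegralB//; try exact: integrableZl01.
  by rewrite !RintegralZl.
under eq_Rintegral do rewrite cImM.
rewrite RintegralD//; try exact: integrableZl01.
by rewrite !RintegralZl.
Qed.

Lemma cint01_FTC (F f : R -> C) :
  (forall t, 0 <= t <= 1 -> cderiv F t (f t)) -> ccont01 f ->
  cint01 f = F 1 - F 0.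
Proof.
move=> Ff fc.
have key (K k : R -> R) : (forall t, 0 <= t <= 1 -> is_derive t 1 K (k t)) ->
    (forall t, 0 <= t <= 1 -> k u @[u --> within `[0, 1] (nbhs t)] --> k t) ->
    \int[mu]_(t in `[0%R, 1%R]) k t = K 1 - K 0.
  move=> Kk kc; rewrite /Rintegral (@continuous_FTC2 _ k K)//.
  - exact: continuous01_within.
  - have Kc t : 0 <= t <= 1 -> K u @[u --> t] --> K t.
      move=> t01; have [Kd _] := Kk t t01.
      by apply: differentiable_continuous; exact/derivable1_diffP.
    split.
    + by move=> t; rewrite in_itv/= => /andP[t0 t1]; have [] := Kk t; rewrite ?ltW.
    + by apply: cvg_at_right_filter; apply: Kc; rewrite lexx ler01.
    + by apply: cvg_at_left_filter; apply: Kc; rewrite lexx ler01.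
  - move=> t; rewrite in_itv/= => /andP[t0 t1].
    have t01 : 0 <= t <= 1 by rewrite !ltW.
    by have [_] := Kk t t01; rewrite derive1E.
apply: complexP; rewrite ?cReD ?cReN ?cImD ?cImN /cint01 /=.
  apply: (key (fun t => Re (F t)) (fun t => Re (f t))) => t t01.
    by have [] := Ff t t01.
  by have [] := fc t t01.
apply: (key (fun t => Im (F t)) (fun t => Im (f t))) => t t01.
  by have [] := Ff t t01.
by have [] := fc t t01.
Qed.

Variable S : contour R.
Hypothesis S_closed : closed_contour S.
Local Notation arc j := (nth (fun=> 0 : C) S j).
Local Notation J := (contour_integral S).

Lemma arc_cderiv j t : (j < size S)%N -> cderiv (arc j) t (arc_derive (arc j) t).
Proof.
case: S_closed => arcs _ jS; have [[dr _] [di _]] := arcs j jS.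
by split; rewrite /arc_derive /= derive1E; exact/derivableP.
Qed.

Lemma arc_cont j : (j < size S)%N -> ccont01 (arc j).
Proof.
move=> jS t _; have [[dr _] [di _]] := arc_cderiv t jS.
by split; apply: cvg_within_filter; apply: differentiable_continuous;
  exact/derivable1_diffP.
Qed.

Lemma arc_derive_cont j : (j < size S)%N -> ccont01 (arc_derive (arc j)).
Proof.
case: S_closed => arcs _ jS t _; have [[_ cr] [_ ci]] := arcs j jS.
by split; apply: cvg_within_filter; [exact: cr|exact: ci].
Qed.

Lemma contour_integralE f :
  J f = \sum_(j < size S) cint01 (fun t => f (arc j t) * arc_derive (arc j) t).
Proof. by rewrite /contour_integral (big_nth (fun=> 0)) big_mkord. Qed.

Definition okc (f : C -> C) : Prop :=
  forall j, (j < size S)%N -> ccont01 (fun t => f (arc j t)).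

Lemma arc_on_contour j t : (j < size S)%N -> 0 <= t <= 1 -> on_contour S (arc j t).
Proof. by move=> jS t01; exists j => //; exists t. Qed.

Lemma okcD f g : okc f -> okc g -> okc (fun z => f z + g z).
Proof. by move=> fc gc j jS t t01; apply: ccvgD; [exact: fc|exact: gc]. Qed.

Lemma okcM f g : okc f -> okc g -> okc (fun z => f z * g z).
Proof. by move=> fc gc j jS t t01; apply: ccvgM; [exact: fc|exact: gc]. Qed.

Lemma okc_cst c : okc (fun=> c).
Proof. by move=> j jS t t01; exact: ccvg_cst. Qed.

Lemma okc_id : okc id.
Proof. by move=> j jS; exact: arc_cont. Qed.

Lemma okcV f : (forall z, on_contour S z -> f z != 0) -> okc f ->
  okc (fun z => (f z)^-1).
Proof.
move=> f0 fc j jS t t01; apply: ccvgV; last exact: fc.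
by apply: f0; exact: arc_on_contour.
Qed.

Lemma okcX f n : okc f -> okc (fun z => f z ^+ n).
Proof. by move=> fc j jS t t01; apply: ccvgX; exact: fc. Qed.

Lemma okc_prod (I : Type) (r : seq I) (f : I -> C -> C) :
  (forall i, okc (f i)) -> okc (fun z => \prod_(i <- r) f i z).
Proof. by move=> fc j jS t t01; apply: ccvg_prod => i _; exact: fc. Qed.

Lemma okc_sum (I : Type) (r : seq I) (f : I -> C -> C) :
  (forall i, okc (f i)) -> okc (fun z => \sum_(i <- r) f i z).
Proof. by move=> fc j jS t t01; apply: ccvg_sum => i _; exact: fc. Qed.

Lemma okc_cexp f : okc f -> okc (fun z => cexp (f z)).
Proof. by move=> fc j jS t t01; apply: ccvg_cexp; exact: fc. Qed.

Lemma okc_horner (P : {poly C}) : okc (horner P).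
Proof.
move=> j jS t t01; rewrite horner_coef.
rewrite (_ : (fun u => _) = fun u => \sum_(i < size P) P`_i * arc j u ^+ i).
  2: by apply/funext => u; rewrite horner_coef.
apply: ccvg_sum => i _; apply: ccvgM; first exact: ccvg_cst.
by apply: ccvgX; exact: arc_cont.
Qed.

Lemma okc_arc f j : okc f -> (j < size S)%N ->
  ccont01 (fun t => f (arc j t) * arc_derive (arc j) t).
Proof.
by move=> fc jS t t01; apply: ccvgM; [exact: fc|exact: arc_derive_cont].
Qed.

Lemma contour_integralD f g : okc f -> okc g ->
  J (fun z => f z + g z) = J f + J g.
Proof.
move=> fc gc; rewrite !contour_integralE -big_split/=; apply: eq_bigr => j _.
rewrite -cint01D; [|exact: okc_arc..].
by congr cint01; apply/funext => t; rewrite mulrDl.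
Qed.

Lemma contour_integralZ c f : okc f -> J (fun z => c * f z) = c * J f.
Proof.
move=> fc; rewrite !contour_integralE mulr_sumr; apply: eq_bigr => j _.
rewrite -cint01Z; last exact: okc_arc.
by congr cint01; apply/funext => t; rewrite mulrA.
Qed.

Lemma eq_contour_integral f g : (forall z, on_contour S z -> f z = g z) ->
  J f = J g.
Proof.
move=> fg; rewrite !contour_integralE; apply: eq_bigr => j _.
rewrite /cint01; congr (_ +i* _); apply: eq_Rintegral => t;
  rewrite inE/= in_itv/= => t01; rewrite fg//; exact: arc_on_contour.
Qed.

Lemma contour_integral_sum (I : Type) (r : seq I) (f : I -> C -> C) :
  (forall i, okc (f i)) ->
  J (fun z => \sum_(i <- r) f i z) = \sum_(i <- r) J (f i).
Proof.
move=> fc; elim: r => [|i r IH].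
  rewrite big_nil (@eq_contour_integral _ (fun z => 0 * (0 : C))).
    by rewrite contour_integralZ ?mul0r//; exact: okc_cst.
  by move=> z _; rewrite big_nil mul0r.
rewrite big_cons -IH -contour_integralD//; last exact: okc_sum.
by apply: eq_contour_integral => z _; rewrite big_cons.
Qed.

(** Each arc contributes F(end) - F(start); ends and starts agree up to a rotation of the cycle. *)
Lemma contour_integral_primitive (F f : C -> C) : okc f ->
  (forall j t, (j < size S)%N -> 0 <= t <= 1 ->
    cderiv (fun u => F (arc j u)) t (f (arc j t) * arc_derive (arc j) t)) ->
  J f = 0.
Proof.
move=> fc Ff.
rewrite contour_integralE.
rewrite (eq_bigr (fun j : 'I_(size S) => F (arc j 1) - F (arc j 0))); last first.
  move=> j _; apply: (@cint01_FTC (fun u => F (arc j u))).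
    by move=> t t01; exact: Ff.
  exact: okc_arc.
rewrite sumrB.
rewrite -[X in X - _](big_mkord xpredT (fun j => F (arc j 1))).
rewrite -[X in _ - X](big_mkord xpredT (fun j => F (arc j 0))).
rewrite -(big_nth (fun=> 0) xpredT (fun g : R -> C => F (g 1))).
rewrite -(big_nth (fun=> 0) xpredT (fun g : R -> C => F (g 0))).
case: S_closed => _ cyc.
suff -> : \sum_(g <- S) F (g 1) = \sum_(g <- S) F (g 0) by rewrite subrr.
case: S cyc => [|x p]; first by rewrite !big_nil.
rewrite /path.cycle => xp.
(* For the closed path x, p, x, [belast] lists every arc once for its end and [rcons p x] lists
   every arc once for its start. *)
have key (s : seq (R -> C)) y : path (fun g h : R -> C => g 1 == h 0) y s ->
    \sum_(g <- belast y s) F (g 1) = \sum_(g <- s) F (g 0).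
  elim: s y => [|z s IH] y /=; first by rewrite !big_nil.
  by move=> /andP[/eqP yz zs]; rewrite !big_cons yz IH.
have := key _ _ xp; rewrite belast_rcons => ->.
by rewrite -cats1 big_cat big_seq1 big_cons addrC.
Qed.

Definition null_form f := okc f /\ J f = 0.

Lemma null_pow n : null_form (fun z => z ^+ n).
Proof.
split; first by apply: okcX; exact: okc_id.
apply: (@contour_integral_primitive (fun z => (n.+1%:R)^-1 * z ^+ n.+1)).
  by apply: okcX; exact: okc_id.
move=> j t jS _.
have := cderivM (cderiv_cst (n.+1%:R)^-1 t) (cderivX n.+1 (arc_cderiv t jS)).
by rewrite mul0r addr0 !mulrA mulVf ?pnatr_eq0// mul1r.
Qed.

Lemma okc_subV c : ~ on_contour S c -> okc (fun z => (z - c)^-1).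
Proof.
move=> cS; apply: okcV; last by apply: okcD; [exact: okc_id|exact: okc_cst].
by move=> z zS; rewrite subr_eq0; apply/eqP => zc; apply: cS; rewrite -zc.
Qed.

(** A pole of order at least 2 has a primitive, so c only has to be off the curve, whatever its
    winding number. *)
Lemma null_inv c n : ~ on_contour S c -> null_form (fun z => (z - c)^-1 ^+ n.+2).
Proof.
move=> cS; have okV := okc_subV cS.
split; first exact: okcX.
apply: (@contour_integral_primitive (fun z => - (n.+1%:R)^-1 * (z - c)^-1 ^+ n.+1)).
  exact: okcX.
move=> j t jS t01.
have dc : cderiv (fun u => arc j u - c) t (arc_derive (arc j) t).
  have := cderivD (arc_cderiv t jS) (cderiv_cst (- c) t).
  by rewrite addr0.
have nz : arc j t - c != 0.
  rewrite subr_eq0; apply/eqP => zc; apply: cS; rewrite -zc.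
  exact: arc_on_contour.
have := cderivM (cderiv_cst (- (n.+1%:R)^-1) t) (cderivX n.+1 (cderivV nz dc)).
rewrite mul0r addr0; set d := (X in cderiv _ _ X).
suff -> : d = (arc j t - c)^-1 ^+ n.+2 * arc_derive (arc j) t by [].
rewrite /d /= -exprVn !exprS expr0 mulr1.
have n0 : n.+1%:R != 0 :> C by rewrite pnatr_eq0.
move: (arc j t - c)^-1 => v; move: (arc_derive _ _) => g.
move: (v ^+ n) => w; field.
by rewrite -natr1 in n0.
Qed.

Lemma winding_integral c :
  J (fun z => (z - c)^-1) = 2 * pi%:C * 'i%C * winding S c.
Proof.
rewrite /winding mulrA divff ?mul1r// !mulf_neq0 ?pnatr_eq0//.
  by rewrite (_ : 0 = 0%:C)// (inj_eq (@complexI _)) gt_eqF// pi_gt0.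
by rewrite eq_complex /= oner_eq0 andbF.
Qed.

Lemma null_inv1 c : leaves_out S c -> null_form (fun z => (z - c)^-1).
Proof.
by move=> [cS wc]; split; [exact: okc_subV|rewrite winding_integral wc mulr0].
Qed.

(** Rational functions with poles in [cs], as the closure of the elementary terms of partial
    fractions: no decomposition has to be written down. Equality is asked off [cs] only, so that the
    values given by [0^-1 = 0] at the poles do not matter. *)
Inductive polar (cs : seq C) : (C -> C) -> Prop :=
| polar_pow n : polar cs (fun z => z ^+ n)
| polar_inv c n : c \in cs -> polar cs (fun z => (z - c)^-1 ^+ n.+1)
| polarD f g : polar cs f -> polar cs g -> polar cs (fun z => f z + g z)
| polarZ a f : polar cs f -> polar cs (fun z => a * f z)
| polar_ext f g : (forall z, z \notin cs -> f z = g z) ->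
    polar cs f -> polar cs g.

(** Every generator has a primitive along the curve except the simple pole, whose integral is a
    winding number, here 0. *)
Lemma polar_null cs f : (forall c, c \in cs -> leaves_out S c) ->
  polar cs f -> null_form f.
Proof.
move=> out; have offS z : on_contour S z -> z \notin cs.
  by move=> zS; apply/negP => /out[].
elim=> [n|c [|n] /out cS|{}f g _ [fc f0] _ [gc g0]|a {}f _ [fc f0]|{}f g fg _ [fc f0]].
- exact: null_pow.
- have [h1 h2] := null_inv1 cS; split; first exact: okcX.
  by rewrite -[RHS]h2; apply: eq_contour_integral => z _; rewrite expr1.
- by apply: null_inv; case: cS.
- by split; [exact: okcD|rewrite contour_integralD// f0 g0 addr0].
- split; last by rewrite contour_integralZ// f0 mulr0.
  by apply: okcM => //; exact: okc_cst.
- split; last by rewrite -f0; apply: eq_contour_integral => z /offS/fg.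
  move=> j jS t t01; rewrite -fg; last by apply: offS; exact: arc_on_contour.
  apply: (near_eq_ccvg _ (fc j jS t t01)).
  have : within `[0, 1] (nbhs t) [set u | f (arc j u) = g (arc j u)].
    rewrite /within /=; apply: filterE => u; rewrite in_itv/= => u01.
    by rewrite fg//; apply: offS; exact: arc_on_contour.
  by [].
Qed.

Lemma polar_sum cs (I : Type) (r : seq I) (f : I -> C -> C) :
  (forall i, polar cs (f i)) -> polar cs (fun z => \sum_(i <- r) f i z).
Proof.
move=> fp; elim: r => [|i r IH].
  apply: polar_ext (polarZ 0 (polar_pow cs 0)) => z _.
  by rewrite big_nil mul0r.
by apply: polar_ext (polarD (fp i) IH) => z _; rewrite big_cons.
Qed.

Lemma polar_horner cs (P : {poly C}) : polar cs (horner P).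
Proof.
apply: (@polar_ext _ (fun z => \sum_(i < size P) P`_i * z ^+ i)).
  by move=> z _; rewrite horner_coef.
by apply: polar_sum => i; apply: polarZ; exact: polar_pow.
Qed.

(** Stability under division by z - c replaces the partial fraction theorem. *)
Lemma polar_div cs c f : c \in cs -> polar cs f ->
  polar cs (fun z => f z / (z - c)).
Proof.
move=> ccs; have nz z : z \notin cs -> z - c != 0.
  by move=> zcs; rewrite subr_eq0; apply: contraNneq zcs => ->.
elim=> [n|d n dcs|{}f g _ IHf _ IHg|a {}f _ IHf|{}f g fg _ IHf].
(* z^(n+1)/(z - c) = z^n + c z^n/(z - c). *)
- elim: n => [|n IH].
    by apply: polar_ext (polar_inv 0 ccs) => z _; rewrite expr1 expr0 mul1r.
  apply: polar_ext (polarD (polar_pow cs n) (polarZ c IH)) => z zcs.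
  by rewrite exprS; move: (z ^+ n) => w; field; exact: nz.
- have [->|cd] := eqVneq d c.
    by apply: polar_ext (polar_inv n.+1 ccs) => z _; rewrite [RHS]mulrC -exprS.
  have dc : d - c != 0 by rewrite subr_eq0.
  have nz' z : z \notin cs -> z - d != 0.
    by move=> zcs; rewrite subr_eq0; apply: contraNneq zcs => ->.
  (* 1/((z - d)(z - c)) = (1/(d - c)) (1/(z - d) - 1/(z - c)) lowers the order at d by one. *)
  elim: n => [|n IH].
    apply: polar_ext (polarZ (d - c)^-1 (polarD (polar_inv 0 dcs)
      (polarZ (-1) (polar_inv 0 ccs)))) => z zcs.
    by rewrite !expr1; field; rewrite dc nz ?nz'.
  apply: polar_ext (polarZ (d - c)^-1 (polarD (polar_inv n.+1 dcs)
      (polarZ (-1) IH))) => z zcs.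
  rewrite !exprS; move: (_ ^+ n) => w; field.
  by rewrite dc nz ?nz'.
- by apply: polar_ext (polarD IHf IHg) => z _; rewrite mulrDl.
- by apply: polar_ext (polarZ a IHf) => z _; rewrite mulrA.
- by apply: polar_ext IHf => z zcs; rewrite fg.
Qed.

Lemma polar_ratio cs (P : {poly C}) ds : {subset ds <= cs} ->
  polar cs (fun z => P.[z] / \prod_(d <- ds) (z - d)).
Proof.
elim: ds => [|d ds IH] dscs.
  apply: polar_ext (polar_horner cs P) => z _.
  by rewrite big_nil divr1.
have dcs : d \in cs by apply: dscs; rewrite mem_head.
have {}IH := IH (fun x xds => dscs x (mem_behead (s := d :: ds) xds)).
apply: polar_ext (polar_div dcs IH) => z _.
by rewrite big_cons invfM mulrA mulrAC.
Qed.

Section Residues.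
Variables (zs cs : seq C).
Hypothesis zs_uniq : uniq zs.
Hypothesis zs_in : forall z, z \in zs -> encloses S z.
Hypothesis cs_out : forall c, c \in cs -> leaves_out S c.

Let zs_cs z : z \in zs -> z \notin cs.
Proof.
move=> /zs_in[_ w1]; apply/negP => /cs_out[_].
by rewrite w1 => /eqP; rewrite oner_eq0.
Qed.

Let cs_off z : on_contour S z -> z \notin cs.
Proof. by move=> zS; apply/negP => /cs_out[]. Qed.

Let zs_off z : on_contour S z -> z \notin zs.
Proof. by move=> zS; apply/negP => /zs_in[]. Qed.

(** The weights [a] make Q, which is P minus an interpolating part, vanish at all nodes. Dividing Q
    by the product over the nodes leaves only poles outside the contour, hence integral 0; each
    remaining a w / (z - w) contributes a winding number 1. *)
Lemma rational_residues (P : {poly C}) :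
  J (fun z => P.[z] / (\prod_(c <- cs) (z - c) * \prod_(w <- zs) (z - w))) =
  2 * pi%:C * 'i%C *
  \sum_(z <- zs) P.[z] / (\prod_(c <- cs) (z - c) * other_prod zs z).
Proof.
pose a z := P.[z] / (\prod_(c <- cs) (z - c) * other_prod zs z).
pose Cp := \prod_(c <- cs) ('X - c%:P).
pose Z := \prod_(w <- zs) ('X - w%:P).
pose Q := P - \sum_(z <- zs) (a z)%:P * (Cp * \prod_(w <- zs | w != z) ('X - w%:P)).
have Qz z : z \in zs -> Q.[z] = 0.
  move=> zzs; rewrite /Q hornerD hornerN horner_sum (bigD1_seq z)//=.
  rewrite [X in _ - (_ + X)]big1.
    rewrite addr0 !hornerM hornerC !horner_prodXsubC.
    rewrite -/(other_prod zs z) /a mulrVK ?subrr// unitfE mulf_neq0//.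
      by apply: prod_sub_neq0; exact: zs_cs.
    exact: other_prod_neq0.
  move=> w wz; rewrite !hornerM !horner_prodXsubC.
  by rewrite [X in _ * (_ * X)](big_rem _ zzs) /= eq_sym wz subrr mul0r !mulr0.
have [P1 QE] : exists P1, Q = P1 * Z.
  apply/dvdpP; rewrite uniq_roots_dvdp//.
    by apply/allP => z zzs; apply/rootP; exact: Qz.
  by rewrite uniq_rootsE.
pose f z := P1.[z] / \prod_(c <- cs) (z - c).
have [fc f0] : null_form f by apply: (polar_null cs_out); exact: polar_ratio.
(* The test makes [g w] continuous along the curve for every w, as [contour_integral_sum] demands,
   and not only for the nodes. *)
pose g w z := if w \in zs then a w * (z - w)^-1 else 0.
have gc w : okc (g w).
  rewrite /g; have [/zs_in[wS _]|_] := boolP (w \in zs); last exact: okc_cst.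
  by apply: okcM; [exact: okc_cst|exact: okc_subV].
have PE z : on_contour S z ->
    P.[z] / (\prod_(c <- cs) (z - c) * \prod_(w <- zs) (z - w)) =
    f z + \sum_(w <- zs) g w z.
  move=> zS.
  have C0 := prod_sub_neq0 (cs_off zS); have Z0 := prod_sub_neq0 (zs_off zS).
  have -> : P = P1 * Z + \sum_(w <- zs) (a w)%:P *
      (Cp * \prod_(w' <- zs | w' != w) ('X - w'%:P)) by rewrite -QE subrK.
  rewrite hornerD horner_sum mulrDl; congr (_ + _).
    by rewrite hornerM horner_prodXsubC /f; field; rewrite C0 Z0.
  rewrite mulr_suml [LHS]big_seq [RHS]big_seq; apply: eq_bigr => w wzs.
  rewrite /g wzs.
  rewrite !hornerM hornerC !horner_prodXsubC.
  move: Z0; rewrite (bigD1_seq w)//= mulf_eq0 negb_or => /andP[zw Z0].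
  by field; rewrite Z0 zw C0.
rewrite (eq_contour_integral PE) contour_integralD//; last exact: okc_sum.
rewrite f0 add0r contour_integral_sum// mulr_sumr [LHS]big_seq [RHS]big_seq.
apply: eq_bigr => w wzs; have [wS w1] := zs_in wzs.
rewrite /g; under eq_fun do rewrite wzs.
rewrite contour_integralZ; last exact: okc_subV.
by rewrite winding_integral w1 mulr1 mulrC.
Qed.

End Residues.

End ContourIntegral.

(** * Limits under the contour integral *)

Section ContourLimits.
Variable R : realType.
Local Notation C := R[i].
Local Notation Re := (@complex.Re R).
Local Notation Im := (@complex.Im R).
Local Notation mu := (@lebesgue_measure R).
Implicit Types t : R.

Lemma Rintegral01_cvg (k_ : nat -> R -> R) (k : R -> R) (M : R) :
  (forall n, mu.-integrable `[0%R, 1%R] (EFin \o k_ n)) ->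
  (forall t, 0 <= t <= 1 -> k_ n t @[n --> \oo] --> k t) ->
  (forall n t, 0 <= t <= 1 -> `|k_ n t| <= M) ->
  \int[mu]_(t in `[0%R, 1%R]) k_ n t @[n --> \oo] -->
  \int[mu]_(t in `[0%R, 1%R]) k t.
Proof.
move=> ki kc kM.
have mk n := measurable_int mu (ki n).
have ck t : (`[0, 1]%classic : set R) t ->
    (EFin \o k_ n) t @[n --> \oo] --> (EFin \o k) t.
  rewrite /= in_itv/= => t01; apply: cvg_EFin; first exact: nearW.
  exact: kc.
have [] := @dominated_convergence _ _ R mu (`[0, 1]%classic : set R) _ (fun n => EFin \o k_ n)
  (EFin \o k) (EFin \o cst M).
- exact: measurable_itv.
- exact: mk.
- exact: emeasurable_fun_cvg mk ck.
- exact: aeW.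
- apply: continuous01_integrable => t _; exact: cvg_cst.
- by apply: aeW => t n /=; rewrite in_itv/= => t01; rewrite lee_fin kM.
move=> kint _ cv; apply: fine_cvg; rewrite /= fineK//.
exact: integrable_fin_num.
Qed.

Lemma cint01_cvg (h_ : nat -> R -> C) (h : R -> C) (M : R) :
  (forall n, ccont01 (h_ n)) ->
  (forall t, 0 <= t <= 1 -> ccvg \oo (h_ ^~ t) (h t)) ->
  (forall n t, 0 <= t <= 1 -> normc (h_ n t) <= M) ->
  ccvg \oo (fun n => cint01 (h_ n)) (cint01 h).
Proof.
move=> hc hl hM; split => /=.
  apply: (@Rintegral01_cvg (fun n t => Re (h_ n t)) (fun t => Re (h t)) M).
  - by move=> n; exact: ccont01_intRe.
  - by move=> t /hl[].
  - by move=> n t /(hM n); apply: le_trans; exact: ler_Re_normc.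
apply: (@Rintegral01_cvg (fun n t => Im (h_ n t)) (fun t => Im (h t)) M).
- by move=> n; exact: ccont01_intIm.
- by move=> t /hl[].
- by move=> n t /(hM n); apply: le_trans; exact: ler_Im_normc.
Qed.

Lemma ccont01_bounded (h : R -> C) : ccont01 h ->
  exists M, forall t, 0 <= t <= 1 -> normc (h t) <= M.
Proof.
move=> hc.
have cn : {within `[0%R, 1%R], continuous (fun t => normc (h t))}.
  by apply: continuous01_within => t /hc /ccvg_normc.
have [c _ cmax] := EVT_max ler01 cn.
by exists (normc (h c)) => t t01; apply: cmax; rewrite in_itv.
Qed.

Variable S : contour R.
Hypothesis S_closed : closed_contour S.
Local Notation arc j := (nth (fun=> 0 : C) S j).
Local Notation J := (contour_integral S).

Lemma arcs_bounded (h : nat -> R -> C) :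
  (forall j, (j < size S)%N -> ccont01 (h j)) ->
  exists M, forall j t, (j < size S)%N -> 0 <= t <= 1 -> normc (h j t) <= M.
Proof.
move=> hc; elim: (size S) hc => [|n IH] hc; first by exists 0.
have [M MP] := IH (fun j jn => hc j (ltnW jn)).
have [M' M'P] := ccont01_bounded (hc n (ltnSn n)).
exists (Num.max M M') => j t; rewrite ltnS leq_eqVlt => /predU1P[->|jn] t01.
  by rewrite le_max M'P ?orbT.
by rewrite le_max MP.
Qed.

Lemma okc_bounded f : okc S f -> exists M, forall z, on_contour S z -> normc (f z) <= M.
Proof.
move=> fc; have [M MP] := @arcs_bounded (fun j t => f (arc j t)) fc.
by exists M => z [j jS [t t01 <-]]; exact: MP.
Qed.

Lemma contour_integral_cvg (f_ : nat -> C -> C) (f : C -> C) (M : R) :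
  (forall n, okc S (f_ n)) ->
  (forall z, on_contour S z -> ccvg \oo (f_ ^~ z) (f z)) ->
  (forall n z, on_contour S z -> normc (f_ n z) <= M) ->
  ccvg \oo (fun n => J (f_ n)) (J f).
Proof.
move=> fc fl fM; rewrite contour_integralE.
under eq_fun do rewrite contour_integralE.
apply: ccvg_sum => j _.
have [B BP] := ccont01_bounded (arc_derive_cont S_closed (ltn_ord j)).
apply: (@cint01_cvg _ _ (M * B)).
- by move=> n; exact: okc_arc.
- move=> t t01; apply: ccvgM; last exact: ccvg_cst.
  by apply: fl; exact: arc_on_contour.
- move=> n t t01; rewrite normcM ler_pM ?normc_ge0 ?BP// fM//.
  exact: arc_on_contour.
Qed.

(** Telescoping of a^n - b^n; [1 <= B] allows [B ^+ n] where n - 1 factors would do. *)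
Lemma normc_subX_le (a b : C) (B : R) n : 1 <= B -> normc a <= B -> normc b <= B ->
  normc (a ^+ n - b ^+ n) <= n%:R * normc (a - b) * B ^+ n.
Proof.
move=> B1 aB bB; elim: n => [|n IH].
  by rewrite subrr normc0 !mul0r.
have -> : a ^+ n.+1 - b ^+ n.+1 = a * (a ^+ n - b ^+ n) + (a - b) * b ^+ n.
  by rewrite !exprS; ring.
apply: le_trans (le_normcD _ _) _; rewrite !normcM normcX.
have B0 : 0 <= B by rewrite (le_trans _ B1).
have h1 : normc a * normc (a ^+ n - b ^+ n) <= n%:R * normc (a - b) * B ^+ n.+1.
  by rewrite exprS mulrCA ler_pM ?normc_ge0.
have h2 : normc (a - b) * normc b ^+ n <= normc (a - b) * B ^+ n.+1.
  rewrite ler_wpM2l ?normc_ge0// (@le_trans _ _ (B ^+ n))//.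
    by rewrite lerXn2r// nnegrE normc_ge0.
  by rewrite exprS ler_peMl// exprn_ge0.
by apply: le_trans (lerD h1 h2) _; rewrite -natr1; lra.
Qed.

(** With v = w/(n+1), e^w is the (n+1)-st power of e^v; the two powers differ by at most a constant
    times n + 1 times the quadratic remainder of e^v, hence by O(1/n). *)
Lemma cexp_cvg (w : C) : ccvg \oo (fun n => (1 + w / n.+1%:R) ^+ n.+1) (cexp w).
Proof.
apply: normc_cvg0.
pose K := 4 * normc w ^+ 2 * expR (normc w) * expR (normc w).
apply: (@squeeze_cvgr _ _ _ _ (cst 0) (fun n => K * (n.+1%:R)^-1)); first last.
- by rewrite -(mulr0 K); apply: cvgMr; exact: cvg_harmonic.
- exact: cvg_cst.
apply: nearW => n; rewrite normc_ge0/=.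
have n0 : 0 < n.+1%:R :> R by [].
set v := w / n.+1%:R.
have nv : normc v = normc w / n.+1%:R.
  by rewrite normcM -natVC normc_real ger0_norm.
have -> : cexp w = cexp v ^+ n.+1.
  by rewrite cexpX -[v *+ _]mulr_natr mulfVK// pnatr_eq0.
rewrite -normcN opprB.
apply: le_trans (normc_subX_le (B := expR (normc v)) _ _ _ _) _.
- by rewrite -expR0 ler_expR normc_ge0.
- by rewrite normc_cexp ler_expR (le_trans (ler_norm _))// ler_Re_normc.
- apply: le_trans (le_normcD _ _) _; rewrite normc1; exact: expR_ge1Dx.
rewrite -expRM_natl nv mulrCA divff ?gt_eqF// mulr1 opprD addrA.
have := cexp_estimate v; rewrite nv => h.
have e1 : expR (normc w / n.+1%:R) <= expR (normc w).
  by rewrite ler_expR ler_pdivrMr// ler_peMr ?normc_ge0// ler1n.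
rewrite (@le_trans _ _ (n.+1%:R * (4 * (normc w / n.+1%:R) ^+ 2 * expR (normc w)) * expR (normc w)))//.
  rewrite ler_wpM2r ?expR_ge0// ler_wpM2l// (le_trans h)//.
  by rewrite ler_wpM2l// mulr_ge0// sqr_ge0.
rewrite /K le_eqVlt; apply/orP; left; apply/eqP.
by field; rewrite gt_eqF.
Qed.

End ContourLimits.

(** * Residues of Gamma quotients *)

Section GammaResidues.
Variable R : realType.
Local Notation C := R[i].
Variable S : contour R.
Hypothesis S_closed : closed_contour S.
Local Notation J := (contour_integral S).
Variable zs : seq C.
Hypothesis zs_uniq : uniq zs.
Hypothesis zs_in : forall z, z \in zs -> encloses S z.

Lemma exp_residues (cs : seq C) (l : C) (P : {poly C}) :
  (forall c, c \in cs -> leaves_out S c) ->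
  J (fun z => cexp (l * z) *
      (P.[z] / (\prod_(c <- cs) (z - c) * \prod_(w <- zs) (z - w)))) =
  2 * pi%:C * 'i%C *
  \sum_(z <- zs) cexp (l * z) * (P.[z] / (\prod_(c <- cs) (z - c) * other_prod zs z)).
Proof.
move=> cs_out.
pose e n z : C := (1 + l * z / n.+1%:R) ^+ n.+1.
pose g z := P.[z] / (\prod_(c <- cs) (z - c) * \prod_(w <- zs) (z - w)).
have off z : on_contour S z -> z \notin cs /\ z \notin zs.
  by move=> zS; split; apply/negP; [move=> /cs_out[]|move=> /zs_in[]].
have okp ds : okc S (fun z => \prod_(c <- ds) (z - c)).
  by apply: okc_prod => c; apply: okcD; [exact: okc_id|exact: okc_cst].
have gc : okc S g.
  apply: okcM; first exact: okc_horner.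
  apply: okcV; last by apply: okcM; exact: okp.
  by move=> z /off[zc zz]; rewrite mulf_neq0 ?prod_sub_neq0.
have ec n : okc S (e n).
  apply: okcX; apply: okcD; first exact: okc_cst.
  apply: okcM; last exact: okc_cst.
  by apply: okcM; [exact: okc_cst|exact: okc_id].
have lc : okc S (fun z => l * z).
  by apply: okcM; [exact: okc_cst|exact: okc_id].
have [M MP] := okc_bounded lc.
have [B BP] := okc_bounded gc.
(* [1 + t <= expR t] bounds all the approximating polynomials on the curve by one constant, M being
   a bound of |l z| there. *)
have eb n z : on_contour S z -> normc (e n z) <= expR M.
  move=> zS; rewrite /e normcX.
  have : normc (1 + l * z / n.+1%:R) <= expR (M / n.+1%:R).
    rewrite (le_trans _ (expR_ge1Dx _))// (le_trans (le_normcD _ _))// normc1.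
    rewrite lerD2l -natVC normcM normc_real ger0_norm// ler_wpM2r//.
    exact: MP.
  move=> h; apply: le_trans (lerXn2r n.+1 _ _ h) _; rewrite ?nnegrE ?normc_ge0 ?expR_ge0//.
  by rewrite -expRM_natl mulrCA divff ?mulr1// pnatr_eq0.
have Jc : ccvg \oo (fun n => J (fun z => e n z * g z)) (J (fun z => cexp (l * z) * g z)).
  apply: (@contour_integral_cvg _ S S_closed _ _ (expR M * B)).
  - by move=> n; exact: okcM.
  - by move=> z _; apply: ccvgM (cexp_cvg _) (ccvg_cst _).
  - by move=> n z zS; rewrite normcM ler_pM ?normc_ge0 ?BP ?eb.
apply: (ccvg_unique Jc).
have JE n : J (fun z => e n z * g z) = 2 * pi%:C * 'i%C *
  \sum_(z <- zs) e n z * (P.[z] / (\prod_(c <- cs) (z - c) * other_prod zs z)).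
  pose Pn : {poly C} := (1 + (l / n.+1%:R)%:P * 'X) ^+ n.+1 * P.
  have PnE z : Pn.[z] = e n z * P.[z].
    by rewrite /Pn hornerM horner_exp !hornerE /e mulrAC.
  under eq_bigr do rewrite mulrA -PnE.
  rewrite -(@rational_residues _ _ S_closed _ _ zs_uniq zs_in cs_out).
  by congr contour_integral; apply/funext => z; rewrite PnE /g mulrA.
under eq_fun do rewrite JE.
apply: ccvgM (ccvg_cst _) _; apply: ccvg_sum => z _.
by apply: ccvgM (cexp_cvg _) (ccvg_cst _).
Qed.

(** Integrands at finite rank, without the nodes [zs], which stay apart as the poles to be enclosed.
    The class is closed under products and contains [cpow x], the Gauss products and, when the
    contour leaves out their zeros, the inverses of these. *)
Definition exp_rational (f : C -> C) : Prop :=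
  exists l (P : {poly C}) cs, (forall c, c \in cs -> leaves_out S c) /\
    forall z, f z = cexp (l * z) * (P.[z] / \prod_(c <- cs) (z - c)).

Lemma exp_rationalM f g : exp_rational f -> exp_rational g ->
  exp_rational (fun z => f z * g z).
Proof.
move=> [l [P [cs [co fE]]]] [m [Q [ds [dso gE]]]].
exists (l + m), (P * Q), (cs ++ ds); split.
  by move=> c; rewrite mem_cat => /orP[/co|/dso].
move=> z; rewrite fE gE mulrDl cexpD hornerM big_cat/= invfM.
by rewrite mulrACA; congr (_ * _); rewrite mulrACA.
Qed.

Lemma exp_rational_cst (c : C) : exp_rational (fun=> c).
Proof.
exists 0, c%:P, [::]; split=> // z.
by rewrite mul0r cexp0 hornerC big_nil divr1 mul1r.
Qed.

Lemma exp_rational_prod (I : Type) (r : seq I) (f : I -> C -> C) :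
  (forall i, exp_rational (f i)) -> exp_rational (fun z => \prod_(i <- r) f i z).
Proof.
move=> fe; elim: r => [|i r IH].
  by under eq_fun do rewrite big_nil; exact: exp_rational_cst.
by under eq_fun do rewrite big_cons; exact: exp_rationalM.
Qed.

Lemma exp_rational_cpow (x : R) : exp_rational (cpow x).
Proof.
exists (ln x)%:C, 1%:P, [::]; split=> // z.
by rewrite cpowE hornerC big_nil divr1 mulr1 mulrC.
Qed.

Lemma exp_rational_gauss n (a : C) : exp_rational (fun z => gauss n (z + a)).
Proof.
pose L : C := (ln n%:R)%:C.
exists (- L), ((cexp (- (a * L)) / n`!%:R)%:P *
  \prod_(i < n.+1) ('X + (a + i%:R)%:P)), [::]; split=> // z.
rewrite big_nil divr1 hornerM hornerC /gauss /poch cpowE.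
have -> : (\prod_(i < n.+1) ('X + (a + i%:R)%:P)).[z] =
    \prod_(i < n.+1) (z + a + i%:R).
  by rewrite horner_prod; apply: eq_bigr => i _; rewrite hornerD hornerX hornerC addrA.
rewrite invfM -/L cexpV mulrDl opprD cexpD mulNr [L * z]mulrC.
by move: (\prod_(_ < _) _) => q; ring.
Qed.

Lemma exp_rational_gaussV n (b : C) :
  (forall m : nat, leaves_out S (- (b + m%:R))) ->
  exp_rational (fun z => (gauss n (z + b))^-1).
Proof.
move=> bo; pose L : C := (ln n%:R)%:C.
exists L, (n`!%:R * cexp (b * L))%:P, [seq - (b + i%:R) | i <- iota 0 n.+1].
split=> [c /mapP[i _ ->]|z]; first exact: bo.
rewrite gaussV hornerC big_map /poch cpowE -/L mulrDl cexpD [L * z]mulrC.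
rewrite (_ : iota 0 n.+1 = index_iota 0 n.+1); last by rewrite /index_iota subn0.
have -> : \prod_(0 <= i < n.+1) (z - - (b + i%:R)) =
    \prod_(i < n.+1) (z + b + i%:R).
  by rewrite big_mkord; apply: eq_bigr => i _; rewrite opprK addrA.
by move: (\prod_(_ < _) _) => q; ring.
Qed.

Lemma exp_rational_okc f : exp_rational f -> okc S f.
Proof.
move=> [l [P [cs [co /funext ->]]]].
apply: okcM.
  by apply: okc_cexp; apply: okcM; [exact: okc_cst|exact: okc_id].
apply: okcM; first exact: okc_horner.
apply: okcV.
  by move=> z zS; apply: prod_sub_neq0; apply/negP => /co[].
by apply: okc_prod => c; apply: okcD; [exact: okc_id|exact: okc_cst].
Qed.

Lemma exp_rational_residues f : exp_rational f ->
  J (fun z => f z / \prod_(w <- zs) (z - w)) =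
  2 * pi%:C * 'i%C * \sum_(z <- zs) f z / other_prod zs z.
Proof.
move=> [l [P [cs [co fE]]]].
under eq_bigr do rewrite fE -[cexp _ * _ / _]mulrA -[_ / _ / _]mulrA -invfM.
rewrite -exp_residues//; congr contour_integral; apply/funext => z.
by rewrite fE -[cexp _ * _ / _]mulrA -[_ / _ / _]mulrA -invfM.
Qed.

(** Only from some rank on, because inverse Gauss products are controlled only once
    [gauss_lower_bound] applies. *)
Definition unif_bounded (u : nat -> C -> C) : Prop :=
  exists N B, forall n z, (N <= n)%N -> on_contour S z -> normc (u n z) <= B.

Lemma unif_boundedM u v : unif_bounded u -> unif_bounded v ->
  unif_bounded (fun n z => u n z * v n z).
Proof.
move=> [N [B uB]] [N' [B' vB]]; exists (maxn N N'), (B * B') => n z.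
rewrite geq_max => /andP[nN nN'] zS.
by rewrite normcM ler_pM ?normc_ge0 ?uB ?vB.
Qed.

Lemma unif_bounded_prod (I : eqType) (r : seq I) (u : I -> nat -> C -> C) :
  (forall i, i \in r -> unif_bounded (u i)) ->
  unif_bounded (fun n z => \prod_(i <- r) u i n z).
Proof.
elim: r => [|i r IH] ub.
  by exists 0%N, 1 => n z _ _; rewrite big_nil normc1.
have h1 := ub i (mem_head _ _).
have h2 := IH (fun j jr => ub j (mem_behead (s := i :: r) jr)).
have [N [B h]] := unif_boundedM h1 h2.
by exists N, B => n z nN zS; rewrite big_cons; exact: h.
Qed.

Lemma shift_bounded (a : C) : exists2 M, 0 <= M &
  forall z, on_contour S z -> normc (z + a) <= M.
Proof.
have ac : okc S (fun z => z + a).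
  by apply: okcD; [exact: okc_id|exact: okc_cst].
have [M MP] := okc_bounded ac.
exists (Num.max 0 M); first by rewrite le_max lexx.
by move=> z /MP zM; rewrite le_max zM orbT.
Qed.

Lemma unif_bounded_gauss (a : C) : unif_bounded (fun n z => gauss n (z + a)).
Proof.
have [M M0 MP] := shift_bounded a.
have [B BP] := gauss_upper_bound M0.
by exists 1%N, B => n z n0 /MP; exact: BP.
Qed.

(** From rank n0 on, the inverse has at most twice its modulus at rank n0, and the latter is bounded
    because it is continuous along the arcs. *)
Lemma unif_bounded_gaussV (b : C) :
  (forall m : nat, leaves_out S (- (b + m%:R))) ->
  unif_bounded (fun n z => (gauss n (z + b))^-1).
Proof.
move=> bo; have [M M0 MP] := shift_bounded b.
have [n0 n00 low] := gauss_lower_bound M0.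
have [B BP] := okc_bounded (exp_rational_okc (exp_rational_gaussV n0 bo)).
exists n0, (B * 2) => n z nn zS.
have nz : gauss n0 (z + b) != 0.
  apply: gauss_neq0; rewrite /poch; apply/prodf_neq0 => m _.
  apply/eqP => zbm; have [+ _] := bo m; apply.
  suff <- : z = - (b + m%:R) by [].
  by apply/eqP; rewrite -addr_eq0 addrA zbm.
have g0 : 0 < normc (gauss n0 (z + b)) by rewrite normc_gt0.
have h1 := low n (z + b) nn (MP z zS).
have h2 := BP z zS; rewrite normcV in h2; rewrite normcV.
have g1 : 0 < normc (gauss n (z + b)) by apply: lt_le_trans h1; rewrite divr_gt0.
apply: (@le_trans _ _ ((normc (gauss n0 (z + b)) / 2)^-1)).
  by rewrite lef_pV2 ?posrE ?divr_gt0.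
by rewrite invf_div mulrC ler_wpM2r.
Qed.

Lemma gauss_cvg_inv (b z : C) : (forall m : nat, z + b + m%:R != 0) ->
  ccvg \oo (fun n => (gauss n (z + b))^-1) (cGamma (z + b)).
Proof.
move=> nz; rewrite -[X in ccvg _ _ X]invrK; apply: ccvgV; last exact: gauss_cvg.
by rewrite invr_eq0; exact: cGamma_neq0.
Qed.

(** Both sides are limits of the formula for [Fn]. The constant [k] makes room for the sign of the
    denominator of the kernel. *)
Lemma gamma_residues (As Bs : seq C) (k : C) (x : R) :
  (forall b (m : nat), b \in Bs -> leaves_out S (- (b + m%:R))) ->
  let F z := \prod_(b <- Bs) cGamma (z + b) / \prod_(a <- As) cGamma (z + a) *
             (k * cpow x z) in
  J (fun z => F z / \prod_(w <- zs) (z - w)) =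
  2 * pi%:C * 'i%C * \sum_(z <- zs) F z / other_prod zs z.
Proof.
move=> Bo F.
pose Fn n z := \prod_(b <- Bs) (gauss n (z + b))^-1 *
  \prod_(a <- As) gauss n (z + a) * (k * cpow x z).
have kxe : exp_rational (fun z => k * cpow x z).
  by apply: exp_rationalM; [exact: exp_rational_cst|exact: exp_rational_cpow].
have Fe n : exp_rational (Fn n).
  apply: exp_rationalM; last exact: kxe.
  apply: exp_rationalM; last first.
    by apply: exp_rational_prod => a; exact: exp_rational_gauss.
  (* Off [Bs] the factor is replaced by 1, since [exp_rational_prod] quantifies over all indices. *)
  pose f b z := if b \in Bs then (gauss n (z + b))^-1 else 1.
  rewrite (_ : (fun z => _) = (fun z => \prod_(b <- Bs) f b z)).
    apply: exp_rational_prod => b; rewrite /f.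
    have [bB|_] := boolP (b \in Bs); last exact: exp_rational_cst.
    by apply: exp_rational_gaussV => m; exact: Bo.
  apply/funext => z; rewrite [LHS]big_seq [RHS]big_seq; apply: eq_bigr => b bB.
  by rewrite /f bB.
have Fcvg z : (forall b (m : nat), b \in Bs -> z + b + m%:R != 0) ->
    ccvg \oo (Fn ^~ z) (F z).
  move=> nz; apply: ccvgM (ccvg_cst _); apply: ccvgM.
    rewrite [X in ccvg _ _ X]big_seq; under eq_fun do rewrite big_seq.
    by apply: ccvg_prod => b bB; apply: gauss_cvg_inv => m; exact: nz.
  rewrite -prodfV; apply: ccvg_prod => a _; exact: gauss_cvg.
have nzS z : on_contour S z -> forall b (m : nat), b \in Bs -> z + b + m%:R != 0.
  move=> zS b m bB; apply/eqP => zbm; have [+ _] := Bo b m bB; apply.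
  suff <- : z = - (b + m%:R) by [].
  by apply/eqP; rewrite -addr_eq0 addrA zbm.
(* A node has winding number 1 and a pole of the numerator has 0, so they never coincide. *)
have nzz z : z \in zs -> forall b (m : nat), b \in Bs -> z + b + m%:R != 0.
  move=> zzs b m bB; apply/eqP => zbm; have [_] := Bo b m bB.
  have <- : z = - (b + m%:R) by apply/eqP; rewrite -addr_eq0 addrA zbm.
  by have [_ ->] := zs_in zzs; apply/eqP; rewrite oner_eq0.
have off z : on_contour S z -> z \notin zs by move=> zS; apply/negP => /zs_in[].
have Zc : okc S (fun z => (\prod_(w <- zs) (z - w))^-1).
  apply: okcV; first by move=> z /off; exact: prod_sub_neq0.
  by apply: okc_prod => w; apply: okcD; [exact: okc_id|exact: okc_cst].
have [N [B FB]] : unif_bounded (fun n z => Fn n z / \prod_(w <- zs) (z - w)).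
  have cb f : okc S f -> unif_bounded (fun=> f).
    by move=> /okc_bounded[M MP]; exists 0%N, M => n z _; exact: MP.
  apply: unif_boundedM; last exact: cb.
  apply: unif_boundedM; last by apply: cb; exact: exp_rational_okc.
  apply: unif_boundedM.
    apply: (@unif_bounded_prod _ Bs (fun b n z => (gauss n (z + b))^-1)) => b bB.
    by apply: unif_bounded_gaussV => m; exact: Bo.
  by apply: unif_bounded_prod => a _; exact: unif_bounded_gauss.
(* Shifting the rank by N makes the uniform bound valid for every n. *)
apply: (@ccvg_unique _ _ \oo _
  (fun n => J (fun z => Fn (n + N)%N z / \prod_(w <- zs) (z - w)))).
  apply: (@contour_integral_cvg _ S S_closed _ _ B).
  - by move=> n; apply: okcM => //; exact: exp_rational_okc.
  - move=> z zS; apply: ccvgM (ccvg_cst _).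
    have [h1 h2] := Fcvg z (nzS z zS).
    split.
      by rewrite (cvg_shiftn N (fun n => complex.Re (Fn n z))).
    by rewrite (cvg_shiftn N (fun n => complex.Im (Fn n z))).
  - by move=> n z zS; apply: FB => //; exact: leq_addl.
under eq_fun do rewrite exp_rational_residues//.
apply: ccvgM (ccvg_cst _) _.
rewrite [X in ccvg _ _ X]big_seq; under eq_fun do rewrite big_seq.
apply: ccvg_sum => z zzs; apply: ccvgM (ccvg_cst _).
have [h1 h2] := Fcvg z (nzz z zzs).
split.
  by rewrite (cvg_shiftn N (fun n => complex.Re (Fn n z))).
by rewrite (cvg_shiftn N (fun n => complex.Im (Fn n z))).
Qed.

End GammaResidues.

(** * Gamma and Beta integrals *)

Lemma gt0_powRD (R : realType) (x r s : R) : 0 < x ->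
  x `^ (r + s) = x `^ r * x `^ s.
Proof. by move=> x0; rewrite powRD//; apply/implyP => _; rewrite gt_eqF. Qed.

(** * The Bohr-Mollerup theorem *)

Section BohrMollerup.
Variable R : realType.
Variable F : R -> R.
Implicit Types t s : R.
Hypothesis F_gt0 : forall t, -1 < t -> 0 < F t.
Hypothesis FS : forall t, -1 < t -> F (t + 1) = (t + 1) * F t.
Hypothesis F0 : F 0 = 1.
Hypothesis F_logconvex : forall t s, -1 < t -> 0 <= s <= 1 ->
  F (t + s) <= F t `^ (1 - s) * F (t + 1) `^ s.

Let F_fact n : F n%:R = n`!%:R.
Proof.
elim: n => [|n IH]; first by rewrite F0.
by rewrite -natr1 FS ?IH ?(lt_le_trans (ltrN10 _))// natr1 factS natrM.
Qed.

Let F_poch s n : -1 < s -> F (s + n%:R) = poch (s + 1) n * F s.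
Proof.
move=> s1; elim: n => [|n IH]; first by rewrite addr0 poch0 mul1r.
rewrite -natr1 addrA FS; last by rewrite (lt_le_trans s1)// lerDl.
by rewrite IH pochS; ring.
Qed.

(** [F t] stands for Gamma (t + 1), the moment of order t. Log-convexity from n to n + 1 and from n
    + s to n + s + 1 encloses F (n + s); in terms of the Gauss product [g n] at s + 1 this reads 1
    <= F s * g n <= (1 + 1/n) (1 + 2/n). *)
Let F_unit s : 0 <= s <= 1 -> F s = rGamma (s + 1).
Proof.
move=> /andP[s0 s1].
have sN1 : -1 < s by rewrite (lt_le_trans (ltrN10 _)).
pose g n := poch (s + 1) n.+1 / (n`!%:R * n%:R `^ (s + 1)) : R.
have Fg n : (0 < n)%N -> 1 <= F s * g n <= (1 + n%:R^-1) * (1 + 2 * n%:R^-1).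
  move=> n0; have nR : 0 < n%:R :> R by rewrite ltr0n.
  have nf : 0 < n`!%:R :> R by rewrite ltr0n fact_gt0.
  have nS : 0 < n%:R + 1 :> R by rewrite addr_gt0.
  have nsS : 0 < n%:R + s + 1 :> R by rewrite addr_gt0// ltr_wpDr.
  have E : F s * g n = F (n%:R + s) * (n%:R + s + 1) / (n`!%:R * (n%:R `^ s * n%:R)).
    rewrite /g pochS [n%:R + s]addrC F_poch// gt0_powRD//.
    rewrite powRr1 ?ltW//; have := powR_gt0 s nR; move: (n%:R `^ s) => u u0.
    by field; rewrite !gt_eqF.
  have ns0 := powR_gt0 s nR.
  have nN1 : -1 < n%:R :> R by rewrite (lt_trans (ltrN10 _)).
  have FnS : F (n%:R + 1) = (n%:R + 1) * n`!%:R by rewrite FS// F_fact.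
  have up : F (n%:R + s) <= n`!%:R * (n%:R + 1) `^ s.
    apply: le_trans (F_logconvex nN1 _) _; first by rewrite s0.
    rewrite F_fact FnS powRM ?(ltW nS) ?(ltW nf)// mulrCA -gt0_powRD//.
    by rewrite subrK powRr1 ?(ltW nf)// mulrC.
  (* The weight is 1 - s, so that the intermediate point n + s + (1 - s) is n + 1. *)
  have lo : F (n%:R + 1) <= F (n%:R + s) * (n%:R + s + 1) `^ (1 - s).
    have nsN1 : -1 < n%:R + s by rewrite (lt_le_trans nN1)// lerDl.
    have Fns := F_gt0 nsN1.
    have := F_logconvex nsN1 (s := 1 - s); rewrite subr_ge0 s1 gerBl s0 => /(_ isT).
    rewrite -addrA [s + _]addrC subrK => /le_trans; apply.
    rewrite FS// powRM ?(ltW nsS) ?(ltW Fns)// mulrCA -gt0_powRD//.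
    by rewrite subrK powRr1 ?(ltW Fns)// mulrC.
  have den0 : 0 < n`!%:R * (n%:R `^ s * n%:R) :> R by rewrite !mulr_gt0.
  rewrite E; apply/andP; split.
    rewrite ler_pdivlMr// mul1r.
    have h1 : (n%:R + 1) * n`!%:R * (n%:R + s + 1) `^ s <=
        F (n%:R + s) * (n%:R + s + 1).
      rewrite -FnS; apply: le_trans (ler_wpM2r (powR_ge0 _ _) lo) _.
      rewrite -mulrA -gt0_powRD//.
      by rewrite subrK powRr1 ?(ltW nsS).
    apply: le_trans h1; rewrite (mulrC (n%:R `^ s)) mulrA (mulrC n`!%:R).
    rewrite ler_pM ?mulr_ge0 ?powR_ge0 ?(ltW nf) ?(ltW nR)//.
      by rewrite ler_pM2r// lerDl.
    by rewrite ge0_ler_powR ?nnegrE ?(ltW nR) ?(ltW nsS)// -addrA lerDl addr_ge0.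
  rewrite ler_pdivrMr//.
  apply: le_trans (ler_wpM2r (ltW nsS) up) _.
  have h2 : (n%:R + 1) `^ s <= n%:R `^ s * (1 + n%:R^-1).
    have -> : n%:R + 1 = n%:R * (1 + n%:R^-1) :> R by rewrite mulrDr mulr1 divff ?gt_eqF.
    rewrite powRM ?(ltW nR)// ?addr_ge0 ?invr_ge0 ?(ltW nR)//.
    rewrite ler_pM2l// -[leRHS]powRr1; last by rewrite addr_ge0 ?invr_ge0 ?(ltW nR).
    by rewrite ler_powR// lerDl invr_ge0 ltW.
  have h3 : n%:R + s + 1 <= n%:R * (1 + 2 / n%:R) :> R.
    by rewrite mulrDr mulr1 mulrCA divff ?gt_eqF// mulr1; lra.
  rewrite -mulrA.
  have -> : (1 + n%:R^-1) * (1 + 2 / n%:R) * (n`!%:R * (n%:R `^ s * n%:R)) =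
    n`!%:R * ((n%:R `^ s * (1 + n%:R^-1)) * (n%:R * (1 + 2 / n%:R))) :> R by ring.
  by rewrite ler_pM2l// ler_pM ?powR_ge0 ?(ltW nsS).
have c1 : F s * g n @[n --> \oo] --> F s * (rGamma (s + 1))^-1.
  by apply: cvgMr; exact: rgauss_cvg.
have c2 : F s * g n @[n --> \oo] --> (1 : R).
  apply: (@squeeze_cvgr _ _ _ _ (cst 1)
    (fun n => (1 + n%:R^-1) * (1 + 2 * n%:R^-1))).
  - by exists 1%N => // n /= n0; exact: Fg.
  - exact: cvg_cst.
  - have E : (1 : R) = (1 + 0) * (1 + 2 * 0) by rewrite mulr0 !addr0 mulr1.
    rewrite [X in _ --> X]E; apply: cvgM; apply: cvgD; try exact: cvg_cst.
      exact: cvg_invn.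
    by apply: cvgMr; exact: cvg_invn.
have E : F s / rGamma (s + 1) = 1 by apply: (cvg_unique _ c1 c2).
exact: divr1_eq.
Qed.

Lemma bohr_mollerup t : -1 < t -> F t = rGamma (t + 1).
Proof.
move=> t1; have gt0 (u : R) : -1 < u -> 0 < u + 1 by rewrite -ltrBlDr sub0r.
(* Induction on an integer bound: a positive argument is moved down by one, an argument in ]-1, 0[
   is moved up into the unit interval. *)
have [m] : exists m : nat, t <= m.+1%:R.
  exists (Num.truncn t).
  have [t0|t0] := leP 0 t; first by rewrite ltW// truncnS_gt.
  by rewrite (le_trans (ltW t0)).
elim: m t t1 => [|m IH] u uN1 um.
  have [u0|u0] := leP 0 u; first by apply: F_unit; rewrite u0.
  have u1_gt0 := gt0 u uN1.
  apply: (mulfI (negbT (gt_eqF u1_gt0))).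
  rewrite -FS// -rGammaS// F_unit// (ltW u1_gt0)/=.
  by rewrite -lerBrDr subrr ltW.
have [u0|u0] := ltP 0 u; last first.
  by apply: IH => //; exact: le_trans u0 _.
have := IH (u - 1); rewrite ltrBrDr subrK.
rewrite addNr u0 => /(_ isT) => h.
have um' : u - 1 <= m.+1%:R by rewrite lerBlDr natr1.
have uN1' : -1 < u - 1 by rewrite ltrBrDr addNr.
rewrite -[u in LHS](subrK 1) FS// subrK h//.
by rewrite rGammaS.
Qed.

End BohrMollerup.

Section LogConvexity.
Variable R : realType.
Local Notation mu := (@lebesgue_measure R).
Implicit Types (t s x y : R) (f : R -> R).

(** Weighted arithmetic-geometric mean. With th = y^s, the inequalities 1 + ln u <= u at u = 1/th
    and u = y/th, taken with weights 1 - s and s, lose their logarithms. *)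
Lemma powR_le_affine y s : 0 < y -> 0 <= s <= 1 -> y `^ s <= 1 - s + s * y.
Proof.
move=> y0 /andP[s0 s1].
have ln_le u : 0 < u -> 1 + ln u <= u.
  by move=> u0; have := expR_ge1Dx (ln u); rewrite lnK.
set th := y `^ s; have th0 : 0 < th by rewrite powR_gt0.
have lth : ln th = s * ln y by rewrite ln_powR.
have h1 : 1 - ln th <= th^-1.
  by rewrite -lnV ?posrE// ln_le ?invr_gt0.
have h2 : 1 + ln y - ln th <= y / th.
  by rewrite -addrA -ln_div ?posrE// ln_le ?divr_gt0.
have h3 : 1 <= (1 - s + s * y) / th.
  rewrite mulrDl -mulrA.
  have h4 : (1 - s) * (1 - ln th) <= (1 - s) / th by rewrite ler_wpM2l// subr_ge0.
  have h5 : s * (1 + ln y - ln th) <= s * (y / th) by rewrite ler_wpM2l.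
  rewrite (le_trans _ (lerD h4 h5))// lth; lra.
by rewrite ler_pdivlMr// mul1r in h3.
Qed.

(** An equality of extended reals, so it includes the convergence of the integral. *)
Definition has_moment f t v : Prop :=
  (\int[mu]_(x in `]0%R, +oo[) (x `^ t * f x)%:E = v%:E)%E.

Lemma moment_integrable f t v : measurable_fun setT f -> (forall x, 0 <= f x) ->
  has_moment f t v ->
  mu.-integrable `]0%R, +oo[ (fun x => (x `^ t * f x)%:E).
Proof.
move=> mf f0 ft; apply/integrableP; split.
  apply/measurable_EFinP; apply: measurable_funTS.
  by apply: measurable_funM => //; exact: measurable_powR.
under eq_integral do rewrite gee0_abs ?lee_fin ?mulr_ge0 ?powR_ge0//.
by rewrite ft ltry.
Qed.

(** Integrate the affine bound of (x/c)^s. The scale c = v1/v is the one for which the majorant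
    integrates to exactly v^(1-s) v1^s. *)
Lemma moment_logconvex f t s (v v1 vs : R) : measurable_fun setT f ->
  (forall x, 0 <= f x) -> 0 <= s <= 1 -> 0 < v -> 0 < v1 ->
  has_moment f t v -> has_moment f (t + 1) v1 -> has_moment f (t + s) vs ->
  vs <= v `^ (1 - s) * v1 `^ s.
Proof.
move=> mf f0 s01 v0 v10 h h1 hs.
have i0 := moment_integrable mf f0 h.
have i1 := moment_integrable mf f0 h1.
pose c := v1 / v; have c0 : 0 < c by rewrite divr_gt0.
have -> : v `^ (1 - s) * v1 `^ s = (c `^ s * (1 - s)) * v + (c `^ s * (s / c)) * v1.
  have -> : v `^ (1 - s) = v * v `^ (- s).
    by rewrite gt0_powRD// powRr1 ?ltW.
  have -> : c `^ s = v1 `^ s * v `^ (- s).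
    by rewrite /c powRM ?invr_ge0 ?ltW// -powR_inv1 ?ltW// -powRrM mulN1r.
  by rewrite /c; field; rewrite !gt_eqF.
have pt x : 0 < x -> x `^ (t + s) * f x <=
    c `^ s * (1 - s) * (x `^ t * f x) + c `^ s * (s / c) * (x `^ (t + 1) * f x).
  move=> x0; have xc : x = c * (x / c) by rewrite mulrCA divff ?mulr1// gt_eqF.
  have h2 : x `^ s <= c `^ s * (1 - s + s * (x / c)).
    rewrite [in leLHS]xc powRM; [|exact: ltW|by rewrite divr_ge0// ltW].
    by rewrite ler_wpM2l ?powR_ge0// powR_le_affine// divr_gt0.
  rewrite !gt0_powRD// powRr1 ?(ltW x0)//.
  have Xy0 : 0 <= x `^ t * f x by rewrite mulr_ge0// powR_ge0.
  have := ler_wpM2l Xy0 h2.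
  rewrite mulrAC => /le_trans; apply; rewrite le_eqVlt; apply/orP; left; apply/eqP.
  by field; rewrite gt_eqF.
rewrite -lee_fin -hs EFinD [X in (_ <= X + _)%E]EFinM [X in (_ <= _ + X)%E]EFinM.
rewrite -h -h1 -!integralZl// -integralD//=; [|exact: integrableZl..].
apply: ge0_le_integral => //.
- by move=> x _; rewrite lee_fin mulr_ge0// powR_ge0.
- apply/measurable_EFinP/measurable_funTS.
  by apply: measurable_funM => //; exact: measurable_powR.
- apply/measurable_EFinP/measurable_funTS.
  apply: measurable_funD; apply: measurable_funM => //;
  by apply: measurable_funM => //; exact: measurable_powR.
- by move=> x /=; rewrite in_itv/= andbT => x0; rewrite lee_fin pt.
Qed.

End LogConvexity.

Section GammaBeta.
Variable R : realType.
Local Notation mu := (@lebesgue_measure R).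
Implicit Types (t s x y c : R) (f : R -> R).

Lemma compact_FTC (h H : R -> R) (u v : R) : u < v ->
  (forall x, u <= x <= v -> is_derive x 1 H (h x)) ->
  (forall x, u <= x <= v -> {for x, continuous h}) ->
  (\int[mu]_(x in `[u, v]) (h x)%:E = (H v - H u)%:E)%E.
Proof.
move=> uv dH ch.
have cH x : u <= x <= v -> {for x, continuous H}.
  move=> xuv; have [Hd _] := dH x xuv.
  by apply: differentiable_continuous; exact/derivable1_diffP.
rewrite (@continuous_FTC2 _ h H)//.
- by apply: continuous_in_subspaceT => x; rewrite inE/= in_itv/=; exact: ch.
- split.
  + move=> x; rewrite in_itv/= => /andP[ux xv].
    by have [|] := dH x; rewrite ?(ltW ux) ?(ltW xv).
  + by apply: cvg_at_right_filter; apply: cH; rewrite lexx ltW.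
  + by apply: cvg_at_left_filter; apply: cH; rewrite lexx ltW.
- move=> x; rewrite in_itv/= => /andP[ux xv].
  have xuv : u <= x <= v by rewrite !ltW.
  by have [_] := dH x xuv; rewrite derive1E.
Qed.

(** Integration by parts on a domain without its end points. The derivative of H is split into two
    nonnegative parts, so monotone convergence applies to each, and the identity holds before either
    integral is known to be finite. *)
Lemma exhaustion_FTC (u v : nat -> R) (D : set R) (h1 h2 H : R -> R) L :
  (forall n, u n < v n) ->
  nonincreasing_seq u -> nondecreasing_seq v ->
  \bigcup_n `[u n, v n]%classic = D ->
  (forall x, D x -> 0 <= h1 x) -> (forall x, D x -> 0 <= h2 x) ->
  (forall x, D x -> {for x, continuous h1}) ->
  (forall x, D x -> {for x, continuous h2}) ->
  (forall x, D x -> is_derive x 1 H (h1 x - h2 x)) ->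
  H (v n) - H (u n) @[n --> \oo] --> L ->
  (\int[mu]_(x in D) (h1 x)%:E = \int[mu]_(x in D) (h2 x)%:E + L%:E)%E.
Proof.
move=> uv du dv UD h10 h20 ch1 ch2 dH HL.
have sub n : `[u n, v n]%classic `<=` D.
  by move=> x xuv; rewrite -UD; exists n.
have subD n x : u n <= x <= v n -> D x.
  by move=> xuv; apply: (sub n); rewrite /= in_itv.
have nd : nondecreasing_seq (fun n => `[u n, v n]%classic : set R).
  move=> m n mn; rewrite subsetEset => x /=; rewrite !in_itv/= => /andP[ux xv].
  by rewrite (le_trans (du _ _ mn))// (le_trans xv)// dv.
have ci (h : R -> R) n : (forall x, D x -> {for x, continuous h}) ->
    mu.-integrable `[u n, v n] (EFin \o h).
  move=> ch; apply: continuous_compact_integrable; first exact: segment_compact.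
  by apply: continuous_in_subspaceT => x; rewrite inE/= in_itv/= => /subD /ch.
have lim (h : R -> R) : (forall x, D x -> 0 <= h x) -> (forall x, D x -> {for x, continuous h}) ->
    (\int[mu]_(x in `[u n, v n]) (h x)%:E @[n --> \oo] --> \int[mu]_(x in D) (h x)%:E)%E.
  move=> h0 ch; rewrite -UD.
  apply: (@ge0_nondecreasing_set_cvg_integral _ (measurableTypeR R) R
    (fun n => `[u n, v n]%classic) (EFin \o h) [the measure _ _ of mu] nd) => //.
  - by move=> n; exact: measurable_int (ci h n ch).
  - by move=> n x /(sub n) Dx; rewrite lee_fin h0.
have E n : (\int[mu]_(x in `[u n, v n]) (h1 x)%:E =
    \int[mu]_(x in `[u n, v n]) (h2 x)%:E + (H (v n) - H (u n))%:E)%E.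
  have dHn x : u n <= x <= v n -> is_derive x 1 H (h1 x - h2 x).
    by move=> /subD /dH.
  have chn x : u n <= x <= v n -> {for x, continuous (fun x => h1 x - h2 x)}.
    by move=> /subD Dx; apply: cvgB; [exact: ch1|exact: ch2].
  rewrite -(compact_FTC (uv n) dHn chn) -integralD//=; [|exact: ci|].
    by apply: eq_integral => x _; rewrite -EFinD addrC subrK.
  apply: (ci (fun x => h1 x - h2 x)) => x Dx.
  by apply: cvgB; [exact: ch1|exact: ch2].
apply: cvg_unique (lim h1 h10 ch1) _ => //=.
rewrite (funext E).
apply: cvgeD; [|exact: lim|by apply: cvg_EFin => //; exact: nearW].
by rewrite fin_num_adde_defl.
Qed.

Lemma bigcup_itv_pos :
  \bigcup_n `[n.+1%:R^-1, n.+2%:R]%classic = `]0%R, +oo[%classic :> set R.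
Proof.
apply/seteqP; split => [x [n _]|x]; rewrite /= !in_itv/= ?andbT.
  by move=> /andP[nx _]; rewrite (lt_le_trans _ nx)// invr_gt0.
move=> x0; exists (maxn (Num.truncn x) (Num.truncn x^-1)) => //=.
rewrite in_itv/=; apply/andP; split.
  rewrite invf_ple ?posrE// (le_trans (ltW (truncnS_gt _)))//.
  by rewrite ler_nat ltnS leq_maxr.
by rewrite (le_trans (ltW (truncnS_gt _)))// ler_nat ltnS leqW// leq_maxl.
Qed.

Lemma bigcup_itv01 :
  \bigcup_n `[n.+3%:R^-1, 1 - n.+3%:R^-1]%classic = `]0%R, 1%R[%classic :> set R.
Proof.
apply/seteqP; split => [x [n _]|x]; rewrite /= !in_itv/=.
  move=> /andP[nx xn]; rewrite (lt_le_trans _ nx)/= ?invr_gt0//.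
  by rewrite (le_lt_trans xn)// gtrBl invr_gt0.
move=> /andP[x0 x1]; have x1' : 0 < 1 - x by rewrite subr_gt0.
exists (maxn (Num.truncn x^-1) (Num.truncn (1 - x)^-1)) => //=.
rewrite in_itv/= lerBrDl -lerBrDr; apply/andP; split.
  rewrite invf_ple ?posrE// (le_trans (ltW (truncnS_gt _)))//.
  by rewrite ler_nat ltnS leqW// leqW// leq_maxl.
rewrite invf_ple ?posrE// (le_trans (ltW (truncnS_gt _)))//.
by rewrite ler_nat ltnS leqW// leqW// leq_maxr.
Qed.

Lemma powR_expRN_le s : exists2 K, 0 <= K &
  forall x, 1 <= x -> x `^ s * expR (- x) <= K * x^-1.
Proof.
pose m := (Num.truncn `|s|).+1.
have sm : s <= m%:R by rewrite (le_trans (ler_norm s))// ltW// truncnS_gt.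
exists m.+1`!%:R => // x x1.
have x0 : 0 < x by rewrite (lt_le_trans ltr01).
rewrite expRN ler_pdivrMr ?expR_gt0//.
rewrite (@le_trans _ _ (x `^ m%:R))//; first by rewrite ler_powR.
rewrite powR_mulrn ?(ltW x0)//.
have := expR_ge1Dxn m (ltW x0); rewrite exprS => h.
have f0 : 0 < m.+1`!%:R :> R by rewrite ltr0n fact_gt0.
have h2 : x * x ^+ m / m.+1`!%:R <= expR x by rewrite (le_trans _ h)// lerDr.
rewrite ler_pdivrMr// in h2.
have : x^-1 * (x * x ^+ m) <= x^-1 * (expR x * m.+1`!%:R).
  by rewrite ler_wpM2l// invr_ge0 ltW.
rewrite mulKf ?gt_eqF// => /le_trans; apply.
by rewrite le_eqVlt; apply/orP; left; apply/eqP; ring.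
Qed.

Lemma cvg_invSn k : ((n + k).+1%:R : R)^-1 @[n --> \oo] --> (0 : R).
Proof.
rewrite (cvg_shiftn k (fun n => (n.+1%:R : R)^-1)).
exact: cvg_harmonic.
Qed.

Lemma cvg_powR_invSn k s : 0 < s ->
  ((n + k).+1%:R^-1 : R) `^ s @[n --> \oo] --> (0 : R).
Proof.
move=> s0; have := powR_cvg0 s0; move/cvg_at_rightP; apply; split.
  by move=> n; rewrite invr_gt0.
exact: cvg_invSn.
Qed.

Lemma gamma_boundary t : -1 < t ->
  n.+2%:R `^ (t + 1) * expR (- n.+2%:R) -
  n.+1%:R^-1 `^ (t + 1) * expR (- n.+1%:R^-1) @[n --> \oo] --> (0 : R).
Proof.
move=> t1; have t10 : 0 < t + 1 by rewrite -ltrBlDr sub0r.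
rewrite -[X in _ --> X](subrr 0); apply: cvgB.
  have [K K0 KP] := powR_expRN_le (t + 1).
  apply: (@squeeze_cvgr _ _ _ _ (cst 0) (fun n => K * (n.+2%:R)^-1)).
  - apply: nearW => n; rewrite mulr_ge0 ?powR_ge0 ?expR_ge0//=.
    by rewrite KP// ler1n.
  - exact: cvg_cst.
  - rewrite -[X in _ --> X](mulr0 K); apply: cvgMr.
    have := cvg_invSn 1; rewrite (_ : (fun n => _) = fun n => (n.+2%:R)^-1)//.
    by apply/funext => n; rewrite addn1.
apply: (@squeeze_cvgr _ _ _ _ (cst 0) (fun n => (n.+1%:R^-1) `^ (t + 1))).
- apply: nearW => n; rewrite mulr_ge0 ?powR_ge0 ?expR_ge0//=.
  by rewrite ler_piMr ?powR_ge0// -expR0 ler_expR oppr_le0.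
- exact: cvg_cst.
- have := cvg_powR_invSn 0 t10; rewrite (_ : (fun n => _) = fun n => (n.+1%:R^-1) `^ (t + 1))//.
  by apply/funext => n; rewrite addn0.
Qed.

Let E x := gamma_factor 0 x.

Let E_pos x : 0 < x -> E x = expR (- x).
Proof. by move=> x0; rewrite /E /gamma_factor x0 powRr0 mul1r. Qed.

Lemma measurable_gamma_factor a : measurable_fun setT (@gamma_factor R a).
Proof.
rewrite /gamma_factor; apply: measurable_fun_ifT => //.
  exact: measurable_fun_ltr.
apply: measurable_funM; first exact: measurable_powR.
by apply: measurableT_comp => //; exact: measurable_funN.
Qed.

Lemma gamma_factor_ge0 a x : 0 <= gamma_factor a x.
Proof.
by rewrite /gamma_factor; case: ifPn => // _; rewrite mulr_ge0 ?powR_ge0 ?expR_ge0.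
Qed.

Let I t : \bar R := (\int[mu]_(x in `]0%R, +oo[) (x `^ t * E x)%:E)%E.

(** By parts with H = x^(t+1) e^(-x). This comes before finiteness, which for t < 0 is deduced from
    it. *)
Let IS t : -1 < t -> I (t + 1) = ((t + 1)%:E * I t)%E.
Proof.
move=> t1; have t10 : 0 < t + 1 by rewrite -ltrBlDr sub0r.
have powc s x : 0 < x -> {for x, continuous (fun y => y `^ s)}.
  move=> x0; have [d _] := is_derive1_powR s x0.
  by apply: differentiable_continuous; exact/derivable1_diffP.
have expc x : {for x, continuous (fun y => expR (- y))}.
  by apply: continuous_comp; [exact: continuousN|exact: continuous_expR].
rewrite /I -ge0_integralZl//=; first last.
- by rewrite lee_fin ltW.
- by move=> x _; rewrite lee_fin mulr_ge0 ?powR_ge0 ?gamma_factor_ge0.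
- apply/measurable_EFinP/measurable_funTS; apply: measurable_funM.
    exact: measurable_powR.
  exact: measurable_gamma_factor.
transitivity (\int[mu]_(x in `]0%R, +oo[) (x `^ (t + 1) * expR (- x))%:E)%E.
  by apply: eq_integral => x; rewrite inE/= in_itv/= andbT => x0; rewrite E_pos.
transitivity (\int[mu]_(x in `]0%R, +oo[) ((t + 1) * x `^ t * expR (- x))%:E)%E;
    last first.
  apply: eq_integral => x; rewrite inE/= in_itv/= andbT => x0.
  by rewrite E_pos// -EFinM mulrA.
have := @exhaustion_FTC (fun n => n.+1%:R^-1) (fun n => n.+2%:R) _
  (fun x => (t + 1) * x `^ t * expR (- x)) (fun x => x `^ (t + 1) * expR (- x))
  (fun x => x `^ (t + 1) * expR (- x)) 0 _ _ _ bigcup_itv_pos.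
rewrite adde0 => FTC; apply/esym; apply: FTC.
- by move=> n; rewrite (@le_lt_trans _ _ 1)// ?invf_le1// ?ler1n ?ltr1n.
- by move=> m n mn; rewrite lef_pV2 ?posrE// ler_nat ltnS.
- by move=> m n mn; rewrite ler_nat !ltnS.
- by move=> x _; rewrite !mulr_ge0 ?powR_ge0 ?expR_ge0// ltW.
- by move=> x _; rewrite !mulr_ge0 ?powR_ge0 ?expR_ge0.
- move=> x /=; rewrite in_itv/= andbT => x0.
  apply: cvgM => //; last exact: expc.
  by apply: cvgMr; exact: powc.
- move=> x /=; rewrite in_itv/= andbT => x0.
  by apply: cvgM; [exact: powc|exact: expc].
- move=> x /=; rewrite in_itv/= andbT => x0.
  have := is_derive1_powR (t + 1) x0 => dp.
  apply: is_derive_eq.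
  by rewrite /GRing.scale/= addrK; ring.
- exact: gamma_boundary.
Qed.

Let I0 : I 0 = 1%E.
Proof.
transitivity (\int[mu]_(x in `]0%R, +oo[) (expR (- x))%:E)%E.
  apply: eq_integral => x; rewrite inE/= in_itv/= andbT => x0.
  by rewrite E_pos// powRr0 mul1r.
have expc x : {for x, continuous (fun y => expR (- y))}.
  by apply: continuous_comp; [exact: continuousN|exact: continuous_expR].
have := @exhaustion_FTC (fun n => n.+1%:R^-1) (fun n => n.+2%:R) _
  (fun x => expR (- x)) (cst 0) (fun x => - expR (- x)) 1 _ _ _ bigcup_itv_pos.
rewrite integral0 add0e => FTC; apply: FTC.
- by move=> n; rewrite (@le_lt_trans _ _ 1)// ?invf_le1// ?ler1n ?ltr1n.
- by move=> m n mn; rewrite lef_pV2 ?posrE// ler_nat ltnS.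
- by move=> m n mn; rewrite ler_nat !ltnS.
- by move=> x _; exact: expR_ge0.
- by [].
- by move=> x _; exact: expc.
- by move=> x _; exact: cvg_cst.
- move=> x _; apply: is_derive_eq.
  by rewrite /GRing.scale/=; ring.
- have E1 : (1 : R) = - 0 - - 1 by rewrite oppr0 sub0r opprK.
  rewrite [X in _ --> X]E1.
  apply: cvgB; apply: cvgN.
    have [K K0 KP] := powR_expRN_le 0.
    apply: (@squeeze_cvgr _ _ _ _ (cst 0) (fun n => K * (n.+2%:R)^-1)).
    + apply: nearW => n; rewrite expR_ge0/=.
      by have := KP n.+2%:R; rewrite powRr0 mul1r; apply; rewrite ler1n.
    + exact: cvg_cst.
    + rewrite -[X in _ --> X](mulr0 K); apply: cvgMr.
      have := cvg_invSn 1; rewrite (_ : (fun n => _) = fun n => (n.+2%:R)^-1)//.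
      by apply/funext => n; rewrite addn1.
  rewrite -[X in _ --> X](@expR0 R) -[X in expR X]oppr0.
  apply: (continuous_cvg _ (expc 0)); exact: cvg_harmonic.
Qed.

Let I_fact n : I n%:R = (n`!%:R)%:E.
Proof.
elim: n => [|n IH]; first by rewrite I0.
rewrite -natr1 IS ?(lt_le_trans (ltrN10 _))// IH -EFinM natr1.
by rewrite factS natrM.
Qed.

Lemma measurable_moment f t : measurable_fun setT f ->
  measurable_fun (`]0%R, +oo[ : set (measurableTypeR R)) (fun x => (x `^ t * f x)%:E).
Proof.
move=> mf; apply/measurable_EFinP/measurable_funTS.
by apply: measurable_funM => //; exact: measurable_powR.
Qed.

(** x^t is at most x^u or x^s, according to the side of 1 on which x lies. Finiteness thus passes
    from two orders to those between them. *)
Lemma moment_le f s t u : measurable_fun setT f -> (forall x, 0 <= f x) ->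
  s <= t -> t <= u ->
  (\int[mu]_(x in `]0%R, +oo[) (x `^ t * f x)%:E <=
   \int[mu]_(x in `]0%R, +oo[) (x `^ s * f x)%:E +
   \int[mu]_(x in `]0%R, +oo[) (x `^ u * f x)%:E)%E.
Proof.
move=> mf f0 st tu; rewrite -ge0_integralD//=; first last.
- exact: measurable_moment.
- by move=> x _; rewrite lee_fin mulr_ge0 ?powR_ge0.
- exact: measurable_moment.
- by move=> x _; rewrite lee_fin mulr_ge0 ?powR_ge0.
apply: ge0_le_integral => //.
- by move=> x _; rewrite lee_fin mulr_ge0 ?powR_ge0.
- exact: measurable_moment.
- by apply: emeasurable_funD; exact: measurable_moment.
- move=> x /=; rewrite in_itv/= andbT => x0.
  rewrite -EFinD lee_fin -mulrDl ler_wpM2r//.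
  have [x1|x1] := leP 1 x.
    by rewrite (le_trans (ler_powR x1 tu))// lerDr powR_ge0.
  have x01 : 0 < x <= 1 by rewrite x0 ltW.
  by rewrite (le_trans (ger_powR x01 st))// lerDl powR_ge0.
Qed.

Let I_fin t : -1 < t -> (I t \is a fin_num)%E.
Proof.
move=> t1; have I_ge0 u : (0 <= I u)%E.
  by apply: integral_ge0 => x _; rewrite lee_fin mulr_ge0 ?powR_ge0 ?gamma_factor_ge0.
have pos u : 0 <= u -> (I u \is a fin_num)%E.
  move=> u0; rewrite ge0_fin_numE//.
  have := moment_le (measurable_gamma_factor 0) (gamma_factor_ge0 0) u0
    (ltW (truncnS_gt u)).
  rewrite -/(I u) -/(I 0) -/(I _.+1%:R) I0 I_fact => /le_lt_trans; apply.
  by rewrite -EFinD ltry.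
have [t0|t0] := leP 0 t; first exact: pos.
have t10 : 0 < t + 1 by rewrite -ltrBlDr sub0r.
(* For -1 < t < 0, an infinite [I t] would make [I (t + 1)] infinite by the recurrence. *)
have := pos (t + 1) (ltW t10); rewrite IS// !ge0_fin_numE ?mule_ge0 ?lee_fin ?(ltW t10)//.
have := I_ge0 t; case: (I t) => //= [r _ _|_]; first exact: ltry.
by rewrite gt0_muley ?lte_fin.
Qed.

(** The positivity required by Bohr-Mollerup, from a lower bound of f on one segment. The minimum in
    [l] covers both monotonicities of x^t. *)
Lemma moment_gt0 f t (u v k m : R) : measurable_fun setT f -> (forall x, 0 <= f x) ->
  0 < u -> u < v -> 0 < k -> (forall x, u <= x <= v -> k <= f x) ->
  has_moment f t m -> 0 < m.
Proof.
move=> mf f0 u0 uv k0 kf fm.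
pose l := Num.min (u `^ t) (v `^ t).
have l0 : 0 < l by rewrite lt_min !powR_gt0// (lt_trans u0).
have kl0 : 0 < l * k * (v - u) by rewrite !mulr_gt0// subr_gt0.
apply: (lt_le_trans kl0); rewrite -lee_fin -fm.
have sub : `[u, v]%classic `<=` (`]0, +oo[%classic : set R).
  by move=> x /=; rewrite !in_itv/= andbT => /andP[ux _]; exact: lt_le_trans ux.
have := @ge0_subset_integral _ _ R mu _ _ (measurable_itv `[u, v]) (measurable_itv `]0, +oo[)
  _ (measurable_moment t mf) _ sub.
move=> /(_ (fun x _ => _)) h; apply: le_trans (h _); last first.
  by move=> x; rewrite lee_fin mulr_ge0 ?powR_ge0.
have <- : (\int[mu]_(x in `[u, v]) (cst (l * k)%:E) x = (l * k * (v - u))%:E)%E.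
  rewrite integral_cst//= lebesgue_measure_itv/= lte_fin uv.
  by rewrite -EFinB -EFinM.
apply: ge0_le_integral => //.
- by move=> x _; rewrite lee_fin mulr_ge0 ?ltW.
- apply: (@measurable_funS _ _ _ _ (`]0, +oo[%classic : set (measurableTypeR R))) => //.
  exact: measurable_moment.
- move=> x /=; rewrite in_itv/= => /andP[ux xv].
  have x0 : 0 < x by rewrite (lt_le_trans u0).
  rewrite lee_fin ler_pM ?(ltW l0) ?(ltW k0)//; last by rewrite kf ?ux.
  rewrite ge_min; have [t0|t0] := leP 0 t.
    by rewrite ge0_ler_powR ?nnegrE ?(ltW u0) ?(ltW x0).
  apply/orP; right; rewrite -[t]opprK !powRN lef_pV2 ?posrE ?invr_gt0 ?powR_gt0//.
    by rewrite -!powRN ge0_ler_powR ?nnegrE ?oppr_ge0 ?(ltW t0) ?(ltW x0)// (le_trans (ltW x0)).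
  exact: lt_le_trans xv.
Qed.

Lemma gamma_moment0 t : -1 < t -> has_moment (gamma_factor 0) t (rGamma (t + 1)).
Proof.
pose m t := fine (I t).
have mE u : -1 < u -> has_moment (gamma_factor 0) u (m u).
  by move=> u1; rewrite /has_moment -/(I u) /m fineK// I_fin.
have m_gt0 u : -1 < u -> 0 < m u.
  move=> u1; apply: (@moment_gt0 _ u 1 2 (expR (-2)) _ (measurable_gamma_factor 0)
    (gamma_factor_ge0 0) _ _ _ _ (mE u u1)); rewrite ?ltr1n ?expR_gt0//.
  move=> x /andP[x1 x2]; rewrite -/(E x) E_pos ?(lt_le_trans ltr01)//.
  by rewrite ler_expR lerN2.
move=> t1; have -> : rGamma (t + 1) = m t; last exact: mE.
apply/esym; apply: (@bohr_mollerup _ m) => //.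
- by move=> u u1; rewrite /m IS// fineM// I_fin.
- by rewrite /m I0.
- move=> u s u1 s01; apply: (moment_logconvex (measurable_gamma_factor 0)
    (gamma_factor_ge0 0) s01 _ _ (mE u u1) (mE (u + 1) _) (mE (u + s) _)).
  + exact: m_gt0.
  + by apply: m_gt0; rewrite (lt_trans u1)// ltrDl.
  + by rewrite (lt_trans u1)// ltrDl.
  + by case/andP: s01 => s0 _; rewrite (lt_le_trans u1)// lerDl.
Qed.

Lemma gamma_moment a t : -1 < t + a -> has_moment (gamma_factor a) t (rGamma (t + a + 1)).
Proof.
move=> ta; rewrite /has_moment -(gamma_moment0 ta).
apply: eq_integral => x; rewrite inE/= in_itv/= andbT => x0.
by rewrite -/(E x) E_pos// /gamma_factor x0 mulrA -gt0_powRD.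
Qed.

End GammaBeta.

Lemma powR_mean_mul (R : realType) (x y u v s : R) :
  0 < x -> 0 < y -> 0 < u -> 0 < v ->
  (x * u) `^ (1 - s) * (y * v) `^ s =
  (x `^ (1 - s) * y `^ s) * (u `^ (1 - s) * v `^ s).
Proof. by move=> x0 y0 u0 v0; rewrite !powRM ?ltW// mulrACA. Qed.

Lemma powR_mean_div (R : realType) (x y d s : R) : 0 < x -> 0 < y -> 0 < d ->
  (x / d) `^ (1 - s) * (y / d) `^ s = x `^ (1 - s) * y `^ s / d.
Proof.
move=> x0 y0 d0; rewrite powR_mean_mul ?invr_gt0// -gt0_powRD ?invr_gt0//.
by rewrite subrK powRr1 ?invr_ge0 ?ltW.
Qed.

(** * Beta integrals *)

Section Beta.
Local Opaque rGamma.
Variable R : realType.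
Local Notation mu := (@lebesgue_measure R).
Implicit Types (t s x y : R) (f : R -> R).
Variable c : R.
Hypothesis c_gt0 : 0 < c.

(** The Beta weight without its power of x and its normalization; the exponent is a parameter
    because the recurrences relate c to c + 1. *)
Let W d x : R := if 0 < x < 1 then (1 - x) `^ (d - 1) else 0.

Let W_ge0 d x : 0 <= W d x.
Proof. by rewrite /W; case: ifP => // _; exact: powR_ge0. Qed.

Lemma measurable_itv01_test : measurable_fun setT (fun x : R => 0 < x < 1).
Proof. by apply: measurable_and; exact: measurable_fun_ltr. Qed.

Let W_meas d : measurable_fun setT (W d).
Proof.
apply: measurable_fun_ifT => //; first exact: measurable_itv01_test.
apply: (measurableT_comp (measurable_powR (d - 1))).
exact: measurable_funB.
Qed.

Let B t d : \bar R := (\int[mu]_(x in `]0%R, +oo[) (x `^ t * W d x)%:E)%E.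

Let B01 t d : B t d = (\int[mu]_(x in `]0%R, 1%R[) (x `^ t * (1 - x) `^ (d - 1))%:E)%E.
Proof.
rewrite /B integral_mkcond [RHS]integral_mkcond; apply: eq_integral => x _.
rewrite !patchE !mem_setE !in_itv/= andbT /W.
by case: (ltP 0 x) => //= x0; case: ifP => //; rewrite mulr0.
Qed.

Let powR_cont s x : 0 < x -> {for x, continuous (fun y => y `^ s)}.
Proof.
move=> x0; have [d _] := is_derive1_powR s x0.
by apply: differentiable_continuous; exact/derivable1_diffP.
Qed.

Let der1 s x : x < 1 ->
  is_derive x 1 (fun y => (1 - y) `^ s) (- (s * (1 - x) `^ (s - 1))).
Proof.
move=> x1; have x10 : 0 < 1 - x by rewrite subr_gt0.
have d2 : is_derive x 1 (fun y => 1 - y) (-1).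
  by have := is_deriveB (is_derive_cst (1 : R) x 1) (is_derive_id x 1); rewrite sub0r.
have := @is_derive1_comp R (fun y => y `^ s) (fun y => 1 - y) x _ _
  (is_derive1_powR s x10) d2.
by rewrite mulrN1.
Qed.

Let cont1 s x : x < 1 -> {for x, continuous (fun y => (1 - y) `^ s)}.
Proof.
move=> x1; have [d _] := der1 s x1.
by apply: differentiable_continuous; exact/derivable1_diffP.
Qed.

Let ends_lt n : n.+3%:R^-1 < 1 - n.+3%:R^-1 :> R.
Proof.
have h : (n.+3%:R : R)^-1 <= 3^-1 by rewrite lef_pV2 ?posrE// ler_nat.
by move: (n.+3%:R^-1 : R) h => w h; lra.
Qed.

Let ends_l : nonincreasing_seq (fun n => n.+3%:R^-1 : R).
Proof. by move=> m n mn; rewrite lef_pV2 ?posrE// ler_nat !ltnS. Qed.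

Let ends_r : nondecreasing_seq (fun n => 1 - n.+3%:R^-1 : R).
Proof. by move=> m n mn; rewrite lerD2l lerN2 ends_l. Qed.

Let cvg_end s : 0 < s -> (n.+3%:R^-1 : R) `^ s @[n --> \oo] --> (0 : R).
Proof.
move=> s0; have := cvg_powR_invSn 2 s0.
rewrite (_ : (fun n => _) = fun n => (n.+3%:R^-1) `^ s)//.
by apply/funext => n; rewrite addn2.
Qed.

Let powR_le1 s y : 0 <= s -> 0 <= y -> y <= 1 -> y `^ s <= 1.
Proof.
by move=> s0 y0 y1; have := ge0_ler_powR s0 y0 ler01 y1; rewrite powR1.
Qed.

Let ends_01 n : 0 <= 1 - (n.+3%:R : R)^-1 <= 1.
Proof. by rewrite subr_ge0 invf_le1// ler1n/= gerBl invr_ge0. Qed.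

(** By parts with H = x^(t+1) (1 - x)^c. *)
Let BS1 t : -1 < t -> ((t + 1)%:E * B t (c + 1) = c%:E * B (t + 1) c)%E.
Proof.
move=> t1; have t10 : 0 < t + 1 by rewrite -ltrBlDr sub0r.
rewrite !B01 -!ge0_integralZl//=; first last.
- by rewrite lee_fin ltW.
- by move=> x _; rewrite lee_fin mulr_ge0 ?powR_ge0.
- apply/measurable_EFinP/measurable_funTS; apply: measurable_funM.
    exact: measurable_powR.
  apply: (measurableT_comp (measurable_powR _)); exact: measurable_funB.
- by rewrite lee_fin ltW.
- by move=> x _; rewrite lee_fin mulr_ge0 ?powR_ge0.
- apply/measurable_EFinP/measurable_funTS; apply: measurable_funM.
    exact: measurable_powR.
  apply: (measurableT_comp (measurable_powR _)); exact: measurable_funB.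
have := @exhaustion_FTC R (fun n => n.+3%:R^-1) (fun n => 1 - n.+3%:R^-1) _
  (fun x => (t + 1) * x `^ t * (1 - x) `^ c)
  (fun x => c * (x `^ (t + 1) * (1 - x) `^ (c - 1)))
  (fun x => x `^ (t + 1) * (1 - x) `^ c) 0 ends_lt ends_l ends_r (bigcup_itv01 R).
rewrite adde0 => FTC.
transitivity (\int[mu]_(x in `]0%R, 1%R[) ((t + 1) * x `^ t * (1 - x) `^ c)%:E)%E.
  by apply: eq_integral => x _; rewrite addrK -EFinM mulrA.
transitivity (\int[mu]_(x in `]0%R, 1%R[)
    (c * (x `^ (t + 1) * (1 - x) `^ (c - 1)))%:E)%E; last first.
  by apply: eq_integral => x _; rewrite -EFinM.
apply: FTC.
- by move=> x _; rewrite !mulr_ge0 ?powR_ge0// ltW.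
- by move=> x _; rewrite !mulr_ge0 ?powR_ge0// ltW.
- move=> x /=; rewrite in_itv/= => /andP[x0 x1].
  apply: cvgM; last exact: cont1.
  by apply: cvgMr; exact: powR_cont.
- move=> x /=; rewrite in_itv/= => /andP[x0 x1].
  by apply: cvgMr; apply: cvgM; [exact: powR_cont|exact: cont1].
- move=> x /=; rewrite in_itv/= => /andP[x0 x1].
  have dp := is_derive1_powR (t + 1) x0; have dq := der1 c x1.
  apply: is_derive_eq.
  by rewrite /GRing.scale/= addrK; ring.
- rewrite -[X in _ --> X](subrr 0); apply: cvgB.
    apply: (@squeeze_cvgr _ _ _ _ (cst 0) (fun n => (n.+3%:R^-1) `^ c)).
    + apply: nearW => n; rewrite mulr_ge0 ?powR_ge0//= subKr.
      have /andP[e0 e1] := ends_01 n.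
      by rewrite ler_piMl ?powR_ge0// powR_le1// ltW.
    + exact: cvg_cst.
    + exact: cvg_end.
  apply: (@squeeze_cvgr _ _ _ _ (cst 0) (fun n => (n.+3%:R^-1) `^ (t + 1))).
  + apply: nearW => n; rewrite mulr_ge0 ?powR_ge0//=.
    have /andP[e0 e1] := ends_01 n.
    by rewrite ler_piMr ?powR_ge0// powR_le1// ltW.
  + exact: cvg_cst.
  + exact: cvg_end.
Qed.

Let B0 : B 0 c = (c^-1)%:E.
Proof.
rewrite B01.
transitivity (\int[mu]_(x in `]0%R, 1%R[) ((1 - x) `^ (c - 1))%:E)%E.
  by apply: eq_integral => x _; rewrite powRr0 mul1r.
have := @exhaustion_FTC R (fun n => n.+3%:R^-1) (fun n => 1 - n.+3%:R^-1) _
  (fun x => (1 - x) `^ (c - 1)) (cst 0)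
  (fun x => - (c^-1 * (1 - x) `^ c)) c^-1 ends_lt ends_l ends_r (bigcup_itv01 R).
rewrite integral0 add0e => FTC; apply: FTC.
- by move=> x _; rewrite powR_ge0.
- by [].
- by move=> x /=; rewrite in_itv/= => /andP[x0 x1]; exact: cont1.
- by move=> x _; exact: cvg_cst.
- move=> x /=; rewrite in_itv/= => /andP[x0 x1]; have dq := der1 c x1.
  apply: is_derive_eq.
  by rewrite /GRing.scale/= subr0; field; rewrite gt_eqF.
- have E1 : c^-1 = - (c^-1 * 0) - - (c^-1 * (1 - 0) `^ c).
    by rewrite mulr0 subr0 powR1 mulr1 oppr0 sub0r opprK.
  rewrite [X in _ --> X]E1; apply: cvgB; apply: cvgN; apply: cvgMr.
    rewrite (_ : (fun n => _) = fun n => (n.+3%:R^-1) `^ c); first exact: cvg_end.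
    by apply/funext => n; rewrite subKr.
  apply: (@cvg_comp _ _ _ (fun n => n.+3%:R^-1 : R) (fun y => (1 - y) `^ c) _
    (nbhs (0 : R))); last exact: (cont1 (s := c) ltr01).
  have := @cvg_invSn R 2; rewrite (_ : (fun n => _) = fun n => (n.+3%:R)^-1)//.
  by apply/funext => n; rewrite addn2.
Qed.

Let B_ge0 t d : (0 <= B t d)%E.
Proof. by apply: integral_ge0 => x _; rewrite lee_fin mulr_ge0 ?powR_ge0. Qed.

(** Write 1 = x + (1 - x) under the integral and eliminate the parameter c + 1 by [BS1]: a
    recurrence in t alone. *)
Let BD t : -1 < t -> ((t + 1)%:E * B t c = (t + 1 + c)%:E * B (t + 1) c)%E.
Proof.
move=> t1; have t10 : 0 < t + 1 by rewrite -ltrBlDr sub0r.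
have -> : B t c = (B (t + 1) c + B t (c + 1))%E.
  rewrite -ge0_integralD//=; first last.
  - exact: measurable_moment.
  - by move=> x _; rewrite lee_fin mulr_ge0 ?powR_ge0.
  - exact: measurable_moment.
  - by move=> x _; rewrite lee_fin mulr_ge0 ?powR_ge0.
  apply: eq_integral => x; rewrite inE/= in_itv/= andbT => x0.
  rewrite -EFinD; congr EFin; rewrite /W x0/=; case: ifP => x1; last by rewrite !mulr0 addr0.
  rewrite addrK gt0_powRD// powRr1 ?(ltW x0)//.
  have -> : (1 - x) `^ c = (1 - x) * (1 - x) `^ (c - 1).
    by rewrite mulr_powRB1// subr_ge0 ltW.
  by ring.
rewrite ge0_muleDr// BS1// [(_ + c)%:E in RHS]EFinD ge0_muleDl// lee_fin ltW//.
Qed.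

Let B_fin t : -1 < t -> (B t c \is a fin_num)%E.
Proof.
move=> t1.
have pos u : 0 <= u -> (B u c \is a fin_num)%E.
  move=> u0; rewrite ge0_fin_numE//.
  apply: (@le_lt_trans _ _ (B 0 c)); last by rewrite B0 ltry.
  apply: ge0_le_integral => //.
  - by move=> x _; rewrite lee_fin mulr_ge0 ?powR_ge0.
  - exact: measurable_moment.
  - exact: measurable_moment.
  - move=> x /=; rewrite in_itv/= andbT => x0.
    rewrite lee_fin /W x0/=; case: ifP => [x1|_]; last by rewrite !mulr0.
    by rewrite ler_wpM2r ?powR_ge0// ger_powR// x0 ltW.
have [t0|t0] := leP 0 t; first exact: pos.
have t10 : 0 < t + 1 by rewrite -ltrBlDr sub0r.
have h := pos (t + 1) (ltW t10); have := BD t1; rewrite ge0_fin_numE//.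
case: (B t c) => [r _||_]; [exact: ltry| |by []].
by rewrite gt0_muley ?lte_fin// -(fineK h) -EFinM.
Qed.

(** Bohr-Mollerup for the product of the moment and Gamma (t + 1 + c) / Gamma c. The recurrences of
    the two factors combine into that of Gamma, and both factors are log-convex; for the second one
    this is read off the moments of e^(-x). *)
Let beta_kernel_moment t : -1 < t ->
  has_moment (W c) t (rGamma (t + 1) * rGamma c / rGamma (t + 1 + c)).
Proof.
pose m t := fine (B t c).
have mE u : -1 < u -> has_moment (W c) u (m u).
  by move=> u1; rewrite /has_moment -/(B u c) /m fineK// B_fin.
have m_gt0 (u : R) : -1 < u -> 0 < m u.
  move=> u1; apply: (@moment_gt0 R _ u 4^-1 2^-1 (2^-1 `^ c) _ (W_meas c) (W_ge0 c)
    _ _ _ _ (mE u u1)); rewrite ?powR_gt0//.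
    by lra.
  move=> x /andP[x1 x2].
  have x01 : 0 < x < 1 by apply/andP; split; lra.
  have y0 : 0 < 1 - x by lra.
  rewrite /W x01 (@le_trans _ _ ((1 - x) `^ c))//.
    by rewrite ge0_ler_powR ?nnegrE ?(ltW c_gt0)//; lra.
  by rewrite ger_powR// ?y0; lra.
pose G t := rGamma (t + 1 + c) / rGamma c.
have c0 := rGamma_gt0 c_gt0.
have tc (u : R) : -1 < u -> 0 < u + 1 + c.
  by move=> u1; have := c_gt0; lra.
have G_gt0 (u : R) : -1 < u -> 0 < G u.
  by move=> u1; rewrite divr_gt0// rGamma_gt0// tc.
move=> t1.
have <- : m t = rGamma (t + 1) * rGamma c / rGamma (t + 1 + c); last exact: mE.
suff -> : rGamma (t + 1) = m t * G t.
  rewrite /G; have h1 := negbT (gt_eqF (rGamma_gt0 (tc t t1))); have h2 := negbT (gt_eqF c0).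
  move: (m t) (rGamma (t + 1 + c)) (rGamma c) h1 h2 => x y z h1 h2.
  by field; rewrite h1 h2.
apply/esym; apply: (@bohr_mollerup _ (fun t => m t * G t)) => //.
- by move=> u u1; rewrite mulr_gt0 ?m_gt0 ?G_gt0.
- move=> u u1; have h := BD u1.
  have u2 : -1 < u + 1 by lra.
  have {}h : (u + 1) * m u = (u + 1 + c) * m (u + 1).
    by rewrite /m -[u + 1 in LHS]/(fine (u + 1)%:E) -fineM ?B_fin// h fineM ?B_fin.
  have -> : G (u + 1) = (u + 1 + c) * G u.
    rewrite /G (_ : u + 1 + 1 + c = u + 1 + c + 1); last by ring.
    by rewrite rGammaS; [rewrite mulrA|exact: tc].
  by rewrite [in LHS]mulrA [m _ * _]mulrC -h mulrA.
- rewrite /m B0 /G add0r addrC rGammaS//=; field.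
  by rewrite !gt_eqF.
- move=> u s u1 s01; have [s0 s1] := andP s01.
  have us : -1 < u + s by rewrite (lt_le_trans u1)// lerDl.
  have u2 : -1 < u + 1 by rewrite (lt_trans u1)// ltrDl.
  have e1 : -1 < u + c by rewrite (lt_trans u1)// ltrDl.
  have e2 : -1 < u + c + 1 by rewrite (lt_trans e1)// ltrDl.
  have e3 : -1 < u + c + s by rewrite (lt_le_trans e1)// lerDl.
  have p1 : 0 < u + c + 1 by rewrite -ltrBlDr sub0r.
  have p2 : 0 < u + c + 1 + 1 by rewrite -ltrBlDr sub0r.
  have h1 := moment_logconvex (W_meas c) (W_ge0 c) s01 (m_gt0 u u1) (m_gt0 _ u2)
    (mE u u1) (mE _ u2) (mE _ us).
  have h2 := moment_logconvex (@measurable_gamma_factor R 0) (gamma_factor_ge0 0) s01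
    (rGamma_gt0 p1) (rGamma_gt0 p2)
    (gamma_moment0 e1) (gamma_moment0 e2) (gamma_moment0 e3).
  have h3 : G (u + s) <= G u `^ (1 - s) * G (u + 1) `^ s.
    rewrite /G powR_mean_div; [|exact/rGamma_gt0/tc|exact/rGamma_gt0/tc|exact: c0].
    apply: ler_wpM2r; first by rewrite invr_ge0; exact: ltW c0.
    have -> : u + s + 1 + c = u + c + s + 1 by ring.
    have -> : u + 1 + c = u + c + 1 by ring.
    by have -> : u + 1 + 1 + c = u + c + 1 + 1 by ring.
  rewrite powR_mean_mul; [|exact: m_gt0|exact: m_gt0|exact: G_gt0|exact: G_gt0].
  by apply: ler_pM h1 h3; apply: ltW; [exact: m_gt0|exact: G_gt0].
Qed.

Lemma beta_moment a t : -1 < t + a ->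
  has_moment (beta_factor a (a + c)) t (rGamma (t + a + 1) / rGamma (t + a + c + 1)).
Proof.
move=> ta; have h := beta_kernel_moment ta.
have c0 := rGamma_gt0 c_gt0.
have Wm := measurable_moment (t + a) (W_meas c).
rewrite /has_moment.
transitivity (\int[mu]_(x in `]0%R, +oo[)
    (((rGamma c)^-1)%:E * (x `^ (t + a) * W c x)%:E))%E.
  apply: eq_integral => x; rewrite inE/= in_itv/= andbT => x0.
  rewrite -EFinM; congr EFin; rewrite /beta_factor /W [a + c]addrC addrK.
  case: ifP => _; last by rewrite !mulr0.
  by rewrite (gt0_powRD t a x0); ring.
rewrite ge0_integralZl//=; first last.
- by rewrite lee_fin invr_ge0 ltW.
- by move=> x _; rewrite lee_fin mulr_ge0 ?powR_ge0.
rewrite h -EFinM; congr EFin; rewrite [t + a + 1 + c]addrAC.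
move: (rGamma (t + a + 1)) ((rGamma (t + a + c + 1))^-1) => x y.
by field; rewrite gt_eqF.
Qed.

Lemma beta_factor_ge0 a x : 0 <= beta_factor a (a + c) x.
Proof.
rewrite /beta_factor; case: ifP => // _.
rewrite !mulr_ge0 ?powR_ge0 ?invr_ge0//; apply/ltW/rGamma_gt0.
by rewrite addrC addKr.
Qed.

End Beta.

Lemma measurable_beta_factor (R : realType) (a b : R) :
  measurable_fun setT (beta_factor a b).
Proof.
apply: measurable_fun_ifT => //; first exact: measurable_itv01_test.
apply: measurable_funM => //; apply: measurable_funM; first exact: measurable_powR.
apply: (measurableT_comp (measurable_powR (b - a - 1))).
exact: measurable_funB.
Qed.

(** * Mellin convolution and moments of the weights *)

Section MellinConvolution.
Variable R : realType.
Local Notation mu := (@lebesgue_measure R).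
Implicit Types (t s x y c : R) (f g : R -> R).

Lemma measurable_mulr_cst c :
  measurable_fun [set: measurableTypeR R]
    (fun x : measurableTypeR R => x * c : measurableTypeR R).
Proof. exact: measurable_funM. Qed.

(** c times the image measure under the dilation agrees with Lebesgue measure on the intervals ]u,
    v], which determine it. *)
Lemma lebesgue_measure_scale c (A : set (measurableTypeR R)) : 0 < c ->
  measurable A ->
  (c%:E * mu ((fun x => x * c)%R @^-1` A) = mu A)%E.
Proof.
move=> c0 mA.
have [m mE] : exists m : {measure set (measurableTypeR R) -> \bar R},
    forall A, m A = (c%:E * mu ((fun x => x * c)%R @^-1` A))%E.
  have [m mE] : exists m : {measure set (measurableTypeR R) -> \bar R},
    forall A, m A = pushforward mu (fun x : measurableTypeR R => x * c : measurableTypeR R) A.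
    unshelve eexists [the measure _ _ of pushforward mu (fun x : measurableTypeR R => x * c : measurableTypeR R)].
      exact: measurable_mulr_cst.
    by [].
  exists [the measure _ _ of mscale (NngNum (ltW c0)) m] => B.
  by rewrite /= /mscale/= mE.
rewrite -mE; apply/esym.
apply: lebesgue_measure_unique => //= _ [[u v]] _ <-.
rewrite mE.
have -> : ((fun x => x * c)%R @^-1` `]u, v])%classic = `](u / c), (v / c)]%classic.
  by apply/seteqP; split => x /=; rewrite !in_itv/= ltr_pdivrMr// ler_pdivlMr.
rewrite !lebesgue_measure_itv/= !lte_fin ltr_pM2r ?invr_gt0//.
case: ifP => _; last by rewrite mule0.
by rewrite -!EFinB -EFinM -mulrBl mulrC divfK ?gt_eqF.
Qed.

Lemma ge0_integral_scale c (phi : R -> \bar R) : 0 < c ->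
  measurable_fun [set: R] phi -> (forall x, 0 <= phi x)%E ->
  (\int[mu]_(x in `]0%R, +oo[) phi (x * c)%R =
   c^-1%:E * \int[mu]_(x in `]0%R, +oo[) phi x)%E.
Proof.
move=> c0 mphi phi0.
have mI : measurable (`]0, +oo[ : set (measurableTypeR R)) by exact: measurable_itv.
suff -> : (\int[mu]_(x in `]0%R, +oo[) phi x =
   c%:E * \int[mu]_(x in `]0%R, +oo[) phi (x * c)%R)%E.
  by rewrite muleA -EFinM mulVf ?gt_eqF// mul1e.
have := ge0_integral_pushforward (measurable_mulr_cst c) mu mI
  (measurable_funTS mphi) (in1W phi0).
have -> : ((fun x : R => x * c) @^-1` `]0, +oo[)%classic = `]0, +oo[%classic :> set R.
  by apply/seteqP; split => x /=; rewrite !in_itv/= !andbT pmulr_lgt0.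
move=> <-.
have := @ge0_integral_mscale _ _ _ _ _ mI (NngNum (ltW c0)) _ (measurable_funTS mphi) (fun x _ => phi0 x).
move=> <-; first exact: measurable_mulr_cst.
move=> mc; apply: eq_measure_integral => A mA _.
exact: (esym (lebesgue_measure_scale c0 mA)).
Qed.

Lemma integral_pos_indic (phi : R -> \bar R) :
  (\int[mu]_(x in `]0%R, +oo[) phi x = \int[mu]_x (if (0 < x)%R then phi x else 0))%E.
Proof.
rewrite integral_mkcond; apply: eq_integral => x _.
by rewrite patchE mem_setE/= in_itv/= andbT.
Qed.

Section Density.
Variables f g : R -> R.
Hypotheses (mf : measurable_fun [set: measurableTypeR R] f)
  (mg : measurable_fun [set: measurableTypeR R] g)
  (f0 : forall x, 0 <= f x) (g0 : forall x, 0 <= g x).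

(** The integrand of the convolution at z = (x, t). Reciprocals are written as powers, so that joint
    measurability follows from that of [powR]. *)
Let H (z : measurableTypeR R * measurableTypeR R) : R :=
  if 0 < z.2 then f z.2 * g (z.1 * z.2 `^ (-1)) * z.2 `^ (-1) else 0.

Let H_ge0 z : 0 <= H z.
Proof. by rewrite /H; case: ifP => // _; rewrite !mulr_ge0 ?powR_ge0. Qed.

Let mH : measurable_fun setT H.
Proof.
have mpow : measurable_fun setT
    (fun z : measurableTypeR R * measurableTypeR R => (z.2 : R) `^ (-1)).
  exact: (measurableT_comp (measurable_powR (-1)) measurable_snd).
apply: measurable_fun_ifT => //.
- exact: (measurable_fun_ltr (measurable_cst _) measurable_snd).
- apply: measurable_funM => //; apply: measurable_funM.
    exact: (measurableT_comp mf measurable_snd).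
  apply: (measurableT_comp mg); exact: measurable_funM.
Qed.

Let J (x : measurableTypeR R) : \bar R := (\int[mu]_t (H (x, t))%:E)%E.

Let J_ge0 x : (0 <= J x)%E.
Proof. by apply: integral_ge0 => t _; rewrite lee_fin. Qed.

Let mJ : measurable_fun [set: measurableTypeR R] J.
Proof.
apply: (@measurable_fun_fubini_tonelli_F _ _ (measurableTypeR R) (measurableTypeR R) R
  mu (EFin \o H)).
  exact/measurable_EFinP.
by move=> z; rewrite lee_fin.
Qed.

Let convE x : mellin_conv f g x = fine (J x).
Proof.
rewrite /mellin_conv /Rintegral integral_pos_indic; congr fine.
apply: eq_integral => t _; rewrite /H/=; case: ifP => // t0.
by rewrite powR_inv1// ltW.
Qed.

Lemma mellin_conv_ge0 x : 0 <= mellin_conv f g x.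
Proof. by rewrite convE fine_ge0. Qed.

Lemma measurable_mellin_conv : measurable_fun [set: measurableTypeR R] (mellin_conv f g).
Proof.
have -> : mellin_conv f g = fine \o J by apply/funext => x; rewrite convE.
exact: measurableT_comp.
Qed.

(** Tonelli and the substitution x -> x y. As [mellin_conv] is the [fine] part of [J], it represents
    [J] only where [J] is finite; the finite double integral makes this almost everywhere. *)
Lemma mellin_conv_moment t (u v : R) : has_moment f t u -> has_moment g t v ->
  has_moment (mellin_conv f g) t (u * v).
Proof.
move=> fu gv.
have mI : measurable (`]0, +oo[ : set (measurableTypeR R)) by exact: measurable_itv.
have mpowt : measurable_fun [set: measurableTypeR R] (fun x => (x : R) `^ t).
  exact: measurable_powR.
pose K (z : measurableTypeR R * measurableTypeR R) : R :=
  if 0 < z.1 then z.1 `^ t * H z else 0.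
have K0 z : 0 <= K z by rewrite /K; case: ifP => // _; rewrite mulr_ge0 ?powR_ge0.
have mK : measurable_fun setT K.
  apply: measurable_fun_ifT => //.
    exact: (measurable_fun_ltr (measurable_cst _) measurable_fst).
  apply: measurable_funM => //.
  exact: (measurableT_comp (measurable_powR t) measurable_fst).
have JK : (\int[mu]_(x in `]0%R, +oo[) ((x `^ t)%:E * J x) = (u * v)%:E)%E.
  transitivity (\int[mu]_x \int[mu]_y (K (x, y))%:E)%E.
    rewrite integral_pos_indic; apply: eq_integral => x _; rewrite /K/=.
    case: ifP => _; last by rewrite integral0.
    rewrite -ge0_integralZl//.
    - apply/measurable_EFinP; apply: (measurableT_comp mH).
      exact: measurable_fun_pair.
    - by move=> y _; rewrite lee_fin.
    - by rewrite lee_fin powR_ge0.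
  rewrite (@fubini_tonelli _ _ (measurableTypeR R) (measurableTypeR R) R mu mu
    (fun z => (K z)%:E)); last 2 first.
  - exact/measurable_EFinP.
  - by move=> z; rewrite lee_fin.
  transitivity (\int[mu]_(y in `]0%R, +oo[) ((y `^ t * f y)%:E * v%:E))%E.
    rewrite integral_pos_indic; apply: eq_integral => y _; rewrite /K /H/=.
    case: ifP => [y0|_]; last first.
      by under eq_integral do rewrite mulr0 if_same; rewrite integral0.
    pose phi (x : R) : \bar R := (if 0 < x then (x * y) `^ t * g x else 0)%:E.
    have mphi : measurable_fun [set: measurableTypeR R] phi.
      apply/measurable_EFinP; apply: measurable_fun_ifT => //.
        exact: measurable_fun_ltr.
      apply: measurable_funM => //.
      apply: (measurableT_comp (measurable_powR t)); exact: measurable_funM.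
    have phi0 x : (0 <= phi x)%E.
      by rewrite /phi lee_fin; case: ifP => // _; rewrite mulr_ge0 ?powR_ge0.
    transitivity ((y^-1 * f y)%:E * \int[mu]_(x in `]0%R, +oo[) phi (x * y^-1)%R)%E.
      rewrite -ge0_integralZl//; last 2 first.
      - by apply/measurable_funTS/(measurableT_comp mphi); exact: measurable_mulr_cst.
      - by rewrite lee_fin mulr_ge0 ?invr_ge0 ?(ltW y0).
      rewrite integral_pos_indic; apply: eq_integral => x _; rewrite /phi.
      case: ifP => // x0.
      rewrite (divr_gt0 x0 y0) divfK ?gt_eqF// -EFinM powR_inv1 ?(ltW y0)//.
      by congr EFin; ring.
    rewrite ge0_integral_scale ?invr_gt0//.
    rewrite -gv muleA -EFinM invrK -[X in (X * _)%E = _](_ : (f y)%:E = _); last first.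
      by congr EFin; field; rewrite gt_eqF.
    rewrite EFinM (muleC (y `^ t)%:E) -muleA; congr (_ * _)%E.
    rewrite -ge0_integralZl//.
    - apply: eq_integral => x; rewrite inE/= in_itv/= andbT => x0.
      by rewrite /phi x0 powRM ?(ltW x0) ?(ltW y0)// -EFinM; congr EFin; ring.
    - exact: measurable_moment.
    - by move=> x _; rewrite lee_fin mulr_ge0 ?powR_ge0.
    - by rewrite lee_fin powR_ge0.
  rewrite EFinM -fu -ge0_integralZr//.
  - exact: measurable_moment.
  - by move=> x _; rewrite lee_fin mulr_ge0 ?powR_ge0.
  - rewrite -gv; apply: integral_ge0 => x _.
    by rewrite lee_fin mulr_ge0 ?powR_ge0.
have mint : measurable_fun (`]0, +oo[ : set (measurableTypeR R)) (fun x => (x `^ t)%:E * J x)%E.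
  apply: measurable_funTS; apply: emeasurable_funM => //.
  exact/measurable_EFinP.
have int0 x : (0 <= (x `^ t)%:E * J x)%E by rewrite mule_ge0 ?lee_fin ?powR_ge0.
rewrite /has_moment -JK; apply: ge0_ae_eq_integral => //.
- by apply: measurable_moment; exact: measurable_mellin_conv.
- by move=> x _; rewrite lee_fin mulr_ge0 ?powR_ge0 ?mellin_conv_ge0.
(* An integrable function is finite almost everywhere, and x^t > 0 passes this on to [J x]. *)
- have : mu.-integrable (`]0, +oo[ : set (measurableTypeR R)) (fun x => (x `^ t)%:E * J x)%E.
    apply/integrableP; split => //.
    under eq_integral => x _ do rewrite gee0_abs//.
    by rewrite JK ltry.
  move=> /(integrable_ae mI); apply: filterS => x /[swap] x0 /(_ x0).
  move: x0; rewrite /= in_itv/= andbT => x0 fin.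
  rewrite convE EFinM fineK//; move: fin.
  have : 0 < x `^ t by rewrite powR_gt0.
  case: (J x) (J_ge0 x) => // _ xt0.
  by rewrite mulry gtr0_sg// mul1e.
Qed.

End Density.

End MellinConvolution.

(** * The Euler operator on convolutions with Gamma factors *)

Section EulerOperator.
Variable R : realType.
Local Notation mu := (@lebesgue_measure R).
Implicit Types (t s x y c a : R) (f g : R -> R).

Lemma gamma_factorS a x : gamma_factor (a + 1) x = x * gamma_factor a x.
Proof.
rewrite /gamma_factor; case: ifP => x0; last by rewrite mulr0.
by rewrite (gt0_powRD a 1 x0) powRr1 ?(ltW x0)//; ring.
Qed.

(** [-1 <= a] keeps x^(a+1) bounded near 0. As a consequence the integrand of the convolution is at
    most a multiple of f, the majorant for differentiation under the integral. *)
Lemma gamma_factor_bound a : -1 <= a ->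
  exists2 K : R, 0 <= K & forall x, 0 < x -> x * gamma_factor a x <= K.
Proof.
move=> a1; have [K K0 KP] := powR_expRN_le (a + 1).
exists (1 + K) => [|x x0]; first by rewrite addr_ge0.
rewrite -gamma_factorS /gamma_factor x0.
have [x1|x1] := leP 1 x.
  rewrite (le_trans (KP _ x1))// ler_wpDl// ler_pdivrMr//.
  by rewrite ler_peMr.
rewrite ler_wpDr// mulr_ile1 ?powR_ge0 ?expR_ge0//.
  have a10 : 0 <= a + 1 by lra.
  have := @ge0_ler_powR _ _ a10 x 1; rewrite powR1; apply; rewrite ?nnegrE ?ltW//.
by rewrite -expR0 ler_expR oppr_le0 ltW.
Qed.

Lemma is_derive_gamma_factor a x : 0 < x ->
  is_derive x 1 (@gamma_factor R a) (a * gamma_factor a x / x - gamma_factor a x).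
Proof.
move=> x0.
have dp := is_derive1_powR a x0.
apply: (@near_eq_is_derive _ _ _ (fun y => y `^ a * expR (- y))).
  near=> y; rewrite /gamma_factor ifT//; near: y; exact: lt_nbhsr.
apply: is_derive_eq.
have -> : x `^ (a - 1) = x `^ a / x by rewrite (gt0_powRD a (-1) x0) powR_inv1 ?(ltW x0).
by rewrite /gamma_factor x0 /GRing.scale/=; ring.
Unshelve. all: by end_near. Qed.

Section Conv.
Variables (f : R -> R) (u : R).
Hypotheses (mf : measurable_fun [set: measurableTypeR R] f) (f0 : forall x, 0 <= f x)
  (fu : has_moment f 0 u).
Local Notation Phi a := (mellin_conv f (gamma_factor a)).

Let F a x y : R := f y * gamma_factor a (x / y) / y.

Let mI : measurable (`]0, +oo[ : set (measurableTypeR R)).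
Proof. exact: measurable_itv. Qed.

Let F_ge0 a x y : 0 < y -> 0 <= F a x y.
Proof. by move=> y0; rewrite /F !mulr_ge0 ?gamma_factor_ge0 ?invr_ge0 ?(ltW y0). Qed.

Let F_bound a : -1 <= a -> exists2 K : R, 0 <= K &
  forall x y, 0 < x -> 0 < y -> F a x y <= K / x * f y.
Proof.
move=> /gamma_factor_bound[K K0 KP]; exists K => // x y x0 y0.
have -> : F a x y = (x / y * gamma_factor a (x / y)) / x * f y.
  by rewrite /F; move: (gamma_factor a _) => v; field; rewrite !gt_eqF.
by rewrite ler_wpM2r// ler_pM2r ?invr_gt0// KP// divr_gt0.
Qed.

Let f_int : mu.-integrable (`]0, +oo[ : set (measurableTypeR R)) (EFin \o f).
Proof.
have := moment_integrable mf f0 fu.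
apply: eq_integrable => // x; rewrite inE/= in_itv/= andbT => x0.
by rewrite powRr0 mul1r.
Qed.

Let mF a x : 0 < x -> measurable_fun (`]0, +oo[ : set (measurableTypeR R)) (F a x).
Proof.
move=> x0.
apply: (@eq_measurable_fun _ _ _ _ _ (fun y => f y * gamma_factor a (x * y `^ (-1)) * y `^ (-1))).
  by move=> y; rewrite inE/= in_itv/= andbT => y0; rewrite powR_inv1 ?ltW.
apply: measurable_funTS; apply: measurable_funM; last exact: measurable_powR.
apply: measurable_funM => //; apply: (measurableT_comp (measurable_gamma_factor a)).
by apply: measurable_funM => //; exact: measurable_powR.
Qed.

Let F_int a x : -1 <= a -> 0 < x ->
  mu.-integrable (`]0, +oo[ : set (measurableTypeR R)) (EFin \o F a x).
Proof.
move=> a1 x0; have [K K0 KP] := F_bound a1.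
apply: (@le_integrable _ _ _ _ _ mI _ (fun y => (K / x)%:E * (EFin \o f) y)%E).
- by apply/measurable_EFinP; exact: mF.
- move=> y /=; rewrite in_itv/= andbT => y0.
  by rewrite lee_fin !ger0_norm ?F_ge0 ?KP// mulr_ge0 ?divr_ge0 ?(ltW x0).
- exact: integrableZl.
Qed.

Let is_derive_F a x y : 0 < x -> 0 < y ->
  is_derive x 1 (F a ^~ y) (x^-1 * (a * F a x y - F (a + 1) x y)).
Proof.
move=> x0 y0.
have d1 : is_derive x 1 (fun z : R => z / y) y^-1.
  by apply: is_derive_eq; rewrite /GRing.scale/=; ring.
have d2 := is_derive_gamma_factor a (divr_gt0 x0 y0).
have d3 : is_derive x 1 (fun z => gamma_factor a (z / y)) _ := @is_derive1_comp _ (@gamma_factor R a) (fun z : R => z / y) x _ _ d2 d1.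
rewrite /F; apply: is_derive_eq.
rewrite gamma_factorS /GRing.scale/=; move: (gamma_factor a _) => v.
by field; rewrite !gt_eqF.
Qed.

(** Differentiation under the integral; the two terms come from the power and from the exponential
    of the Gamma factor. *)
Lemma is_derive_mellin_conv_gamma a x : -1 <= a -> 0 < x ->
  is_derive x 1 (Phi a) (x^-1 * (a * Phi a x - Phi (a + 1) x)).
Proof.
move=> a1 x0.
have a2 : -1 <= a + 1 by rewrite ler_wpDr.
have [K K0 KP] := F_bound a1; have [K' K'0 K'P] := F_bound a2.
(* On ]x/2, 2x[ one has 1/z <= 2/x, which bounds the outer factor and, through [F_bound] at a and at
   a + 1, each of the two terms. *)
pose G y := 2 / x * (`|a| * (K * (2 / x)) + K' * (2 / x)) * f y.
have xI : `](x / 2), (x * 2)[%classic x by rewrite /= in_itv/=; apply/andP; split; lra.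
have I0 z : `](x / 2), (x * 2)[%classic z -> 0 < z.
  by rewrite /= in_itv/= => /andP[]; lra.
have dF z y : `](x / 2), (x * 2)[%classic z -> `]0, +oo[%classic y ->
    is_derive z 1 (F a ^~ y) (z^-1 * (a * F a z y - F (a + 1) z y)).
  by rewrite [X in _ -> X -> _]/= in_itv/= andbT => /I0 z0 y0; exact: is_derive_F.
have der z y : `](x / 2), (x * 2)[%classic z -> `]0, +oo[%classic y ->
    derivable (F a ^~ y) z 1.
  by move=> zI y0; have [] := dF z y zI y0.
have int z : `](x / 2), (x * 2)[%classic z ->
    mu.-integrable (`]0, +oo[ : set (measurableTypeR R)) (EFin \o F a z).
  by move/I0 => z0; exact: F_int.
have x20 : 0 <= 2 / x by rewrite divr_ge0// ltW.
have G0 y : 0 <= G y by rewrite /G !(mulr_ge0, addr_ge0) ?invr_ge0 ?(ltW x0).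
have Gint : mu.-integrable (`]0, +oo[ : set (measurableTypeR R)) (EFin \o G).
  exact: (@integrableZl _ _ _ _ _ mI _ _ f_int).
have dG z y : `](x / 2), (x * 2)[%classic z -> `]0, +oo[%classic y ->
    `|partial1of2 (F a) z y| <= G y.
  move=> zI yI; rewrite partial1of2E.
  have [_ ->] := dF z y zI yI.
  have z0 := I0 z zI; have y0 : 0 < y by move: yI; rewrite /= in_itv/= andbT.
  have zx : z^-1 <= 2 / x.
    rewrite -[2 / x]invrK invf_div lef_pV2 ?posrE// ?divr_gt0//.
    by move: zI; rewrite /= in_itv/= => /andP[/ltW].
  rewrite normrM ger0_norm ?invr_ge0 ?(ltW z0)// /G -mulrA ler_pM ?invr_ge0 ?(ltW z0)//.
  rewrite (le_trans (ler_normB _ _))// normrM (ger0_norm (F_ge0 _ _ y0)) (ger0_norm (F_ge0 _ _ y0)).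
  rewrite mulrDl lerD//.
    rewrite -mulrA ler_wpM2l// (le_trans (KP _ _ z0 y0))// ler_wpM2r//.
    by rewrite ler_wpM2l.
  by rewrite (le_trans (K'P _ _ z0 y0))// ler_wpM2r// ler_wpM2l.
apply: DeriveDef.
  exact: (derivable_under_integral mI xI int der G0 Gint dG).
rewrite -derive1E.
have := differentiation_under_integral mI xI int der G0 Gint dG.
rewrite /mellin_conv => ->.
have Z1 := @integrableZl _ _ _ _ _ mI a _ (F_int a1 x0).
rewrite -RintegralZl//; last exact: F_int.
rewrite -RintegralB//; last exact: F_int.
rewrite -RintegralZl//; last first.
  exact: (integrableB mI Z1 (F_int a2 x0)).
apply: eq_Rintegral => y; rewrite inE => y0.
rewrite partial1of2E; by have [_ ->] := dF x y xI y0.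
Qed.

Let is_derive_comb (zs : seq (R * R)) x :
  all (fun z => -1 <= z.2) zs -> 0 < x ->
  is_derive x 1 (fun x => \sum_(z <- zs) z.1 * Phi z.2 x)
    (\sum_(z <- zs) z.1 * (x^-1 * (z.2 * Phi z.2 x - Phi (z.2 + 1) x))).
Proof.
move=> + x0; elim: zs => [_|z zs IH /= /andP[z1 /IH dzs]].
  under eq_fun do rewrite big_nil.
  by rewrite big_nil; exact: is_derive_cst.
under eq_fun do rewrite big_cons.
rewrite big_cons.
have dz := is_derive_mellin_conv_gamma z1 x0.
have dZ : is_derive x 1 (fun y => z.1 * Phi z.2 y)
    (z.1 * (x^-1 * (z.2 * Phi z.2 x - Phi (z.2 + 1) x))).
  exact: (@is_deriveZ _ _ _ (Phi z.2) z.1 x 1 _ dz).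
exact: (is_deriveD dZ dzs).
Qed.

(** The operator maps Phi c to - c Phi c + Phi (c + 1), so iterates stay in the span of the Phi c;
    [zs] lists pairs of coefficient and index. Since Gamma (t + c + 2) - c Gamma (t + c + 1) = (t +
    1) Gamma (t + c + 1), moments are found without boundary terms. *)
Lemma iter_euler_mellin_conv a j : -1 <= a -> exists zs : seq (R * R),
  [/\ all (fun z => a <= z.2) zs,
      forall x, 0 < x ->
        iter j (@euler_op R) (Phi a) x = \sum_(z <- zs) z.1 * Phi z.2 x
    & forall t, -1 < t + a ->
        \sum_(z <- zs) z.1 * rGamma (t + z.2 + 1) = (t + 1) ^+ j * rGamma (t + a + 1)].
Proof.
move=> a1; elim: j => [|j [zs [za zsE zsG]]].
  exists [:: (1, a)]; split=> [|x x0|t ta] /=; first by rewrite lexx.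
    by rewrite big_seq1 mul1r.
  by rewrite big_seq1 expr0.
exists ([seq (- z.2 * z.1, z.2) | z <- zs] ++ [seq (z.1, z.2 + 1) | z <- zs]).
have zs1 : all (fun z => -1 <= z.2) zs.
  by apply: sub_all za => z /=; exact: le_trans.
split=> [|x x0|t ta].
- rewrite all_cat !all_map; apply/andP; split; first exact: za.
  by apply: sub_all za => z /=; lra.
- rewrite big_cat !big_map /= /euler_op.
  have dc := is_derive_comb zs1 x0.
  have : is_derive x 1 (iter j (@euler_op R) (Phi a))
    (\sum_(z <- zs) z.1 * (x^-1 * (z.2 * Phi z.2 x - Phi (z.2 + 1) x))).
    apply: near_eq_is_derive dc; near=> y; rewrite zsE//; near: y; exact: lt_nbhsr.
  rewrite derive1E; case=> _ ->.
  rewrite -big_split mulr_sumr; apply: eq_bigr => z _ /=.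
  by move: (Phi _ _) (Phi _ _) => v w; field; rewrite gt_eqF.
- rewrite big_cat !big_map /= -big_split/= exprS -mulrA -zsG// mulr_sumr.
  rewrite big_seq [RHS]big_seq; apply: eq_bigr => z /(allP za) /= az.
  rewrite (addrA t) (@rGammaS _ (t + z.2 + 1)); last by lra.
  by move: (rGamma _) => v; ring.
Unshelve. all: by end_near. Qed.

End Conv.

(** The variant of [has_moment] for functions of variable sign, such as iterates of the Euler
    operator. *)
Definition mellin_at f t v : Prop :=
  mu.-integrable (`]0%R, +oo[ : set (measurableTypeR R)) (fun x => (x `^ t * f x)%:E) /\
  \int[mu]_(x in `]0%R, +oo[) (x `^ t * f x) = v.

Lemma mellin_at_moment f t v : measurable_fun [set: measurableTypeR R] f ->
  (forall x, 0 <= f x) -> has_moment f t v -> mellin_at f t v.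
Proof.
move=> mf f0 fv; split; first exact: moment_integrable fv.
by rewrite /Rintegral fv.
Qed.

Lemma eq_mellin_at f g t v : (forall x, 0 < x -> f x = g x) ->
  mellin_at f t v -> mellin_at g t v.
Proof.
move=> fg [fi fv]; split.
  apply: eq_integrable fi => //.
  by move=> x; rewrite inE/= in_itv/= andbT => x0; rewrite fg.
rewrite -fv; apply: eq_Rintegral => x; rewrite inE/= in_itv/= andbT => x0.
by rewrite fg.
Qed.

Lemma mellin_at_sum (I : eqType) (zs : seq I) (c v : I -> R) (F : I -> R -> R) t :
  (forall z, z \in zs -> mellin_at (F z) t (v z)) ->
  mellin_at (fun x => \sum_(z <- zs) c z * F z x) t (\sum_(z <- zs) c z * v z).
Proof.
have mI : measurable (`]0, +oo[ : set (measurableTypeR R)) by exact: measurable_itv.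
elim: zs => [_|z zs IH zsv].
  split; rewrite ?big_nil.
    apply: (eq_integrable mI) (integrable0 _ _) => x _.
    by rewrite big_nil mulr0.
  transitivity (\int[mu]_(x in `]0%R, +oo[) (0 : R)); last by rewrite Rintegral_cst// mul0r.
  by apply: eq_Rintegral => x _; rewrite big_nil mulr0.
have /IH[] : forall w, w \in zs -> mellin_at (F w) t (v w).
  by move=> w wzs; apply: zsv; rewrite in_cons wzs orbT.
move=> si sv; have [zi zv] := zsv z (mem_head _ _).
have E x : x `^ t * (\sum_(w <- z :: zs) c w * F w x) =
  c z * (x `^ t * F z x) + x `^ t * (\sum_(w <- zs) c w * F w x).
  by rewrite big_cons mulrDr mulrCA.
have ci := @integrableZl _ _ _ _ _ mI (c z) _ zi.
split.
  apply: (eq_integrable mI) (integrableD mI ci si) => x _.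
  by rewrite E EFinD EFinM.
transitivity (\int[mu]_(x in `]0%R, +oo[)
    (c z * (x `^ t * F z x) + x `^ t * (\sum_(w <- zs) c w * F w x))).
  by apply: eq_Rintegral => x _; rewrite E.
by rewrite RintegralD// RintegralZl// zv big_cons sv.
Qed.

End EulerOperator.

Section WeightMoments.
Variable R : realType.
Implicit Types (t u x y c : R) (f g : R -> R).

Lemma foldl_mellin_conv f (I : eqType) (F : I -> R -> R) (l : seq I) :
  measurable_fun [set: measurableTypeR R] f -> (forall x, 0 <= f x) ->
  (forall i, measurable_fun [set: measurableTypeR R] (F i)) ->
  (forall i x, 0 <= F i x) ->
  [/\ measurable_fun [set: measurableTypeR R] (foldl (@mellin_conv R) f (map F l)),
      forall x, 0 <= foldl (@mellin_conv R) f (map F l) x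
    & forall t u (v : I -> R), has_moment f t u ->
        (forall i, i \in l -> has_moment (F i) t (v i)) ->
        has_moment (foldl (@mellin_conv R) f (map F l)) t (u * \prod_(i <- l) v i)].
Proof.
move=> + + mF F0; elim: l f => [|i l IH] f mf f0 /=.
  by split=> // t u v fu _; rewrite big_nil mulr1.
have := IH (mellin_conv f (F i)).
case.
- exact: measurable_mellin_conv.
- by move=> x; exact: mellin_conv_ge0.
move=> mc c0 cm; split=> // t u v fu Fv.
rewrite big_cons mulrA; apply: cm => [|j jl].
  by apply: mellin_conv_moment => //; apply: Fv; exact: mem_head.
by apply: Fv; rewrite in_cons jl orbT.
Qed.

Section Weight.
Variables (q r : nat) (a : q.-tuple R) (b : r.-tuple R).
Hypotheses (rq : (r < q)%N) (a1 : forall i, (i < q)%N -> -1 < a`_i)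
  (ab : forall h, (h < r)%N -> a`_h < b`_h).

Let F h : R -> R :=
  if (h < r)%N then beta_factor a`_h b`_h else gamma_factor a`_h.

Let mF h : measurable_fun [set: measurableTypeR R] (F h).
Proof.
rewrite /F.
by case: ifP => _; [exact: measurable_beta_factor|exact: measurable_gamma_factor].
Qed.

Let F0 h x : 0 <= F h x.
Proof.
rewrite /F; case: ifP => hr; last exact: gamma_factor_ge0.
have c0 : 0 < b`_h - a`_h by rewrite subr_gt0; exact: ab.
have := beta_factor_ge0 c0 a`_h x.
by rewrite [a`_h + (_ - _)]addrC subrK.
Qed.

Let m t h : R :=
  rGamma (t + a`_h + 1) / (if (h < r)%N then rGamma (t + b`_h + 1) else 1).

Let Fm t h : -1 < t + a`_h -> has_moment (F h) t (m t h).
Proof.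
move=> ta; rewrite /F /m; case: ifP => hr; last first.
  by rewrite divr1; exact/gamma_moment/ta.
have c0 : 0 < b`_h - a`_h by rewrite subr_gt0; exact: ab.
have := beta_moment c0 ta.
have E : a`_h + (b`_h - a`_h) = b`_h by rewrite addrC subrK.
by rewrite -[t + _ + (_ - _)]addrA E.
Qed.

Let w0E : w0 a b = foldl (@mellin_conv R) (F 0) [seq F h | h <- iota 1 q.-1].
Proof.
rewrite /w0.
have -> : [seq beta_factor a`_h b`_h | h <- iota 0 r] ++
    [seq gamma_factor a`_h | h <- iota r (q - r)] = [seq F h | h <- iota 0 q].
  have -> : iota 0 q = iota 0 r ++ iota r (q - r).
    by rewrite -[r in iota r]add0n -iotaD subnKC// ltnW.
  rewrite map_cat; congr (_ ++ _).
    by apply/eq_in_map => h; rewrite mem_iota add0n /F => /andP[_ ->].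
  by apply/eq_in_map => h; rewrite mem_iota /F leqNgt => /andP[/negbTE -> _].
have {1}-> : q = q.-1.+1 by rewrite prednK// (leq_ltn_trans _ rq).
by [].
Qed.

Let prod_m n t : (0 < n)%N ->
  \prod_(h < n) m t h = m t 0 * \prod_(h <- iota 1 n.-1) m t h.
Proof.
by case: n => // n _; rewrite -(big_mkord xpredT (m t)) /index_iota subn0 big_cons.
Qed.

Let prod_mq t : \prod_(h < q) m t h =
  \prod_(i < q) rGamma (t + a`_i + 1) / \prod_(h < r) rGamma (t + b`_h + 1).
Proof.
rewrite big_split; congr (_ * _).
rewrite -[RHS]prodfV (big_ord_widen q (fun h => (rGamma (t + b`_h + 1))^-1) (ltnW rq)).
by rewrite [RHS]big_mkcond/=; apply: eq_bigr => h _; case: ifP; rewrite ?invr1.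
Qed.

Lemma w0_moment t : (forall i, (i < q)%N -> -1 < t + a`_i) ->
  mellin_at (w0 a b) t
    (\prod_(i < q) rGamma (t + a`_i + 1) / \prod_(h < r) rGamma (t + b`_h + 1)).
Proof.
move=> ta; have q0 : (0 < q)%N by rewrite (leq_ltn_trans _ rq).
have [mw w0' wm] := foldl_mellin_conv (iota 1 q.-1) (mF 0) (F0 0) mF F0.
rewrite w0E; apply: mellin_at_moment => //.
rewrite -prod_mq prod_m//; apply: wm; first exact/Fm/ta.
move=> i; rewrite mem_iota add1n prednK// => /andP[_ iq]; exact/Fm/ta.
Qed.

(** All derivatives act on the last factor, a Gamma factor; [f] is the convolution of the others.
    The premise provides two Gamma factors as soon as there is a derivative, so [f] is not an empty
    convolution. *)
Lemma iter_euler_w0_moment t j : (0 < j -> r.+1 < q)%N ->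
  (forall i, (i < q)%N -> -1 < t + a`_i) ->
  mellin_at (iter j (@euler_op R) (w0 a b)) t
    (\prod_(i < q) rGamma (t + a`_i + 1) / \prod_(h < r) rGamma (t + b`_h + 1)
     * (t + 1) ^+ j).
Proof.
case: j => [_ ta|j /(_ isT) rq1 ta]; first by rewrite mulr1; exact: w0_moment.
have q1 : (1 < q)%N by rewrite (leq_ltn_trans _ rq1).
pose f := foldl (@mellin_conv R) (F 0) [seq F h | h <- iota 1 q.-2].
have [mf f0 fm] := foldl_mellin_conv (iota 1 q.-2) (mF 0) (F0 0) mF F0.
have wE : w0 a b = mellin_conv f (gamma_factor a`_q.-1).
  rewrite w0E.
  have -> : iota 1 q.-1 = iota 1 q.-2 ++ [:: q.-1].
    case: (q) q1 => [|[|n]] // _.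
    by have := iotaD 1 n 1; rewrite addn1 add1n.
  rewrite map_cat foldl_cat /= -/f /F ifF//.
  by apply/negbTE; rewrite -leqNgt -ltnS prednK// ltnW.
have fmt u : (forall i, (i < q)%N -> -1 < u + a`_i) ->
    has_moment f u (\prod_(h < q.-1) m u h).
  move=> ua.
  have q0 : (0 < q.-1)%N by case: (q) q1 => [|[|?]].
  rewrite prod_m//; apply: fm; first by apply: Fm; apply: ua; exact: ltnW.
  move=> i; rewrite mem_iota => /andP[_ iq]; apply: Fm; apply: ua.
  by case: (q) q1 iq => [|[|?]] //= _; rewrite add1n => /ltnW.
(* The moment of order 0 is the integrability of f on which the majorants rely; it exists because
   every a_i exceeds -1. *)
have f00 : has_moment f 0 (\prod_(h < q.-1) m 0 h).
  by apply: fmt => i /a1; rewrite add0r.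
have aq1 : -1 <= a`_q.-1 by apply/ltW/a1; rewrite ltn_predL ltnW.
have [zs [za zsE zsG]] := iter_euler_mellin_conv mf f0 f00 j.+1 aq1.
have taq : -1 < t + a`_q.-1 by apply: ta; rewrite ltn_predL ltnW.
pose v (z : R * R) := (\prod_(h < q.-1) m t h) * rGamma (t + z.2 + 1).
have -> : \prod_(i < q) rGamma (t + a`_i + 1) / \prod_(h < r) rGamma (t + b`_h + 1) *
    (t + 1) ^+ j.+1 = \sum_(z <- zs) z.1 * v z.
  transitivity ((\prod_(h < q.-1) m t h) * \sum_(z <- zs) z.1 * rGamma (t + z.2 + 1)).
    rewrite -prod_mq zsG//.
    have -> : \prod_(h < q) m t h = \prod_(h < q.-1) m t h * m t q.-1.
      by rewrite -(big_mkord xpredT (m t)) -(big_mkord xpredT (m t)) -big_nat_recr/= ?prednK // ltnW.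
    rewrite [m t q.-1]/m ifF ?divr1; first by rewrite mulrAC -mulrA.
    by apply/negbTE; rewrite -leqNgt -ltnS prednK// ltnW.
  by rewrite mulr_sumr; apply: eq_bigr => z _; rewrite mulrCA.
rewrite wE.
apply: (@eq_mellin_at _ (fun x => \sum_(z <- zs) z.1 * mellin_conv f (gamma_factor z.2) x)).
  by move=> x x0; rewrite zsE.
apply: (@mellin_at_sum _ _ zs (fun z => z.1) v (fun z => mellin_conv f (gamma_factor z.2))) => z zzs.
apply: mellin_at_moment.
- apply: measurable_mellin_conv => //; first exact: measurable_gamma_factor.
  by move=> ?; exact: gamma_factor_ge0.
- by move=> x; apply: mellin_conv_ge0 => // ?; exact: gamma_factor_ge0.
- apply: (mellin_conv_moment mf (measurable_gamma_factor _) f0 (gamma_factor_ge0 _)).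
  + exact: fmt.
  + apply: gamma_moment; rewrite (lt_le_trans taq)// lerD2l.
    exact: (allP za).
Qed.

End Weight.

(** Raising b_j by one replaces Gamma (t + b_j + 1) by t + b_j + 1 times itself in the denominator,
    whence the inverse factor. *)
Lemma weight_moment (q r : nat) (a : q.-tuple R) (b : r.-tuple R) t j :
  (r < q)%N -> (forall i, (i < q)%N -> -1 < a`_i) ->
  (forall h, (h < r)%N -> a`_h < b`_h) ->
  (forall i, (i < q)%N -> -1 < t + a`_i) -> (0 < j <= q)%N ->
  mellin_at (weight a b j) t
    (\prod_(i < q) rGamma (t + a`_i + 1) / \prod_(h < r) rGamma (t + b`_h + 1)
     * (if (j <= r)%N then (t + b`_j.-1 + 1)^-1 else (t + 1) ^+ (j - r).-1)).
Proof.
move=> rq a1 ab ta /andP[j0 jq]; rewrite /weight; case: ifP => jr; last first.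
  apply: iter_euler_w0_moment => //; lia.
have bE (h : nat) : (h < r)%N -> (add_unit b j.-1)`_h = b`_h + (h == j.-1)%:R.
  by move=> hr; rewrite /add_unit -[h]/(val (Ordinal hr)) -tnth_nth tnth_mktuple.
have ab' h : (h < r)%N -> a`_h < (add_unit b j.-1)`_h.
  by move=> hr; rewrite bE// (lt_le_trans (ab _ hr))// lerDl.
have := w0_moment rq ab' ta.
congr mellin_at; rewrite -mulrA; congr (_ * _); rewrite -invfM; congr (_^-1).
have jr' : (j.-1 < r)%N by rewrite prednK.
rewrite (bigD1 (Ordinal jr'))//= [in RHS](bigD1 (Ordinal jr'))//= bE// eqxx.
have tb : 0 < t + b`_j.-1 + 1.
  have := ta _ (ltn_trans jr' rq); have := ab _ jr'; lra.
rewrite addrA rGammaS// [RHS]mulrC mulrA; congr (_ * _).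
apply: eq_bigr => h; rewrite -val_eqE /= => /negbTE hj.
by rewrite bE// hj addr0.
Qed.

End WeightMoments.

(** * Exponents and balanced vectors *)

Lemma step_sigmaS p M i : (i < p)%N ->
  step_sigma p M.+1 i = (step_sigma p M i + (i == M %% p))%N.
Proof.
move=> ip; have p0 : (0 < p)%N by exact: leq_ltn_trans ip.
rewrite /step_sigma divnS// modnS; case: ifP => pM; last first.
  by rewrite ltnS leq_eqVlt; case: eqP => [->|]; rewrite ?ltnn addn0 ?addn0.
have : (M %% p).+1 = p.
  apply/eqP; rewrite eqn_leq ltn_pmod//=.
  by move: pM; rewrite {1}(divn_eq M p) -addnS dvdn_addr ?dvdn_mull// => /dvdn_leq ->.
lia.
Qed.

(* The entries of sigma_p(M) record how 0, ..., M - 1 spread over the residue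
   classes modulo p. *)
Lemma big_step_sigma (T : Type) (idx : T) (op : Monoid.com_law idx) p M (F : nat -> T) :
  (0 < p)%N ->
  \big[op/idx]_(i < p) \big[op/idx]_(j < step_sigma p M i) F (i + j * p)%N =
  \big[op/idx]_(n < M) F n.
Proof.
move=> p0; elim: M => [|M IH].
  by rewrite big_ord0 big1// => i _; rewrite /step_sigma div0n mod0n ltn0 big_ord0.
rewrite big_ord_recr/= -IH.
have lp := ltn_pmod M p0.
rewrite (bigD1 (Ordinal lp))//= [in RHS](bigD1 (Ordinal lp))//=.
rewrite step_sigmaS// eqxx addn1 big_ord_recr/=.
have -> : step_sigma p M (M %% p) = (M %/ p)%N by rewrite /step_sigma ltnn addn0.
rewrite addnC -divn_eq.
rewrite [in RHS]Monoid.mulmAC/=; congr (op _ _).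
apply: eq_bigr => i; rewrite -val_eqE /= => /negbTE iM.
by rewrite step_sigmaS// iM addn0.
Qed.

Section Exponents.
Variables (R : realType) (p : nat) (beta : p.-tuple R).
Hypotheses (p0 : (0 < p)%N)
  (nonres : forall i h, (i < p)%N -> (h < p)%N -> i != h ->
    beta`_i - beta`_h \isn't a Num.int).

(* The exponents of all the step-line forms, indexed from 0. *)
Definition exponent n : R := beta_ext beta n.+1.

Lemma exponentE n : exponent n = beta`_(n %% p) + (n %/ p)%:R.
Proof. by []. Qed.

Lemma exponentDM n m : exponent (n + m * p) = exponent n + m%:R.
Proof. by rewrite !exponentE addnC modnMDl divnMDl// natrD addrCA addrC. Qed.

Lemma exponent_inj : injective exponent.
Proof.
move=> n m; rewrite !exponentE => E.
have nm : (n %% p = m %% p)%N.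
  apply/eqP; apply: contraT => nm.
  have := nonres (ltn_pmod n p0) (ltn_pmod m p0) nm.
  have -> : beta`_(n %% p) - beta`_(m %% p) = (m %/ p)%:R - (n %/ p)%:R by lra.
  by rewrite rpredB// natr_int.
move: E; rewrite nm => /addrI/eqP; rewrite eqr_nat => /eqP nm'.
by rewrite (divn_eq n p) (divn_eq m p) nm nm'.
Qed.

Lemma beta_shift_exponent k i : (i < p)%N -> (beta_shift beta k)`_i = exponent (k + i).
Proof.
move=> ip; rewrite /beta_shift -[i in LHS]/(val (Ordinal ip)) -tnth_nth tnth_mktuple.
by rewrite /exponent addnS.
Qed.

(** [f] is the identity or the embedding of the reals into the complex numbers, so that one
    regrouping serves both the norms and the kernel. The i-th symbol collects the indices congruent
    to i modulo p. *)
Lemma prod_poch_exponent (K : comNzRingType) (f : R -> K) k M (x : K) :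
  (forall y n, f (y + n%:R) = f y + n%:R) ->
  \prod_(i < p) poch (f (beta_shift beta k)`_i + x) (step_sigma p M i) =
  \prod_(n < M) (f (exponent (k + n)) + x).
Proof.
move=> fD.
rewrite -(big_step_sigma _ M (fun n => f (exponent (k + n)) + x) p0).
apply: eq_bigr => i _; apply: eq_bigr => j _.
by rewrite beta_shift_exponent// addnA exponentDM (fD (exponent _)) addrAC.
Qed.

End Exponents.

Section PowerIndependence.
Variable R : realType.

(* Evaluating at x = e^j reduces the independence of distinct powers of x to
   that of distinct geometric sequences. *)
Lemma powR_independent (M : nat) (e z : nat -> R) : injective z ->
  (forall x : R, 0 < x -> \sum_(n < M) e n * x `^ z n = 0) ->
  forall n, (n < M)%N -> e n = 0.
Proof.
move=> zI e0 n nM.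
pose y (m : nat) : R := expR (z m).
have eX j : \sum_(m < M) e m * y m ^+ j = 0.
  rewrite -[RHS](e0 (expR j%:R)) ?expR_gt0//; apply: eq_bigr => m _.
  by rewrite /powR gt_eqF ?expR_gt0// expRK -expRM_natr.
have eP (P : {poly R}) : \sum_(m < M) e m * P.[y m] = 0.
  under eq_bigr do rewrite horner_coef mulr_sumr.
  rewrite exchange_big big1//= => j _.
  transitivity (P`_j * \sum_(m < M) e m * y m ^+ j); last by rewrite eX mulr0.
  by rewrite mulr_sumr; apply: eq_bigr => m _; rewrite mulrCA.
(* This polynomial vanishes at every y m except y n, which isolates e n. *)
have := eP (\prod_(m < M | m != Ordinal nM) ('X - (y m)%:P)).
rewrite (bigD1 (Ordinal nM))//= [X in _ + X]big1 ?addr0; last first.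
  by move=> m mn; rewrite horner_prod (bigD1 m)//= hornerXsubC subrr mul0r mulr0.
move/eqP; rewrite mulf_eq0 => /orP[/eqP//|].
rewrite horner_prod => /prodf_eq0[m mn]; rewrite hornerXsubC subr_eq0 => /eqP/expR_inj/zI nm.
by move: mn; rewrite -val_eqE /= nm eqxx.
Qed.

End PowerIndependence.

(** * Step-line forms *)

Section StepLineForms.
Variables (R : realType) (p q r s : nat).
Variables (a : q.-tuple R) (b : r.-tuple R) (beta : p.-tuple R).
Hypothesis setting : laguerreI_setting s a b beta.
Implicit Types (S : contour R) (t x : R).

Let p0 := lag_p_gt0 setting.
Let rq : (r < q)%N.
Proof. by rewrite (lag_q setting) -addn1 leq_add2l (lag_s_gt0 setting). Qed.
Let q0 : (0 < q)%N := leq_ltn_trans (leq0n r) rq.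

Let z k n : R := exponent beta (k + n).

Let z_inj k : injective (z k).
Proof. by move=> m n /(exponent_inj p0 (lag_beta_nonres setting)) /addnI. Qed.

Let z_a k n j : (j < q)%N -> -1 < z k n + a`_j.
Proof.
move=> jq; rewrite /z exponentE addrAC ltr_wpDr//.
exact: (lag_beta setting (ltn_pmod _ p0) jq).
Qed.

Let z_b k n h : (h < r)%N -> -1 < z k n + b`_h.
Proof.
move=> hr; have := z_a k n (ltn_trans hr rq); have := lag_ab setting hr; lra.
Qed.

Definition form_nodes k N : seq R := [seq exponent beta (k + n) | n <- iota 0 N.+1].

Let nodes_uniq k N : uniq (form_nodes k N).
Proof. by rewrite map_inj_uniq ?iota_uniq//; exact: z_inj. Qed.

(** Residue of the kernel at the node w; the sign comes from writing each factor w - t as - (t -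
    w). *)
Definition form_coef k N (w : R) : R :=
  (-1) ^+ N.+1 * (\prod_(h < r) rGamma (w + (b`_h + (step_sigma q N h)%:R + 1)) /
    \prod_(j < q) rGamma (w + (a`_j + 1))) / other_prod (form_nodes k N) w.

Let form_denE k N (t : R[i]) : form_den (beta_shift beta k) N t =
  (-1) ^+ N.+1 * \prod_(w <- [seq w%:C | w <- form_nodes k N]) (t - w).
Proof.
rewrite /form_den (@prod_poch_exponent R p beta p0 _ (real_complex R))//; last first.
  by move=> y n; rewrite rmorphD/= rmorph_nat.
rewrite /form_nodes !big_map (_ : iota 0 N.+1 = index_iota 0 N.+1) ?big_mkord; last first.
  by rewrite /index_iota subn0.
have <- : \prod_(n < N.+1) (-1) = (-1) ^+ N.+1 :> R[i] by rewrite prodr_const card_ord.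
rewrite -big_split/=.
by apply: eq_bigr => n _; rewrite mulN1r opprB.
Qed.

Lemma form_hatE S k N x : 0 < x -> admissible_contour q b (beta_shift beta k) S N ->
  form_hat a b (beta_shift beta k) S N x =
  (\sum_(w <- form_nodes k N) form_coef k N w * x `^ w)%:C.
Proof.
move=> x0 [Sc Sin Sout].
pose zs := [seq w%:C | w <- form_nodes k N].
have zs_uniq : uniq zs by rewrite map_inj_uniq//; exact: complexI.
have zs_in w : w \in zs -> encloses S w.
  move=> wzs; apply: Sin; rewrite form_denE (big_rem w)//= subrr mul0r mulr0//.
pose As := [seq (a`_j + 1)%:C | j <- iota 0 q].
pose Bs := [seq (b`_h + (step_sigma q N h)%:R + 1)%:C | h <- iota 0 r].
have Bo (c : R[i]) (m : nat) : c \in Bs -> leaves_out S (- (c + m%:R)).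
  move=> /mapP[h]; rewrite mem_iota => /andP[_ hr] ->.
  apply: Sout; exists h => //; exists m.
  by rewrite opprD addrAC addNr add0r.
have iotaE n (f : nat -> R[i]) : \prod_(j <- iota 0 n) f j = \prod_(j < n) f j.
  by rewrite -(big_mkord xpredT f) /index_iota subn0.
have BsE (t : R[i]) : \prod_(c <- Bs) cGamma (t + c) = form_num q b N t.
  by rewrite /Bs big_map iotaE.
have AsE (t : R[i]) : \prod_(c <- As) cGamma (t + c) = \prod_(j < q) cGamma (t + (a`_j + 1)%:C).
  by rewrite /As big_map iotaE.
have := gamma_residues Sc zs_uniq zs_in As ((-1) ^+ N.+1) x Bo.
rewrite /form_hat => res.
have -> : contour_integral S (fun t : R[i] => form_kernel a b (beta_shift beta k) N t * cpow x t)
  = 2 * pi%:C * 'i%C * \sum_(w <- zs) \prod_(c <- Bs) cGamma (w + c) /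
      \prod_(c <- As) cGamma (w + c) * ((-1) ^+ N.+1 * cpow x w) / other_prod zs w.
  rewrite -res; congr contour_integral; apply/funext => t.
  rewrite /form_kernel form_denE -/zs BsE AsE invfM -exprVn invrN1.
  move: (\prod_(w <- zs) _) (form_num _ _ _ _) (\prod_(j < q) _) (cpow x t) ((-1) ^+ _).
  by move=> u1 u2 u3 u4 u5; ring.
have i0 : 2 * pi%:C * (0 +i* 1) != 0 :> R[i].
  rewrite !mulf_neq0//.
    by rewrite eq_complex /= gt_eqF ?pi_gt0.
  by rewrite eq_complex /= oner_eq0 andbF.
rewrite mulKf//.
have realE (w : R) n (y : nat -> R) : \prod_(h < n) cGamma (w%:C + (y h)%:C) =
    (\prod_(h < n) rGamma (w + y h))%:C.
  by rewrite rmorph_prod; apply: eq_bigr => h _; rewrite -rmorphD cGamma_real.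
have otherE (w : R) : other_prod zs w%:C = (other_prod (form_nodes k N) w)%:C.
  rewrite /other_prod /zs big_map rmorph_prod; apply: eq_big => [v|v _].
    by rewrite (inj_eq (@complexI R)).
  by rewrite rmorphB.
rewrite /zs big_map rmorph_sum; apply: eq_bigr => w _.
rewrite BsE AsE -/zs otherE cpow_real// /form_coef /form_num.
rewrite (realE w r (fun h => b`_h + (step_sigma q N h)%:R + 1)).
rewrite (realE w q (fun j => a`_j + 1)).

rewrite !(rmorphM, fmorphV) rmorphXn rmorphN1.
move: (\prod_(h < r) _) (\prod_(j < q) _) (other_prod _ _) (x `^ w) => u1 u2 u3 u4.
rewrite -[RHS]/((-1) ^+ N.+1 * (u1%:C / u2%:C) / u3%:C * u4%:C).
by move: (u1%:C) (u2%:C) (u3%:C) (u4%:C) => v1 v2 v3 v4; ring.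
Qed.

(** The residue expansion and the components are two combinations of the same powers of x, compared
    at the index N. *)
Lemma form_components_LC S k N (A : p.-tuple {poly R}) :
  admissible_contour q b (beta_shift beta k) S N ->
  form_components a b (beta_shift beta k) S N A ->
  LC N A = form_coef k N (exponent beta (k + N)).
Proof.
move=> Sadm Acomp.
(* K exceeds N and is at least the size of every component, so both combinations fit into the first
   K p exponents. *)
pose K := (N.+1 + \sum_(i < p) size (A`_i)%R)%N.
have AK i : (i < p)%N -> (size (A`_i)%R <= K)%N.
  move=> ip; rewrite /K (bigD1 (Ordinal ip))//=; lia.
have sK i : step_sigma p (K * p) i = K by rewrite /step_sigma mulnK// modnMl ltn0 addn0.
(* The power of index n carries the coefficient of degree n div p in the component n mod p. *)
pose e n := A`_(n %% p)`_(n %/ p) - (if (n < N.+1)%N then form_coef k N (z k n) else 0).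
have NK : (N < K * p)%N by rewrite /K; nia.
have : e N = 0.
  apply: (powR_independent (@z_inj k) _ NK) => x x0.
  under eq_bigr do rewrite mulrBl.
  rewrite sumrB; apply/eqP; rewrite subr_eq0; apply/eqP.
  have := Acomp x x0; rewrite form_hatE// => /complexI E.
  transitivity (\sum_(w <- form_nodes k N) form_coef k N w * x `^ w); last first.
    rewrite /form_nodes big_map (_ : iota 0 N.+1 = index_iota 0 N.+1) ?big_mkord; last first.
      by rewrite /index_iota subn0.
    rewrite (big_ord_widen _ (fun n => form_coef k N (z k n) * x `^ z k n) NK).
    by rewrite big_mkcond/=; apply: eq_bigr => n _; case: ifP; rewrite ?mul0r.
  rewrite E -(big_step_sigma _ _ (fun n => A`_(n %% p)`_(n %/ p) * x `^ z k n) p0).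
  apply: eq_bigr => i _; rewrite sK (horner_coef_wide _ (AK _ (ltn_ord i))) mulr_suml.
  apply: eq_bigr => j _.
  rewrite addnC modnMDl modn_small// divnMDl// divn_small// addn0.
  rewrite beta_shift_exponent// /z (addnC (j * p)%N) addnA exponentDM//.
  by rewrite (gt0_powRD _ _ x0) powR_mulrn ?(ltW x0)//; ring.
rewrite /e ltnSn => /eqP; rewrite subr_eq0 => /eqP <-.
(* The entry of sigma_p(N+1) at index N mod p is N div p + 1. *)
rewrite /LC step_sigmaS ?ltn_pmod// eqxx addn1 /=.
by rewrite /step_sigma ltnn addn0.
Qed.

Lemma rGammaDn x n : 0 < x -> rGamma (x + n%:R) = rGamma x * poch x n.
Proof.
move=> x0; elim: n => [|n IH]; first by rewrite addr0 poch0 mulr1.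
rewrite -natr1 addrA rGammaS ?ltr_wpDr//.
by rewrite IH /poch big_ord_recr/= -/(poch x n); ring.
Qed.

(* The numerator which the integral against the N-th weight attaches to the
   node w; it has degree N. *)
Definition form_roots N : seq R :=
  [seq - (a`_i + 1 + m%:R) | i <- iota 0 q, m <- iota 0 (N %/ q)] ++
  [seq - (b`_h + (N %/ q)%:R + 1) | h <- iota 0 (minn (N %% q) r)] ++
  nseq (N %% q - r) (- ((N %/ q)%:R + 1)).

Definition form_poly N : {poly R} := \prod_(c <- form_roots N) ('X - c%:P).

Lemma size_form_poly N : size (form_poly N) = N.+1.
Proof.
rewrite size_prod_XsubC !size_cat size_allpairs size_map !size_iota size_nseq.
have := divn_eq N q; rewrite mulnC.
by move: (q * _)%N (N %% q)%N => u l ->; lia.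
Qed.

Lemma form_poly_lead N : (form_poly N)`_N = 1.
Proof.
have /monicP : form_poly N \is monic by exact: monic_prod_XsubC.
by rewrite lead_coefE size_form_poly.
Qed.

Lemma form_polyE N w : (form_poly N).[w] =
  \prod_(i < q) poch (w + (a`_i + 1)) (N %/ q) *
  (\prod_(h < minn (N %% q) r) (w + (b`_h + (N %/ q)%:R + 1)) *
   (w + ((N %/ q)%:R + 1)) ^+ (N %% q - r)).
Proof.
rewrite horner_prodXsubC !big_cat/= big_nseq_cond/= big_allpairs_dep/= big_map.
have iotaE n (f : nat -> R) : \prod_(j <- iota 0 n) f j = \prod_(j < n) f j.
  by rewrite -(big_mkord xpredT f) /index_iota subn0.
rewrite !iotaE; congr (_ * (_ * _)).
- apply: eq_bigr => i _; rewrite iotaE; apply: eq_bigr => m _.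
  by rewrite opprK addrA.
- by apply: eq_bigr => h _; rewrite opprK.
- by rewrite opprK iter_mulr mulr1.
Qed.

Let weight_mellin N t : R :=
  \prod_(i < q) rGamma (t + a`_i + 1) / \prod_(h < r) rGamma (t + b`_h + 1) *
  (if (step_chi q N <= r)%N then (t + b`_(step_chi q N).-1 + 1)^-1
   else (t + 1) ^+ (step_chi q N - r).-1).

(** As sigma_q(N) raises the first N mod q entries, the Gamma factors in b leave one linear factor
    for each h < min (N mod q, r); those in a leave Pochhammer symbols of length v. With the power
    of w + v + 1 from the Euler operator these are the factors of [form_poly]. *)
Let form_coef_weight k N w : (forall j, (j < q)%N -> -1 < w + a`_j) ->
  form_coef k N w * weight_mellin N (w + (N %/ q)%:R) =
  (-1) ^+ N.+1 * ((form_poly N).[w] /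
    (if (N %% q < r)%N then w + (b`_(N %% q) + (N %/ q)%:R + 1) else 1) /
    other_prod (form_nodes k N) w).
Proof.
move=> wa; rewrite /form_coef /weight_mellin form_polyE /step_chi /=.
set v := (N %/ q)%N; set j := (N %% q)%N.
have wb h : (h < r)%N -> -1 < w + b`_h.
  move=> hr; have := wa h (ltn_trans hr rq); have := lag_ab setting hr; lra.
have -> : \prod_(i < q) rGamma (w + v%:R + a`_i + 1) =
    \prod_(i < q) rGamma (w + (a`_i + 1)) * \prod_(i < q) poch (w + (a`_i + 1)) v.
  rewrite -big_split; apply: eq_bigr => i _ /=; rewrite -rGammaDn.
    by congr rGamma; ring.
  by have := wa i (ltn_ord i); lra.
have -> : \prod_(h < r) rGamma (w + (b`_h + (step_sigma q N h)%:R + 1)) =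
    \prod_(h < r) rGamma (w + v%:R + b`_h + 1) *
    \prod_(h < minn j r) (w + (b`_h + v%:R + 1)).
  rewrite (big_ord_widen r (fun h => w + (b`_h + v%:R + 1)) (geq_minr j r)).
  rewrite [X in _ * X]big_mkcond -big_split; apply: eq_bigr => h _ /=.
  rewrite ltn_min ltn_ord andbT /step_sigma -/v -/j natrD.
  case: ifP => _; last by rewrite mulr1 addr0; congr rGamma; ring.
  rewrite mulrC (_ : w + (b`_h + v%:R + 1) = w + v%:R + b`_h + 1); last by ring.
  rewrite -rGammaS; first by rewrite (_ : true%:R = 1)//; congr rGamma; ring.
  have := wb h (ltn_ord h); have : 0 <= v%:R :> R by []; lra.
have GA : \prod_(i < q) rGamma (w + (a`_i + 1)) != 0.
  apply/prodf_neq0 => i _; rewrite gt_eqF// rGamma_gt0//.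
  by have := wa i (ltn_ord i); lra.
have GB : \prod_(h < r) rGamma (w + v%:R + b`_h + 1) != 0.
  apply/prodf_neq0 => h _; rewrite gt_eqF// rGamma_gt0//.
  have := wb h (ltn_ord h); have : 0 <= v%:R :> R by []; lra.
move: (other_prod_neq0 (form_nodes k N) w) GA GB.
move: (other_prod _ _) (\prod_(i < q) rGamma _) (\prod_(h < r) rGamma _).
move=> W GA GB W0 GA0 GB0.
move: (\prod_(i < q) poch _ _) (\prod_(h < minn j r) _) ((-1) ^+ _) => X Y e.
case: ifP => jr.
  (* Truncated subtraction: no power of w + v + 1 occurs below r. *)
  have -> : (j - r = 0)%N by apply/eqP; rewrite subn_eq0 ltnW.
  rewrite expr0 (_ : w + (b`_j + v%:R + 1) = w + v%:R + b`_j + 1); last by ring.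
  have : w + v%:R + b`_j + 1 != 0.
    rewrite gt_eqF//; have := wb j jr; have : 0 <= v%:R :> R by []; lra.
  move: (w + _ + _ + 1) => B B0; field.
  by rewrite W0 GA0 GB0 B0.
rewrite (_ : (j.+1 - r).-1 = j - r)%N; last by lia.
rewrite (addrA w); move: ((w + _ + 1) ^+ _) => B; field.
by rewrite W0 GA0 GB0.
Qed.

Let node_a k N w : w \in form_nodes k N -> forall j, (j < q)%N -> -1 < w + a`_j.
Proof. by move=> /mapP[n _ ->] j jq; exact: z_a. Qed.

Lemma g_normE S k N : admissible_contour q b (beta_shift beta k) S N ->
  g_norm a b (beta_shift beta k) S N =
  (-1) ^+ N.+1 * \sum_(w <- form_nodes k N) ((form_poly N).[w] /
    (if (N %% q < r)%N then w + (b`_(N %% q) + (N %/ q)%:R + 1) else 1) /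
    other_prod (form_nodes k N) w).
Proof.
move=> Sadm; pose v := (N %/ q)%N.
(* Order 0, because every term has its own exponent w + v, which is put inside the function. *)
have [_ E] : mellin_at (fun x => \sum_(w <- form_nodes k N) form_coef k N w *
    (x `^ (w + v%:R) * weight a b (step_chi q N) x)) 0
    (\sum_(w <- form_nodes k N) form_coef k N w * weight_mellin N (w + v%:R)).
  apply: (@mellin_at_sum _ _ _ (form_coef k N) (fun w => weight_mellin N (w + v%:R))
    (fun w x => x `^ (w + v%:R) * weight a b (step_chi q N) x)) => w wn.
  have ta i : (i < q)%N -> -1 < w + v%:R + a`_i.
    by move=> iq; rewrite addrAC ltr_wpDr//; exact: node_a wn _ iq.
  have chi : (0 < step_chi q N <= q)%N by rewrite /step_chi /= ltn_pmod.
  have [wi wv] := weight_moment rq (lag_a setting) (lag_ab setting) ta chi.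
  have mI : measurable (`]0, +oo[ : set (measurableTypeR R)) by exact: measurable_itv.
  split; first by apply: (eq_integrable mI) wi => x _; rewrite powRr0 mul1r.
  by rewrite [RHS]/weight_mellin -wv; apply: eq_Rintegral => x _; rewrite powRr0 mul1r.
transitivity (\sum_(w <- form_nodes k N) form_coef k N w * weight_mellin N (w + v%:R)).
  rewrite -E; apply: eq_Rintegral => x; rewrite inE/= in_itv/= andbT => x0.
  rewrite powRr0 mul1r form_hatE//= mulr_sumr mulr_suml; apply: eq_bigr => w _.
  rewrite (gt0_powRD _ _ x0) powR_mulrn ?(ltW x0)// -/v.
  by move: (form_coef _ _ _) (weight _ _ _ _) => c W; ring.
rewrite mulr_sumr big_seq [RHS]big_seq; apply: eq_bigr => w wn.
by rewrite form_coef_weight//; exact: node_a wn.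
Qed.

Lemma g_norm_sign S k N : admissible_contour q b (beta_shift beta k) S N ->
  (r <= N %% q)%N -> g_norm a b (beta_shift beta k) S N = (-1) ^+ N.+1.
Proof.
move=> Sadm rN; rewrite g_normE// ltnNge rN /=.
under eq_bigr do rewrite divr1.
have sn : size (form_nodes k N) = N.+1 by rewrite size_map size_iota.
rewrite lagrange_lead ?size_form_poly ?sn//.
by rewrite form_poly_lead mulr1.
Qed.

Lemma g_norm_closed_form S k N : admissible_contour q b (beta_shift beta k) S N ->
  (N %% q < r)%N ->
  g_norm a b (beta_shift beta k) S N =
  - ((\prod_(i < q) poch (a`_i - (b`_(N %% q) + (N %/ q)%:R)) (N %/ q) *
      \prod_(h < N %% q) (b`_h - b`_(N %% q))) /
     \prod_(i < p) poch ((beta_shift beta k)`_i + (b`_(N %% q) + (N %/ q)%:R + 1))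
        (step_sigma p N.+1 i)).
Proof.
move=> Sadm jr; rewrite g_normE// jr.
set v := (N %/ q)%N; set j := (N %% q)%N; pose c : R := - (b`_j + v%:R + 1).
have sn : size (form_nodes k N) = N.+1 by rewrite size_map size_iota.
(* w - c = w + b_j + v + 1 is positive, so c is a new node. *)
have wc w : w \in form_nodes k N -> w != c.
  move=> wn; rewrite -subr_eq0 /c opprK gt_eqF//.
  have := node_a wn (ltn_trans jr rq); have := lag_ab setting jr.
  by rewrite -/j; have : 0 <= v%:R :> R by []; lra.
have cn : c \notin form_nodes k N by apply/negP => /wc; rewrite eqxx.
have cu : uniq (c :: form_nodes k N) by rewrite cons_uniq cn nodes_uniq.
(* There are N + 2 nodes for a polynomial of size N + 1, so the coefficient of index N + 1 is
   read. *)
have := @lagrange_lead _ (c :: form_nodes k N) (form_poly N) cu.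
have -> : size (c :: form_nodes k N) = N.+2 by rewrite -sn.
rewrite size_form_poly leqnSn => /(_ isT).
rewrite [RHS]nth_default ?size_form_poly//.
rewrite big_cons => lag.
have other w : w \in form_nodes k N ->
    other_prod (c :: form_nodes k N) w = (w - c) * other_prod (form_nodes k N) w.
  by move=> wn; rewrite /other_prod big_cons eq_sym wc.
have otherc : other_prod (c :: form_nodes k N) c = \prod_(w <- form_nodes k N) (c - w).
  rewrite /other_prod big_cons eqxx big_seq_cond [RHS]big_seq; apply: eq_bigl => w.
  by case wn : (w \in _); rewrite // wc.
have -> : \sum_(w <- form_nodes k N) (form_poly N).[w] / (w + (b`_j + v%:R + 1)) /
    other_prod (form_nodes k N) w = - ((form_poly N).[c] / \prod_(w <- form_nodes k N) (c - w)).
  apply/eqP; rewrite -addr_eq0 -otherc addrC -[X in _ == X]lag; apply/eqP.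
  congr (_ + _); rewrite big_seq [RHS]big_seq; apply: eq_bigr => w wn.
  by rewrite other// /c opprK invfM mulrA.
rewrite form_polyE -/v -/j; have -> : (j - r = 0)%N by apply/eqP; rewrite subn_eq0 ltnW.
rewrite expr0 mulr1 (minn_idPl (ltnW jr)).
have -> : \prod_(i < q) poch (c + (a`_i + 1)) v = \prod_(i < q) poch (a`_i - (b`_j + v%:R)) v.
  by apply: eq_bigr => i _; congr poch; rewrite /c; ring.
have -> : \prod_(h < j) (c + (b`_h + v%:R + 1)) = \prod_(h < j) (b`_h - b`_j).
  by apply: eq_bigr => h _; rewrite /c; ring.
rewrite (@prod_poch_exponent R p beta p0 _ id)//.
have -> : \prod_(w <- form_nodes k N) (c - w) =
    (-1) ^+ N.+1 * \prod_(n < N.+1) (exponent beta (k + n) + (b`_j + v%:R + 1)).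
  rewrite /form_nodes big_map (_ : iota 0 N.+1 = index_iota 0 N.+1) ?big_mkord; last first.
    by rewrite /index_iota subn0.
  have <- : \prod_(n < N.+1) (-1) = (-1) ^+ N.+1 :> R by rewrite prodr_const card_ord.
  rewrite -big_split/=.
  by apply: eq_bigr => n _; rewrite mulN1r [RHS]opprD [RHS]addrC.
(* The sign from the factors c - w cancels the one in front of the norm. *)
rewrite invfM -exprVn invrN1; move: (_ * \prod_(h < j) _) (\prod_(n < N.+1) _) => X Y.
rewrite mulrN mulrCA (mulrA ((-1) ^+ _)) -signr_odd -signr_addb addbb expr0 mul1r.
by [].
Qed.

(** The nodes for (k, N + 1) are those for (k + 1, N) preceded by [exponent beta k], and sigma_q(N +
    1) exceeds sigma_q(N) only at index N mod q. The minus sign is (-1)^(N+1) over (-1)^(N+2). *)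
Lemma form_coef_ratio k N (w := exponent beta (k.+1 + N)) :
  form_coef k.+1 N w / form_coef k N.+1 w =
  - ((w - exponent beta k) /
     (if (N %% q < r)%N then w + (b`_(N %% q) + (N %/ q)%:R + 1) else 1)).
Proof.
set v := (N %/ q)%N; set j := (N %% q)%N.
have wz : w = z k.+1 N by [].
have wa := z_a k.+1 N; have wb := z_b k.+1 N; rewrite -wz in wa wb.
have we : w - exponent beta k != 0.
  rewrite subr_eq0 -[k in exponent beta k]addn0 /w addSnnS.
  by rewrite (inj_eq (z_inj (k := k))).
have nodesE : form_nodes k N.+1 = exponent beta k :: form_nodes k.+1 N.
  rewrite /form_nodes; have -> : iota 0 N.+2 = 0%N :: map (addn 1) (iota 0 N.+1).
    by rewrite -iotaDl.
  rewrite map_cons -map_comp addn0; congr (_ :: _); apply: eq_map => n /=.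
  by rewrite add1n addSnnS.
have otherE : other_prod (form_nodes k N.+1) w =
    (w - exponent beta k) * other_prod (form_nodes k.+1 N) w.
  by rewrite nodesE /other_prod big_cons eq_sym -subr_eq0 we.
have gammaE : \prod_(h < r) rGamma (w + (b`_h + (step_sigma q N.+1 h)%:R + 1)) =
    \prod_(h < r) rGamma (w + (b`_h + (step_sigma q N h)%:R + 1)) *
    (if (j < r)%N then w + (b`_j + v%:R + 1) else 1).
  have -> : (if (j < r)%N then w + (b`_j + v%:R + 1) else 1) =
      \prod_(h < r) (if h == j :> nat then w + (b`_h + v%:R + 1) else 1).
    case: ifP => jr.
      rewrite (bigD1 (Ordinal jr))//= eqxx big1 ?mulr1// => h.
      by rewrite -val_eqE /= => /negbTE ->.
    rewrite big1// => h _; case: eqP => // hj.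
    by move: jr; rewrite -hj ltn_ord.
  rewrite -big_split; apply: eq_bigr => h _ /=.
  rewrite step_sigmaS ?(ltn_trans _ rq)// -/j.
  case: eqP => [hj|_]; last by rewrite addn0 mulr1.
  have -> : step_sigma q N h = v by rewrite /step_sigma hj ltnn addn0.
  have hb : 0 < w + (b`_h + v%:R + 1).
    have := wb h (ltn_ord h); have : 0 <= v%:R :> R by []; lra.
  by rewrite mulrC -rGammaS// natrD (_ : true%:R = 1)//; congr rGamma; ring.
have GA : \prod_(i < q) rGamma (w + (a`_i + 1)) != 0.
  apply/prodf_neq0 => i _; rewrite gt_eqF// rGamma_gt0//.
  by have := wa i (ltn_ord i); lra.
have GB : \prod_(h < r) rGamma (w + (b`_h + (step_sigma q N h)%:R + 1)) != 0.
  apply/prodf_neq0 => h _; rewrite gt_eqF// rGamma_gt0//.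
  have := wb h (ltn_ord h); have : 0 <= (step_sigma q N h)%:R :> R by []; lra.
have E0 : (if (j < r)%N then w + (b`_j + v%:R + 1) else 1) != 0.
  case: ifP => // jr; rewrite gt_eqF//.
  have := wb j jr; have : 0 <= v%:R :> R by []; lra.
have W0 := other_prod_neq0 (form_nodes k.+1 N) w.
rewrite /form_coef otherE gammaE (exprS _ N.+1).
move: (other_prod _ _) (\prod_(i < q) _) (\prod_(h < r) _) (if _ then _ else _)
  (w - exponent _ _) W0 GA GB E0 we.
have e0 : (-1) ^+ N.+1 != 0 :> R by rewrite signr_eq0.
move: ((-1) ^+ N.+1) e0 => e e0 W GA' GB' E' D W0 GA0 GB0 E0 D0.
by field; rewrite W0 GA0 GB0 E0 D0 e0.
Qed.

End StepLineForms.

(** * Entries of the lower bidiagonal factors *)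

Theorem theorem7p4 (R : realType) (p q r s : nat)
    (a : q.-tuple R) (b : r.-tuple R) (beta : p.-tuple R)
    (setting : laguerreI_setting s a b beta)
    (normal : normality a b beta)
    (Sig : nat -> nat -> contour R)
    (Sig_adm : forall k N, (k <= p)%N ->
       admissible_contour q b (beta_shift beta k) (Sig k N) N)
    (A : nat -> nat -> p.-tuple {poly R})
    (A_comp : forall k N, (k <= p)%N ->
       form_components a b (beta_shift beta k) (Sig k N) N (A k N))
    (g := fun k N : nat => g_norm a b (beta_shift beta k) (Sig k N) N)
    (g_neq0 : forall k N, (k <= p)%N -> g k N != 0)
    (Lgb Lgb' Ugb Ugb' : smx R)
    (GB : gauss_borel (moment_matrix a b beta) Lgb Lgb' Ugb Ugb')
    (L U : nat -> smx R)
    (CGB : CGB_factorization p q (recurrence_matrix q Lgb Lgb')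
       (fun k N => LC N (normalized a b (beta_shift beta k) (Sig k N) N (A k N)))
       L U) :
  (forall k N : nat, (1 <= k <= p)%N ->
     let u := (N %/ p)%N in
     let l := (N %% p)%N in
     let v := (N %/ q)%N in
     let D := beta_ext beta (k + l + 1) - beta_ext beta k + u%:R in
     let E c := beta_ext beta (k + l + 1) + u%:R + 1 + c + v%:R in
     (r = 0%N -> L k N.+1 N = D) /\
     ((0 < r)%N ->
       [/\ (step_chi q N < r)%N ->
             L k N.+1 N =
               - (g k.-1 N.+1 / g k N) * (D / E b`_(step_chi q N).-1),
           step_chi q N = r ->
             L k N.+1 N = - ((-1) ^+ N.+2 / g k N) * (D / E b`_r.-1),
           (r < step_chi q N < q)%N ->
             L k N.+1 N = D
         & step_chi q N = q ->
             L k N.+1 N = - (g k.-1 N.+1 / (-1) ^+ N.+1) * D])) /\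
  (forall k M : nat, (k <= p)%N -> (step_chi q M <= r)%N ->
     let v := (M %/ q)%N in
     let c := b`_(step_chi q M).-1 in
     g k M =
       - ((\prod_(i < q) poch (a`_i - (c + v%:R)) v *
           \prod_(h < (step_chi q M).-1) (b`_h - c)) /
          \prod_(i < p) poch ((beta_shift beta k)`_i + (c + v%:R + 1))
                             (step_sigma p M.+1 i))).
Proof.
have p0 := lag_p_gt0 setting.
have rq : (r < q)%N by rewrite (lag_q setting) -addn1 leq_add2l (lag_s_gt0 setting).
(* One formula for all cases: the [if] is the denominator present exactly when chi_N <= r. *)
have LE k N : (k < p)%N -> L k.+1 N.+1 N = - (g k N.+1 / g k.+1 N) *
    ((exponent beta (k.+1 + N) - exponent beta k) /
     (if (N %% q < r)%N then
        exponent beta (k.+1 + N) + (b`_(N %% q) + (N %/ q)%:R + 1) else 1)).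
  move=> kp; have kp' : (0 < k.+1 <= p)%N by [].
  have [_ ->] := cgb_lc CGB N kp'.
  have lcE j M : (j <= p)%N ->
      LC M (normalized a b (beta_shift beta j) (Sig j M) M (A j M)) =
      (g j M)^-1 * form_coef a b beta j M (exponent beta (j + M)).
    move=> jp.
    rewrite -(form_components_LC setting (Sig_adm j M jp) (A_comp j M jp)) /LC.
    have := tnth_mktuple (fun i : 'I_p => (g j M)^-1 *: (A j M)`_i) (Ordinal (ltn_pmod M p0)).
    by rewrite (tnth_nth 0) /normalized => ->; rewrite coefZ.
  (* k + 1 + N = k + (N + 1): both leading coefficients belong to the same exponent, as
     [form_coef_ratio] requires. *)
  rewrite !lcE// ?(ltnW kp)// -[in X in _ / X]addSnnS mulNr -mulrN -(form_coef_ratio setting) succnK.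
  move: (g_neq0 k.+1 N kp) (g_neq0 k N.+1 (ltnW kp)).
  move: (g _ _) (g _ _) (form_coef _ _ _ _ _ _) (form_coef _ _ _ _ _ _) => u v c d u0 v0.
  by rewrite invfM invrK; ring.
have signE k N : (k <= p)%N -> (r <= N %% q)%N -> g k N = (-1) ^+ N.+1.
  by move=> kp rN; apply: (g_norm_sign setting) => //; exact: Sig_adm.
split=> [[//|k] N kp u l v D E|k M kp chi v c]; last first.
  by rewrite /g (g_norm_closed_form setting (Sig_adm k M kp)).
have kp' : (k < p)%N by [].
(* Writing N = u p + l takes u out of the cyclic index. *)
have wE : exponent beta (k.+1 + N) = beta_ext beta (k.+1 + l + 1) + u%:R.
  by rewrite {1}(divn_eq N p) addnCA addnC exponentDM// /exponent addn1.
have DE : exponent beta (k.+1 + N) - exponent beta k = D.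
  by rewrite wE /D /exponent addrAC.
have EE c : exponent beta (k.+1 + N) + (c + v%:R + 1) = E c by rewrite wE /E; ring.
have s0 n : (-1) ^+ n != 0 :> R by rewrite signr_eq0.
have jq : (N %% q < q)%N by rewrite ltn_pmod// (leq_ltn_trans _ rq).
have nextE : (N %% q).+1 != q -> (N.+1 %% q = (N %% q).+1)%N.
  move=> jq1; rewrite modnS; case: ifP => // qN; exfalso; move: qN.
  rewrite {1}(divn_eq N q) -addnS dvdn_addr ?dvdn_mull// => /dvdn_leq => /(_ isT) qj.
  by move: jq1; rewrite eqn_leq jq qj.
(* Both norms are signs, of opposite parity, so their ratio is -1. *)
have LD : (r <= N %% q)%N -> (N %% q).+1 != q -> L k.+1 N.+1 N = D.
  move=> rN /nextE N1; rewrite LE// ltnNge rN/= divr1 DE !signE ?N1 ?(ltnW kp')// ?(leqW rN)//.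
  by rewrite (exprS _ N.+1) mulfK//; ring.
(* N + 1 may have residue 0 modulo q, where its norm need not be a sign; it is kept. *)
have LDq : (r <= N %% q)%N -> L k.+1 N.+1 N = - (g k N.+1 / (-1) ^+ N.+1) * D.
  by move=> rN; rewrite LE// ltnNge rN/= divr1 DE (signE k.+1).
have LDE : (N %% q < r)%N ->
    L k.+1 N.+1 N = - (g k N.+1 / g k.+1 N) * (D / E b`_(N %% q)).
  by move=> Nr; rewrite LE// Nr DE EE.
split=> [r0|r0].
  (* For r = 0 every norm is a sign, even when the residue of N + 1 returns to 0. *)
  have [qN|] := eqVneq (N %% q).+1 q; last by apply: LD; rewrite r0.
  by rewrite LDq ?r0// signE ?r0 ?(ltnW kp')// (exprS _ N.+1) mulfK//; ring.
split; rewrite /step_chi /=.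
- by move=> /ltnW; exact: LDE.
- move=> jr; have jr' : (N %% q < r)%N by rewrite -jr.
  (* As chi_N = r < q, the residue of N + 1 is r and its norm is a sign. *)
  rewrite LDE//; have N1 : (N.+1 %% q)%N = r by rewrite nextE// jr ltn_eqF.
  have -> : r.-1 = (N %% q)%N by rewrite -jr.
  by rewrite (signE k) ?N1 ?(ltnW kp').
- by move=> /andP[rN Nq]; apply: LD; [rewrite -ltnS|rewrite ltn_eqF].
- by move=> jq'; apply: LDq; rewrite -ltnS jq'.
Qed.
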